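(* Assume that $\operatorname{rank}(X)=p$, and let $t=\operatorname{rank}\left(Z^T(I-P_X)Z\right)$ and $\mathrm{SSE}=\|(I-P_W)y\|^2$. If the following four conditions hold, then the Gibbs--Markov chain $\{(\theta_n,\sigma_n^2)\}_{n=0}^\infty$ is geometrically ergodic: (A) for each $i\in\{1,2,\ldots,r\}$, one of the following holds: (A1) $a_i<b_i=0$; (A2) $b_i>0$; (B$'$) for each $i\in\{1,2,\ldots,r\}$, $q_i+2a_i>q-t+2$; (C$'$) $N+2a_e>p+t+2$; (D) $2b_e+\mathrm{SSE}>0$.
   Context: Model. $X$ and $Z$ are known real matrices of dimensions $N\times p$ and $N\times q$; $q=q_1+\cdots+q_r$ with $r\ge1$ and $Z=(Z_1\ Z_2\ \cdots\ Z_r)$, $Z_i$ being $N\times q_i$. The general linear mixed model is $Y=X\beta+Zu+e$, with $\beta\in\mathbb R^p$, $u=(u_1^T\ \cdots\ u_r^T)^T\in\mathbb R^q$ ($u_i\in\mathbb R^{q_i}$), $u\sim\mathrm N_q(0,D)$ independent of $e\sim\mathrm N_N(0,\sigma_e^2I)$, $D=\bigoplus_{i=1}^r\sigma_{u_i}^2I_{q_i}$. The observed data vector $y\in\mathbb R^N$ is fixed. Write $\theta=(\beta^T\ u^T)^T\in\mathbb R^{p+q}$, $W=(X\ Z)$, $\sigma^2=(\sigma_e^2\ \sigma_{u_1}^2\ \cdots\ \sigma_{u_r}^2)^T\in\mathbb R_+^{r+1}$, $\mathbb R_+=(0,\infty)$. For a matrix $A$, $P_A$ is the orthogonal projection onto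 its column space. Prior. For fixed real hyperparameters $a=(a_e,a_1,\ldots,a_r)$, $b=(b_e,b_1,\ldots,b_r)$, $$p(\beta,\sigma^2;a,b)=(\sigma_e^2)^{-(a_e+1)}e^{-b_e/\sigma_e^2}\left[\prod_{i=1}^r(\sigma_{u_i}^2)^{-(a_i+1)}e^{-b_i/\sigma_{u_i}^2}\right]I_{\mathbb R_+^{r+1}}(\sigma^2).$$ The unnormalized posterior is $\pi^*(\theta,\sigma^2|y)=\phi_N(y;W\theta,\sigma_e^2I)\,\phi_q(u;0,D)\,p(\beta,\sigma^2;a,b)$, with $\phi_d(x;\mu,\Sigma)$ the $\mathrm N_d(\mu,\Sigma)$ density at $x$. Let $m(y)=\int_{\mathbb R_+^{r+1}}\int_{\mathbb R^{p+q}}\pi^*(\theta,\sigma^2|y)\,d\theta\,d\sigma^2$. The posterior is proper if $m(y)<\infty$, in which case the posterior density is $\pi(\theta,\sigma^2|y)=\pi^*(\theta,\sigma^2|y)/m(y)$ and $\Pi$ denotes the corresponding probability distribution. Propriety is not assumed a priori. Gibbs--Markov chain. The chain is well defined when $\operatorname{rank}(X)=p$, all $b_i\ge0$ ($i=1,\ldots,r$), $2b_e+\mathrm{SSE}>0$, and $\min\{q_1+2a_1,\ldots,q_r+2a_r,N+2a_e\}>0$ (all implied by the hypotheses of the claim). Then $\pi(\theta|\sigma^2,y)=\pi^*(\theta,\sigma^2|y)/\int_{\mathbb R^{p+q}}\pi^*(\theta,\sigma^2|y)\,d\theta$ is the multivariate normal density with mean $$\begin{pmatrix}(X^TX)^{-1}X^T\left(I-(\sigma_e^2)^{-1}ZQ^{-1}Z^T(I-P_X)\right)y\\(\sigma_e^2)^{-1}Q^{-1}Z^T(I-P_X)y\end{pmatrix}$$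 and covariance matrix $$\begin{pmatrix}\sigma_e^2(X^TX)^{-1}+RQ^{-1}R^T&-RQ^{-1}\\-Q^{-1}R^T&Q^{-1}\end{pmatrix},$$ where $Q=(\sigma_e^2)^{-1}Z^T(I-P_X)Z+D^{-1}$ and $R=(X^TX)^{-1}X^TZ$. Let $f_{\mathrm{IG}}(v;c,d)=\frac{d^c}{\Gamma(c)v^{c+1}}e^{-d/v}$ for $v>0$ and $0$ for $v\le0$ ($c,d>0$). Let $A=\{i:b_i=0\}$ (indices $i\in\{1,\ldots,r\}$) and $\mathcal N=\{\theta\in\mathbb R^{p+q}:\prod_{i\in A}\|u_i\|=0\}$ ($\mathcal N=\varnothing$ if $A=\varnothing$). For $\theta\notin\mathcal N$, $$\pi(\sigma^2|\theta,y)=f_{\mathrm{IG}}\left(\sigma_e^2;\tfrac N2+a_e,\,b_e+\tfrac{\|y-W\theta\|^2}{2}\right)\prod_{i=1}^rf_{\mathrm{IG}}\left(\sigma_{u_i}^2;\tfrac{q_i}2+a_i,\,b_i+\tfrac{\|u_i\|^2}2\right),$$ and for $\theta\in\mathcal N$, $\pi(\sigma^2|\theta,y)=f_{\mathrm{IG}}(\sigma_e^2;1,1)\prod_{i=1}^rf_{\mathrm{IG}}(\sigma_{u_i}^2;1,1)$. The Gibbs--Markov chain $\{(\theta_n,\sigma_n^2)\}_{n\ge0}$ is the Markov chain on $\mathsf X=\mathbb R^{p+q}\times\mathbb R_+^{r+1}$ with transition density (with respect to Lebesgue measure) $k(\theta,\sigma^2|\tilde\theta,\tilde\sigma^2)=\pi(\sigma^2|\theta,y)\,\pi(\theta|\tilde\sigma^2,y)$.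 Geometric ergodicity. With $P^n$ the $n$-step transition function, the chain is geometrically ergodic if (the posterior is proper and) there exist $M:\mathsf X\to[0,\infty)$ and $\varrho\in[0,1)$ such that $\|P^n((\theta,\sigma^2),\cdot)-\Pi(\cdot)\|_{\mathrm{TV}}\le M(\theta,\sigma^2)\varrho^n$ for all $(\theta,\sigma^2)\in\mathsf X$ and all $n=0,1,\ldots$, where $\|\cdot\|_{\mathrm{TV}}$ is the total variation norm. *)

(* Defs.v *)
From HB Require Import structures.
From mathcomp Require Import all_boot all_order all_algebra.
From mathcomp Require Import all_classical all_reals all_analysis.

Set Implicit Arguments.
Unset Strict Implicit.
Unset Printing Implicit Defensive.

Import Order.TTheory GRing.Theory Num.Theory.
Import numFieldNormedType.Exports.

Local Open Scope classical_set_scope.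
Local Open Scope ring_scope.

(* Points of R^n are tuples rather than matrices because only the former carry a
   (Borel) sigma-algebra in the library. *)
Notation Rvec R n := (n.-tuple (measurableTypeR R)).

Definition col_of (R : realType) n (x : Rvec R n) : 'cV[R]_n :=
  \col_i tnth x i.

Definition posvec (R : realType) n : set (Rvec R n) :=
  [set s | forall i, 0 < (tnth s i : R)].

Section lebesgue_vec.
Context (R : realType).

Definition consv n (x : measurableTypeR R * Rvec R n) : Rvec R n.+1 :=
  [tuple of x.1 :: x.2].

Lemma measurable_consv n : measurable_fun setT (@consv n).
Proof. exact: measurable_cons. Qed.

Section step.
Variables (n : nat) (mu : {sigma_finite_measure set (Rvec R n) -> \bar R}).

Definition lebesgue_cons : set (Rvec R n.+1) -> \bar R :=
  pushforward (lebesgue_measure \x mu)%E (@consv n).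

Let lebesgue_cons0 : lebesgue_cons set0 = 0%E.
Proof. by rewrite /lebesgue_cons /pushforward preimage_set0 measure0. Qed.

Let lebesgue_cons_ge0 A : (0 <= lebesgue_cons A)%E.
Proof. by rewrite /lebesgue_cons /pushforward; exact: measure_ge0. Qed.

Let lebesgue_cons_sigma_additive : semi_sigma_additive lebesgue_cons.
Proof.
have mpre A : measurable A -> measurable (@consv n @^-1` A).
  by move=> mA; rewrite -[X in measurable X]setTI; exact: measurable_consv.
move=> F mF tF mUF; rewrite /lebesgue_cons /pushforward preimage_bigcup.
apply: measure_semi_sigma_additive.
- by move=> i; exact: mpre.
- apply/trivIsetP => /= i j _ _ ij; rewrite -preimage_setI.
  by move/trivIsetP : tF => /(_ _ _ _ _ ij) ->//; rewrite preimage_set0.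
- by rewrite -preimage_bigcup; exact: mpre.
Qed.

HB.instance Definition _ := isMeasure.Build _ _ _ lebesgue_cons
  lebesgue_cons0 lebesgue_cons_ge0 lebesgue_cons_sigma_additive.

Let unconsvK x : (thead (@consv n x), [tuple of behead (consv x)]) = x.
Proof.
case: x => x t; rewrite /consv /=; congr (_, _).
by apply/val_inj.
Qed.

Let sigma_finite_lebesgue_cons : sigma_finite setT lebesgue_cons.
Proof.
have /sigma_finiteP[F [TF ndF Foo]] := sigma_finiteT (@lebesgue_measure R).
have /sigma_finiteP[G [TG ndG Goo]] := sigma_finiteT mu.
pose g (x : Rvec R n.+1) := (thead x, [tuple of behead x]).
have mg : measurable_fun setT g.
  apply/measurable_fun_pairP; split; first exact: measurable_tnth.
  exact: measurable_behead.
exists (fun i => g @^-1` (F i `*` G i)).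
  rewrite -preimage_bigcup (_ : \bigcup_i _ = setT) ?preimage_setT//.
  rewrite -setXTT TF TG predeqE => -[x y]; split.
    by move=> [i _ []/= ? ?]; split; exists i.
  move=> [/= [i _ Fx] [k _ Gy]]; exists (maxn i k) => //; split.
  - by move: x Fx; exact/subsetPset/ndF/leq_maxl.
  - by move: y Gy; exact/subsetPset/ndG/leq_maxr.
move=> i; have [? ?] := Foo i; have [? ?] := Goo i.
split.
  by rewrite -[X in measurable X]setTI; apply: mg => //; exact: measurableX.
rewrite /lebesgue_cons /pushforward -comp_preimage.
rewrite (_ : g \o _ = id); last by apply/funext => x; exact: unconsvK.
by rewrite product_measure1E// lte_mul_pinfty// ge0_fin_numE.
Qed.

HB.instance Definition _ :=
  Measure_isSigmaFinite.Build _ _ _ lebesgue_cons sigma_finite_lebesgue_cons.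

End step.

(* Lebesgue measure on R^n: the n-fold product of [lebesgue_measure]. *)
Fixpoint lebesgue_vec n : {sigma_finite_measure set (Rvec R n) -> \bar R} :=
  if n is n'.+1 then lebesgue_cons (lebesgue_vec n') else \d_[tuple].

Lemma lebesgue_vec_box n (A : 'I_n -> set (measurableTypeR R)) :
  (forall i, measurable (A i)) ->
  lebesgue_vec n [set x | forall i, A i (tnth x i)] =
  (\prod_(i < n) lebesgue_measure (A i))%E.
Proof.
elim: n A => [|n IHn] A mA.
  by rewrite big_ord0 /= diracE mem_set//= => -[].
rewrite big_ord_recl -IHn// /lebesgue_vec -/lebesgue_vec /= /lebesgue_cons.
rewrite /pushforward -product_measure1E//; last first.
  rewrite [X in measurable X](_ : _ =
    \bigcap_(i in setT) (@tnth n _ ^~ i @^-1` A (lift ord0 i))).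
    apply: fin_bigcap_measurable => // i _.
    by rewrite -[X in measurable X]setTI; exact: measurable_tnth.
  by apply/seteqP; split=> [x + i _|x + i]; [exact|exact].
congr (_ \x _)%E; apply/seteqP; split=> -[x t] /= xt.
  split=> [|i]; first by have := xt ord0.
  by have := xt (lift ord0 i); rewrite tnthS.
by move=> i; case: (unliftP ord0 i) => [j|] ->;
  rewrite ?tnthS; [exact: xt.2|exact: xt.1].
Qed.

End lebesgue_vec.

Section linear_algebra.
Context (R : realType).

Definition enorm n (v : 'cV[R]_n) : R := Num.sqrt (\sum_i v i 0 ^+ 2).

(* MathComp projections act on row vectors, hence the transpositions: this is
   the projection onto the column space of A along its orthogonal complement
   {v | v^T A = 0}; see [orthoprojP]. *)
Definition orthoproj m n (A : 'M[R]_(m, n)) : 'M[R]_m :=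
  (proj_mx <<A^T>>%MS (kermx A))^T.

Lemma orthoproj_direct m n (A : 'M[R]_(m, n)) :
  (<<A^T>> :&: kermx A)%MS = 0 /\ (1%:M <= <<A^T>> + kermx A)%MS.
Proof.
have AK : (<<A^T>> :&: kermx A)%MS = 0.
  apply/eqP; rewrite -submx0; apply/rV_subP => v.
  rewrite sub_capmx genmxE => /andP[/submxP[w vE] /sub_kermxP vA].
  suff -> : v = 0 by exact: sub0mx.
  have vv : v *m v^T = 0.
    by rewrite {2}vE trmx_mul trmxK mulmxA vA mul0mx.
  apply/rowP => i; rewrite mxE; apply/eqP; rewrite -sqrf_eq0.
  move/matrixP: vv => /(_ 0 0)/eqP; rewrite !mxE psumr_eq0; last first.
    by move=> j _; rewrite mxE -expr2 sqr_ge0.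
  by move=> /allP/(_ i); rewrite mem_index_enum => /(_ isT); rewrite mxE -expr2.
split=> //; rewrite sub1mx /row_full; apply/eqP.
have := mxrank_sum_cap <<A^T>>%MS (kermx A).
rewrite AK mxrank0 addn0 => ->; rewrite genmxE mxrank_tr mxrank_ker subnKC//.
exact: rank_leq_row.
Qed.

Lemma orthoprojP m n (A : 'M[R]_(m, n)) :
  [/\ (orthoproj A)^T = orthoproj A,
      orthoproj A *m orthoproj A = orthoproj A &
      ((orthoproj A)^T :=: A^T)%MS].
Proof.
have [AK AT] := orthoproj_direct A.
have KA : (kermx A :&: <<A^T>>)%MS = 0 by rewrite capmxC.
set P := proj_mx <<A^T>>%MS (kermx A).
set Q := proj_mx (kermx A) <<A^T>>%MS.
have PT : (orthoproj A)^T = P by rewrite /orthoproj trmxK.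
have PA : (P <= A^T)%MS.
  by have := proj_mx_sub <<A^T>>%MS (kermx A) 1%:M; rewrite mul1mx genmxE.
have PQ : P + Q = 1%:M.
  by rewrite -(add_proj_mx AK AT) !mul1mx.
have QA : Q *m A = 0.
  by apply/sub_kermxP; have := proj_mx_sub (kermx A) <<A^T>>%MS 1%:M; rewrite mul1mx.
have QP : Q *m P^T = 0.
  have /submxP[B PE] := PA.
  by rewrite PE trmx_mul trmxK mulmxA QA mul0mx.
have PP : P^T = P *m P^T.
  by rewrite -{1}(mul1mx P^T) -PQ mulmxDl QP addr0.
have Psym : P^T = P.
  by have := congr1 trmx PP; rewrite trmxK trmx_mul trmxK -PP => {2}->.
split.
- by rewrite PT /orthoproj -/P Psym.
- by rewrite /orthoproj -/P; move: PP; rewrite Psym => /esym.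
- rewrite PT; apply/eqmxP/andP; split=> //.
  have := @proj_mx_id _ _ _ _ _ A^T AK; rewrite genmxE submx_refl => /(_ isT) {1}<-.
  exact: submxMl.
Qed.

(* Density at x of the multivariate normal law with mean m and covariance S. *)
Definition mvn_pdf n (x m : 'cV[R]_n) (S : 'M[R]_n) : R :=
  expR (- (((x - m)^T *m invmx S *m (x - m)) 0 0 / 2)) /
  Num.sqrt ((2 * pi) ^+ n * \det S).

Definition Gamma (c : R) : R :=
  \int[@lebesgue_measure R]_(t in `]0, +oo[) (t `^ (c - 1) * expR (- t)).

(* Inverse gamma density. *)
Definition ig_pdf (c d v : R) : R :=
  if 0 < v then d `^ c / (Gamma c * v `^ (c + 1)) * expR (- d / v) else 0.

End linear_algebra.

Section markov_chain.
Context d (T : measurableType d) (R : realType).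
Variables (mu : {measure set T -> \bar R}) (S : set T).
Local Open Scope ereal_scope.

(* n-step transition function of the chain on S whose transition density with
   respect to mu is [k] ([k z x] is the density at z of a step from x). *)
Fixpoint nstep (k : T -> T -> R) (n : nat) (x : T) (A : set T) : \bar R :=
  if n is n'.+1 then \int[mu]_(z in S) ((k z x)%:E * nstep k n' z A)
  else \d_x A.

(* Total variation norm of a signed measure on S: the supremum of
   sum_i |nu (F i)| over finite measurable families of disjoint subsets. *)
Definition tv_norm (nu : set T -> \bar R) : \bar R :=
  ereal_sup [set e | exists n (F : 'I_n -> set T),
    [/\ forall i, measurable (F i), forall i, F i `<=` S, trivIset setT F
      & e = \sum_(i < n) `|nu (F i)|]].

Definition geometric_tv_bound (k : T -> T -> R) (Pi : set T -> \bar R) : Prop :=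
  exists (M : T -> R) (rho : R),
    [/\ forall x, S x -> (0 <= M x)%R, (0 <= rho < 1)%R &
        forall x n, S x ->
          tv_norm (fun A => nstep k n x A - Pi A) <= (M x * rho ^+ n)%:E].

End markov_chain.

Section mixed_model.
Context (R : realType) (N p r : nat) (q : 'I_r -> nat).
Variables (X : 'M[R]_(N, p)) (Z : forall i, 'M[R]_(N, q i)) (y : 'cV[R]_N).
Variables (ae be : R) (a b : 'I_r -> R).

Definition Zmx : 'M[R]_(N, \sum_i q i) := \mxrow_i Z i.
Definition Wmx : 'M[R]_(N, p + \sum_i q i) := row_mx X Zmx.

Definition SSE : R := enorm ((1%:M - orthoproj Wmx) *m y) ^+ 2.

(* theta = (beta, u_1, ..., u_r) and sigma^2 = (sigma_e^2, sigma_u1^2, ...). *)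
Local Notation parT := (Rvec R (p + \sum_i q i)).
Local Notation varT := (Rvec R r.+1).
Implicit Types (th : parT) (s : varT).

Definition rand_eff th : 'cV[R]_(\sum_i q i) := dsubmx (col_of th).
Definition rand_eff_block th i : 'cV[R]_(q i) := submxcol (rand_eff th) i.

Definition var_e s : R := tnth s ord0.
Definition var_u s (i : 'I_r) : R := tnth s (lift ord0 i).
Definition Dmx s : 'M[R]_(\sum_i q i) := \mxdiag_i (var_u s i)%:M.

(* The prior is flat in beta. *)
Definition prior s : R :=
  var_e s `^ (- (ae + 1)) * expR (- be / var_e s) *
  (\prod_i (var_u s i `^ (- (a i + 1)) * expR (- b i / var_u s i))) *
  \1_(@posvec R r.+1) s.

Definition upost th s : R :=
  mvn_pdf y (Wmx *m col_of th) (var_e s)%:M *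
  mvn_pdf (rand_eff th) 0 (Dmx s) * prior s.

Definition marginal : \bar R :=
  (\int[@lebesgue_vec R r.+1]_(s in @posvec R r.+1)
     \int[@lebesgue_vec R (p + \sum_i q i)]_th (upost th s)%:E)%E.

Definition posterior_proper : Prop := (marginal < +oo)%E.

Definition state_space : set (parT * varT) := setT `*` @posvec R r.+1.

Definition lebesgue_state : {measure set (parT * varT) -> \bar R} :=
  (@lebesgue_vec R (p + \sum_i q i) \x @lebesgue_vec R r.+1)%E.

Definition posterior (A : set (parT * varT)) : \bar R :=
  (\int[lebesgue_state]_(z in A `&` state_space)
     (upost z.1 z.2 / fine marginal)%:E)%E.

(* pi(theta | sigma^2, y) *)
Definition cond_theta th s : R :=
  upost th s / \int[@lebesgue_vec R (p + \sum_i q i)]_t upost t s.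

(* The set N; the empty product is 1, so N is empty when no b i vanishes. *)
Definition nullset : set parT :=
  [set th | \prod_(i | b i == 0) enorm (rand_eff_block th i) = 0].

(* pi(sigma^2 | theta, y) *)
Definition cond_var s th : R :=
  if th \in nullset then
    ig_pdf 1 1 (var_e s) * \prod_i ig_pdf 1 1 (var_u s i)
  else
    ig_pdf (N%:R / 2 + ae) (be + enorm (y - Wmx *m col_of th) ^+ 2 / 2)
      (var_e s) *
    \prod_i ig_pdf ((q i)%:R / 2 + a i)
      (b i + enorm (rand_eff_block th i) ^+ 2 / 2) (var_u s i).

(* k(theta, sigma^2 | theta', sigma'^2), with z the new state and x the old. *)
Definition gibbs_density (z x : parT * varT) : R :=
  cond_var z.2 z.1 * cond_theta z.1 x.2.

Definition gibbs_geometrically_ergodic : Prop :=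
  posterior_proper /\
  geometric_tv_bound lebesgue_state state_space gibbs_density posterior.

End mixed_model.

(* Main.v *)
Require Import Defs.
From HB Require Import structures.
From mathcomp Require Import all_boot all_order all_algebra.
From mathcomp Require Import all_classical all_reals all_analysis.
From mathcomp Require Import measurable_realfun ring lra zify.

Set Implicit Arguments.
Unset Strict Implicit.
Unset Printing Implicit Defensive.

Import Order.TTheory GRing.Theory Num.Theory.
Import numFieldNormedType.Exports.

Local Open Scope classical_set_scope.
Local Open Scope ring_scope.

(** The chain draws [theta] given the old variances (a Gaussian vector) and then
    the new variances given [theta] (independent inverse gamma variables). It
    forgets the old [theta], and everything follows from a drift inequality for a
    function [V] of the variances whose sublevel sets lie in boxes bounded away
    from 0 and from infinity.

    On such boxes the transition density dominates a fixed integrable function,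
    so drift and minorization give a contraction of oscillations measured with
    the weight [1 + beta V] ([contraction], [geometric_ergodicity]). The argument
    starts from the unnormalised posterior density, which is invariant for the
    kernel. That the posterior is proper is a consequence, not an assumption: the
    density is integrable over sublevel sets of [V], where the drift makes the
    chain spend a positive fraction of its time ([invariant_finite]).

    The function [V] is a combination of [v_e], the [v_i], and negative powers
    [v_i^-s_i], [v_e^-s_i], with [v_e], [v_i] the error and random effect
    variances. Conditionally on [theta], each new variance is inverse gamma with
    scale half a sum of squares (plus [be] or [b i]), so that its moments are
    explicit and only moments of these sums of squares given the old variances
    are to be bounded.

    - The residual sum of squares has mean at most [rank(W) v_e + |y|^2], and
      [rank W <= p + t]; the condition on [N + 2 ae] makes the coefficient of
      [v_e] less than 1 ([expected_residual]).

    - The vector [u] splits along the kernel of [(I - P_X) Z], of dimension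
      [q - t], and its orthogonal. The component in the latter is controlled by
      [v_e], the other by the sum of the [v_i] with coefficients that add up to
      [q - t]; the conditions on [q_i + 2 a_i] make the coefficients of the [v_i]
      add up to less than 1 ([expected_rand_eff]). This also needs the conditional
      mean of [u] to be bounded uniformly in the variances, however unbalanced
      ([weighted_orthogonal_bound], [mean_rand_eff_bounded]).

    - If [b i = 0], the small values of [v_i] are controlled by a negative moment
      of [|u_i|^2], obtained from its Laplace transform ([gauss_neg_moment]). For
      [s_i = - a_i / 2] the coefficient of [v_i^-s_i] can be as close as desired to
      [Gamma(q_i/2 + a_i/2)^2 / (Gamma(q_i/2 + a_i) Gamma(q_i/2))], which is less
      than 1 by strict logarithmic convexity ([Gamma_midpoint]). *)

(** * Chains with a drift and an unnormalised invariant density *)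

Section linear_combinations.
Context d (T : measurableType d) (R : realType).
Variable mu : {measure set T -> \bar R}.

Lemma integrable_lincomb (s : seq (R * (T -> R))) :
  (forall p, List.In p s -> mu.-integrable setT (EFin \o p.2)) ->
  mu.-integrable setT (EFin \o (fun z => \sum_(p <- s) p.1 * p.2 z)) /\
  \int[mu]_z (\sum_(p <- s) p.1 * p.2 z) = \sum_(p <- s) p.1 * \int[mu]_z p.2 z.
Proof.
elim: s => [|p s ih] h.
  have -> : (fun z : T => \sum_(p <- [::]) p.1 * p.2 z) = (fun=> 0 : R).
    by apply/funext => z; rewrite big_nil.
  by rewrite big_nil Rintegral_cst// mul0r; split => //; exact: integrable0.
have [|iS Es] := ih; first by move=> q qs; apply: h; right.
have ip : mu.-integrable setT (EFin \o (fun z => p.1 * p.2 z)).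
  have /(integrableZl measurableT p.1) := h p (or_introl erefl).
  by apply: eq_integrable => // z _ /=; rewrite EFinM.
have -> : (fun z => \sum_(p <- p :: s) p.1 * p.2 z) =
    (fun z => p.1 * p.2 z + \sum_(p <- s) p.1 * p.2 z).
  by apply/funext => z; rewrite big_cons.
split; last first.
  by rewrite RintegralD// Es big_cons RintegralZl//; apply: h; left.
have := integrableD measurableT ip iS.
by apply: eq_integrable => // z _ /=; rewrite EFinD.
Qed.

(** The form in which linearity and monotonicity of the integral get used
    below: a pointwise inequality between integrable functions, all terms moved
    to one side. *)
Lemma Rintegral_lincomb_ge0 (s : seq (R * (T -> R))) :
  (forall p, List.In p s -> mu.-integrable setT (EFin \o p.2)) ->
  (forall z, 0 <= \sum_(p <- s) p.1 * p.2 z) ->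
  0 <= \sum_(p <- s) p.1 * \int[mu]_z p.2 z.
Proof.
by move=> /integrable_lincomb[_ <-] h; apply: Rintegral_ge0.
Qed.

Lemma ge0_integrable (h : T -> R) : measurable_fun setT h -> (forall z, 0 <= h z) ->
  (\int[mu]_z (h z)%:E < +oo)%E -> mu.-integrable setT (EFin \o h).
Proof.
move=> mh h0 hoo; apply/integrableP; split; first exact/measurable_EFinP.
by under eq_integral => z _ do rewrite /= ger0_norm//.
Qed.

Lemma le_abs_integrable (h w : T -> R) : measurable_fun setT h ->
  mu.-integrable setT (EFin \o w) -> (forall z, `|h z| <= w z) ->
  mu.-integrable setT (EFin \o h).
Proof.
move=> mh iw hw; apply: le_integrable iw => //; first exact/measurable_EFinP.
by move=> z _ /=; rewrite lee_fin (le_trans (hw z))// ler_norm.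
Qed.

End linear_combinations.

Section harris.
Context d (T : measurableType d) (R : realType).
Variables (mu : {sigma_finite_measure set T -> \bar R}) (S : set T).
Variables (k : T -> T -> R) (V f : T -> R) (gam K : R).
Hypothesis mk : measurable_fun setT (fun zx : T * T => k zx.1 zx.2).
Hypothesis k0 : forall z x, 0 <= k z x.
Hypothesis kS : forall z x, ~ (S z /\ S x) -> k z x = 0.
Hypothesis k1 : forall x, S x -> (\int[mu]_z (k z x)%:E = 1)%E.
Hypothesis mV : measurable_fun setT V.
Hypothesis V0 : forall x, 0 <= V x.
Hypothesis drift : forall x, S x ->
  (\int[mu]_z (k z x * V z)%:E <= (gam * V x + K)%:E)%E.
Hypotheses (gam0 : 0 <= gam) (gam1 : gam < 1) (K0 : 0 <= K).
Hypothesis mf : measurable_fun setT f.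
Hypothesis f0 : forall x, 0 <= f x.
Hypothesis fS : forall x, ~ S x -> f x = 0.
Hypothesis inv : ae_eq mu setT (fun z => \int[mu]_x (k z x * f x)%:E)%E (EFin \o f).

Let mkl x : measurable_fun setT (k ^~ x).
Proof. exact: (measurableT_comp mk (pair2_measurable x)). Qed.

Let mkr z : measurable_fun setT (k z).
Proof. exact: (measurableT_comp mk (pair1_measurable z)). Qed.

Definition transition (phi : T -> \bar R) (x : T) : \bar R :=
  (\int[mu]_z ((k z x)%:E * phi z))%E.
Local Notation P := transition.

Local Open Scope ereal_scope.

Lemma transition_ge0 phi : (forall z, 0 <= phi z) -> forall x, 0 <= P phi x.
Proof. by move=> h x; apply: integral_ge0 => z _; rewrite mule_ge0// lee_fin. Qed.

Let mkphi (phi : T -> \bar R) (x : T) : measurable_fun setT phi ->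
  measurable_fun setT (fun z => (k z x)%:E * phi z).
Proof. by move=> h; apply: emeasurable_funM => //; exact/measurable_EFinP. Qed.

Lemma measurable_transition (phi : T -> \bar R) : measurable_fun setT phi ->
  (forall z, 0 <= phi z) -> measurable_fun setT (P phi).
Proof.
move=> mphi phi0.
apply: (@measurable_fun_fubini_tonelli_G _ _ _ _ _ mu
   (fun zx : T * T => (k zx.1 zx.2)%:E * phi zx.1)).
- apply: emeasurable_funM; first exact/measurable_EFinP.
  exact: measurableT_comp.
- by move=> zx; rewrite mule_ge0// lee_fin.
Qed.

Lemma le_transition (phi psi : T -> \bar R) (x : T) : measurable_fun setT phi -> measurable_fun setT psi ->
  (forall z, 0 <= phi z) -> (forall z, S z -> phi z <= psi z) -> P phi x <= P psi x.
Proof.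
move=> mp mq p0 pq; apply: ge0_le_integral => //.
- by move=> z _; rewrite mule_ge0// lee_fin.
- exact: mkphi.
- exact: mkphi.
- move=> z _; case: (pselect (S z)) => Sz; first by rewrite lee_wpmul2l ?lee_fin ?pq.
  by rewrite kS ?mul0e//; case.
Qed.

Lemma transitionD (phi psi : T -> \bar R) (x : T) : measurable_fun setT phi -> measurable_fun setT psi ->
  (forall z, 0 <= phi z) -> (forall z, 0 <= psi z) ->
  P (fun z => phi z + psi z) x = P phi x + P psi x.
Proof.
move=> mp mq p0 q0; rewrite /P -ge0_integralD//.
- by apply: eq_integral => z _; rewrite ge0_muleDr.
- by move=> z _; rewrite mule_ge0// lee_fin.
- exact: mkphi.
- by move=> z _; rewrite mule_ge0// lee_fin.
- exact: mkphi.
Qed.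

Lemma transitionZ (c : R) (phi : T -> \bar R) (x : T) : measurable_fun setT phi ->
  (forall z, 0 <= phi z) -> (0 <= c)%R ->
  P (fun z => c%:E * phi z) x = c%:E * P phi x.
Proof.
move=> mp p0 c0; rewrite /P -ge0_integralZl//.
- by apply: eq_integral => z _; rewrite muleCA.
- exact: mkphi.
- by move=> z _; rewrite mule_ge0// lee_fin.
Qed.

Lemma transition_cst (c : R) x : S x -> (0 <= c)%R -> P (cst c%:E) x = c%:E.
Proof.
move=> Sx c0; rewrite /P.
under eq_integral do rewrite muleC.
by rewrite ge0_integralZl// ?k1 ?mule1// => [|z _];
  [exact/measurable_EFinP|rewrite lee_fin].
Qed.

Lemma transition_notin phi x : ~ S x -> P phi x = 0.
Proof.
move=> Sx; rewrite /P; apply: integral0_eq => z _.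
by rewrite kS ?mul0e//; case.
Qed.

Definition ntrans n (phi : T -> \bar R) := iter n P phi.

Lemma ntrans_ge0 n (phi : T -> \bar R) : (forall z, 0 <= phi z) -> forall x, 0 <= ntrans n phi x.
Proof. by move=> h; elim: n => //= n ih x; exact: transition_ge0. Qed.

Lemma measurable_ntrans n (phi : T -> \bar R) : measurable_fun setT phi ->
  (forall z, 0 <= phi z) -> measurable_fun setT (ntrans n phi).
Proof.
by move=> mp p0; elim: n => //= n ih; apply: measurable_transition => //;
  exact: ntrans_ge0.
Qed.

Lemma ntrans_le1 n (phi : T -> \bar R) : measurable_fun setT phi -> (forall z, 0 <= phi z) ->
  (forall z, phi z <= 1) -> forall x, ntrans n phi x <= 1.
Proof.
move=> mp p0 p1; elim: n => //= n ih x.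
have [Sx|Sx] := pselect (S x); last by rewrite transition_notin.
rewrite -(transition_cst Sx ler01); apply: le_transition => //.
- exact: measurable_ntrans.
- exact: ntrans_ge0.
Qed.

Lemma nstep_ntrans n x A : measurable A -> S x ->
  nstep mu S k n x A = ntrans n (fun z => (\1_A z)%:E) x.
Proof.
move=> mA; elim: n x => [|n ih] x Sx; first by rewrite /= diracE indicE.
rewrite /= integral_mkcond; apply: eq_integral => z _.
rewrite patchE; case: ifPn => [|/negP] zS; last first.
  by rewrite kS ?mul0e// => -[] /mem_set.
by rewrite ih//; exact: set_mem.
Qed.

(** By Tonelli, a density fixed by the kernel defines a measure that the chain
    preserves. *)
Lemma invariant_integral (phi : T -> \bar R) : measurable_fun setT phi -> (forall z, 0 <= phi z) ->
  \int[mu]_x (P phi x * (f x)%:E) = \int[mu]_x (phi x * (f x)%:E).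
Proof.
move=> mp p0.
pose F (zx : T * T) := (k zx.1 zx.2)%:E * phi zx.1 * (f zx.2)%:E.
have mF : measurable_fun setT F.
  apply: emeasurable_funM.
    apply: emeasurable_funM; first exact/measurable_EFinP.
    exact: measurableT_comp.
  by apply/measurable_EFinP; exact: measurableT_comp.
have F0 zx : 0 <= F zx by rewrite !mule_ge0 ?lee_fin.
transitivity (\int[mu]_x \int[mu]_z F (z, x)).
  apply: eq_integral => x _; rewrite /F /P /= -ge0_integralZr ?lee_fin//.
  - exact: mkphi.
  - by move=> z _; rewrite mule_ge0// lee_fin.
rewrite -(@fubini_tonelli _ _ _ _ _ mu mu)//.
transitivity (\int[mu]_z (phi z * \int[mu]_x (k z x * f x)%:E)).
  apply: eq_integral => z _; rewrite /F/= -ge0_integralZl//.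
  - by apply: eq_integral => x _; rewrite EFinM; rewrite muleA (muleC (phi z)).
  - by apply/measurable_EFinP/measurable_funM.
  - by move=> x _; rewrite lee_fin mulr_ge0.
have mI : measurable_fun setT (fun z => \int[mu]_x (k z x * f x)%:E).
  apply: (@measurable_fun_fubini_tonelli_F _ _ _ _ _ mu
     (fun zx : T * T => (k zx.1 zx.2 * f zx.2)%:E)).
  - apply/measurable_EFinP/measurable_funM => //.
    exact: measurableT_comp.
  - by move=> zx; rewrite lee_fin mulr_ge0.
apply: ge0_ae_eq_integral => //.
- exact: emeasurable_funM.
- by apply: emeasurable_funM => //; exact/measurable_EFinP.
- move=> z _; rewrite mule_ge0//; apply: integral_ge0 => x _.
  by rewrite lee_fin mulr_ge0.
- by move=> z _; rewrite mule_ge0// lee_fin.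
- by apply: filterS inv => z /(_ I) /= -> _.
Qed.

Lemma invariant_ntrans n (phi : T -> \bar R) : measurable_fun setT phi -> (forall z, 0 <= phi z) ->
  \int[mu]_x (ntrans n phi x * (f x)%:E) = \int[mu]_x (phi x * (f x)%:E).
Proof.
move=> mp p0; elim: n => //= n <-; apply: invariant_integral.
- exact: measurable_ntrans.
- exact: ntrans_ge0.
Qed.

Let mVE : measurable_fun setT (fun z => (V z)%:E).
Proof. exact/measurable_EFinP. Qed.

Let Kinf : R := (K / (1 - gam))%R.
Let Kinf0 : (0 <= Kinf)%R. Proof. by rewrite divr_ge0// subr_ge0 ltW. Qed.
(** A geometric sum: [Kinf] is the fixed point of [v |-> gam v + K]. *)
Lemma drift_ntrans n x : S x ->
  ntrans n (fun z => (V z)%:E) x <= (gam ^+ n * V x + (1 - gam ^+ n) * Kinf)%:E.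
Proof.
have g1 m : (gam ^+ m <= 1)%R by rewrite exprn_ile1// ltW.
have gK m : (0 <= (1 - gam ^+ m) * Kinf)%R by rewrite mulr_ge0// subr_ge0.
have gV m z : (0 <= gam ^+ m * V z)%R by rewrite mulr_ge0// exprn_ge0.
elim: n x => [|n ih] x Sx /=; first by rewrite expr0 mul1r subrr mul0r addr0.
apply: (@le_trans _ _ (P (fun z => (gam ^+ n * V z + (1 - gam ^+ n) * Kinf)%:E) x)).
  apply: le_transition => //.
  - by apply: measurable_ntrans => // z; rewrite lee_fin.
  - by apply/measurable_EFinP/measurable_funD => //; exact: measurable_funM.
  - by apply: ntrans_ge0 => z; rewrite lee_fin.
rewrite (_ : (fun z => _) =
    fun z => (gam ^+ n)%:E * (V z)%:E + cst ((1 - gam ^+ n) * Kinf)%:E z); last first.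
  by apply/funext => z; rewrite EFinD EFinM.
have mgV : measurable_fun setT (fun z => (gam ^+ n)%:E * (V z)%:E).
  by under eq_fun do rewrite -EFinM; apply/measurable_EFinP/measurable_funM.
rewrite transitionD//; [|by move=> z; rewrite mule_ge0 ?lee_fin ?exprn_ge0|by move=> z; rewrite lee_fin gK].
rewrite transitionZ ?exprn_ge0//.
rewrite transition_cst//.
apply: (@le_trans _ _ ((gam ^+ n)%:E * (gam * V x + K)%:E + ((1 - gam ^+ n) * Kinf)%:E)).
  rewrite leeD2r// lee_wpmul2l ?lee_fin ?exprn_ge0//.
  by apply: le_trans (drift Sx); rewrite /P; under eq_integral do rewrite -EFinM.
rewrite -EFinM -EFinD lee_fin exprSr le_eqVlt; apply/orP; left; apply/eqP.
have : K = ((1 - gam) * Kinf)%R by rewrite /Kinf; field; rewrite subr_eq0 gt_eqF.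
by move: Kinf => c ->; ring.
Qed.

Hypothesis floc : forall r, \int[mu]_(x in [set x | (V x <= r)%R]) (f x)%:E < +oo.

Let msub r : measurable [set x | (V x <= r)%R].
Proof.
rewrite [X in measurable X](_ : _ = V @^-1` `]-oo, r]).
  by rewrite -[X in measurable X]setTI; exact: mV.
by apply/seteqP; split => x /=; rewrite in_itv.
Qed.

Let mfE : measurable_fun setT (fun z => (f z)%:E).
Proof. exact/measurable_EFinP. Qed.

Let f0E z : 0 <= (f z)%:E. Proof. by rewrite lee_fin. Qed.

Let geom_small (a e : R) : (0 < e)%R -> exists n, (gam ^+ n * a <= e)%R.
Proof.
move=> e0.
have h : (gam ^+ n * a)%R @[n --> \oo] --> (0 : R)%R.
  rewrite -[X in _ --> X](mul0r a); apply: cvgM; last exact: cvg_cst.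
  by apply: cvg_expr; rewrite ger0_norm.
have [n _ /(_ n (leqnn n))] := cvgr0_norm_le _ h _ e0.
by move=> /(le_trans (ler_norm _)) ?; exists n.
Qed.

(** A chain with a drift towards a sublevel set of [V] spends, from every state,
    eventually a fixed proportion of its time there; so an invariant measure
    cannot be infinite if it gives that set finite mass. *)
Lemma invariant_finite : \int[mu]_x (f x)%:E < +oo.
Proof.
(* After many steps the mean of [V] is at most [Kinf + 1 = L / 4], so by Markov's
   inequality the chain is then in [C] with probability at least 3/4. *)
pose L : R := (4 * Kinf + 4)%R.
have L0 : (0 < L)%R by rewrite /L; have := Kinf0; lra.
have L0' : (0 <= L)%R := ltW L0.
pose C := [set x | (V x <= L)%R].
pose iC : T -> \bar R := fun x => (\1_C x)%:E.
have miC : measurable_fun setT iC by apply/measurable_EFinP/measurable_indic/msub.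
have iC0 z : 0 <= iC z by rewrite lee_fin.
have iC1 z : iC z <= 1 by rewrite lee_fin indicE; case: (_ \in _).
have VE0 z : 0 <= (V z)%:E by rewrite lee_fin.
have mnC n := measurable_ntrans n miC iC0.
have nC0 n := ntrans_ge0 n iC0.
have VL0 z : 0 <= (L^-1)%:E * (V z)%:E by rewrite mule_ge0 ?lee_fin ?invr_ge0 ?L0'//.
have mVL : measurable_fun setT (fun z => (L^-1)%:E * (V z)%:E).
  by under eq_fun do rewrite -EFinM; apply/measurable_EFinP/measurable_funM.
have low n x : S x -> 1 <= ntrans n iC x + (L^-1)%:E * ntrans n (fun z => (V z)%:E) x.
  elim: n x => [|n ih] x Sx /=.
    rewrite /iC indicE -EFinM -EFinD lee_fin; case: (boolP (x \in C)) => /=.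
      by move=> _; rewrite lerDl mulr_ge0// invr_ge0 L0'.
    rewrite notin_setE /C /= => /negP; rewrite -ltNge add0r mulrC => VL.
    by rewrite ler_pdivlMr// mul1r ltW.
  have mnV := measurable_ntrans n mVE VE0.
  have nV0 := ntrans_ge0 n VE0.
  have h0 z : 0 <= (L^-1)%:E * ntrans n (fun z => (V z)%:E) z.
    by rewrite mule_ge0 ?lee_fin ?invr_ge0 ?L0'//.
  rewrite -transitionZ ?invr_ge0 ?L0'//.
  rewrite -transitionD//; last exact: emeasurable_funM.
  rewrite -(transition_cst Sx ler01); apply: le_transition => //.
  by apply: emeasurable_funD => //; exact: emeasurable_funM.
have bound m : \int[mu]_(x in [set x | (V x <= m%:R)%R]) (f x)%:E
    <= 4%:E * \int[mu]_(x in C) (f x)%:E.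
  have [n nm] := @geom_small m%:R 1%R ltr01.
  have -> : \int[mu]_(x in C) (f x)%:E = \int[mu]_x (ntrans n iC x * (f x)%:E).
    rewrite invariant_ntrans// integral_mkcond; apply: eq_integral => z _.
    by rewrite /iC indicE patchE; case: ifPn; rewrite ?mul1e ?mul0e.
  have mnf : measurable_fun setT (fun x => ntrans n iC x * (f x)%:E).
    exact: emeasurable_funM.
  rewrite -ge0_integralZl//; last by move=> x _; rewrite mule_ge0.
  rewrite [leLHS]integral_mkcond; apply: ge0_le_integral => //.
  - by move=> x _; rewrite patchE; case: ifPn.
  - by apply/(measurable_restrictT _ (msub _)); exact: measurable_funTS.
  - exact: emeasurable_funM.
  move=> x _; rewrite patchE; case: ifPn => [|_]; last by rewrite !mule_ge0// lee_fin.
  rewrite inE/= => Vm.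
  have [Sx|Sx] := pselect (S x); last by rewrite fS// !mule0.
  rewrite muleA -[leLHS]mul1e lee_wpmul2r//.
  have := low n x Sx.
  have : ntrans n (fun z => (V z)%:E) x <= (1 + Kinf)%:E.
    apply: le_trans (drift_ntrans n Sx) _; rewrite lee_fin lerD//.
      by rewrite (le_trans _ nm)// ler_wpM2l ?exprn_ge0.
    by rewrite ler_piMl// gerBl exprn_ge0.
  have := nC0 n x; have := ntrans_le1 n miC iC0 iC1 x.
  have : 0 <= ntrans n (fun z => (V z)%:E) x by apply: ntrans_ge0 => z; rewrite lee_fin.
  case: (ntrans n iC x) => [c| |]; [|by rewrite mulry gtr0_sg// mul1e leey|by move=> _ _ []].
  case: (ntrans n _ x) => [v| |]//; rewrite -!EFinM -EFinD !lee_fin => v0 _ c0 vK cv.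
  have : (L^-1 * v <= L^-1 * (1 + Kinf))%R by rewrite ler_wpM2l// invr_ge0 L0'.
  have : (L^-1 * (1 + Kinf) = 1/4)%R.
    by rewrite /L; field; have := Kinf0; lra.
  by move=> -> h; move: cv h; lra.
have Tm : \bigcup_m [set x | (V x <= m%:R)%R] = setT.
  apply/seteqP; split => // x _.
  by exists (Num.bound (V x)) => //=; rewrite ltW// archi_boundP.
have ndm : nondecreasing_seq (fun m => [set x | (V x <= m%:R)%R]).
  by move=> a b ab; apply/subsetPset => x /= /le_trans; apply; rewrite ler_nat.
have mm i : measurable_fun [set x | (V x <= i%:R)%R] (EFin \o f).
  exact: measurable_funTS.
have m0 i x : [set x | (V x <= i%:R)%R] x -> 0 <= (EFin \o f) x by move=> _ /=.
have := @ge0_nondecreasing_set_cvg_integral _ _ _ _ (EFin \o f) mu ndm _ mm m0.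
move=> /(_ (fun i => msub _))/cvg_lim; rewrite Tm => /(_ (@ereal_hausdorff _)) <-.
apply: (@le_lt_trans _ _ (4%:E * \int[mu]_(x in C) (f x)%:E)).
  apply: lime_le; last by near=> n; exact: bound.
  apply: ereal_nondecreasing_is_cvgn.
  exact: ge0_nondecreasing_set_nondecreasing_integral.
by rewrite lte_mul_pinfty// floc.
Unshelve. all: by end_near.
Qed.

(** Integrating the drift inequality for the truncations [Num.min V m], which are
    integrable, against the invariant measure. *)
Lemma invariant_drift_finite : \int[mu]_x (V x * f x)%:E < +oo.
Proof.
have ffin := invariant_finite.
have i0 : 0 <= \int[mu]_x (f x)%:E by exact: integral_ge0.
have mVf : measurable_fun setT (fun x => (V x * f x)%:E).
  exact/measurable_EFinP/measurable_funM.
have bound (m : nat) : \int[mu]_(x in [set x | (V x <= m%:R)%R]) (V x * f x)%:E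
    <= Kinf%:E * \int[mu]_x (f x)%:E.
  pose W z : R := Num.min (V z) m%:R.
  have W0 z : (0 <= W z)%R by rewrite le_min V0 ler0n.
  have W0E z : 0 <= (W z)%:E by rewrite lee_fin.
  have mW : measurable_fun setT (fun z => (W z)%:E).
    by apply/measurable_EFinP/measurable_minr.
  pose J z : R := (V z * \1_[set x | (V x <= m%:R)%R] z)%R.
  have J0 z : (0 <= J z)%R by rewrite mulr_ge0.
  have mJ : measurable_fun setT J.
    by apply: measurable_funM => //; exact/measurable_indic/msub.
  have mJf : measurable_fun setT (fun x => ((1 - gam) * (J x * f x))%:E).
    by apply/measurable_EFinP/measurable_funM => //; exact: measurable_funM.
  have -> : \int[mu]_(x in [set x | (V x <= m%:R)%R]) (V x * f x)%:E =
      \int[mu]_x (J x * f x)%:E.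
    rewrite integral_mkcond; apply: eq_integral => x _.
    by rewrite patchE /J indicE; case: ifPn; rewrite ?mulr1 ?mulr0 ?mul0r.
  have PW x : S x -> P (fun z => (W z)%:E) x <= (Num.min (gam * V x + K) m%:R)%:E.
    move=> Sx; rewrite EFin_min le_min; apply/andP; split.
      apply: le_trans (drift Sx); apply: (@le_trans _ _ (P (fun z => (V z)%:E) x)).
        by apply: le_transition => // z _; rewrite lee_fin ge_min lexx.
      by rewrite /P; under eq_integral do rewrite -EFinM.
    rewrite -(@transition_cst m%:R _ Sx)//; apply: le_transition => // z _.
    by rewrite lee_fin ge_min lexx orbT.
  have mWf : measurable_fun setT (fun x => (W x)%:E * (f x)%:E).
    exact: emeasurable_funM.
  have mPWf : measurable_fun setT (fun x => P (fun z => (W z)%:E) x * (f x)%:E).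
    by apply: emeasurable_funM => //; exact: measurable_transition.
  have PW0 x : 0 <= P (fun z => (W z)%:E) x by exact: transition_ge0.
  have Wfin : \int[mu]_x ((W x)%:E * (f x)%:E) < +oo.
    apply: (@le_lt_trans _ _ (m%:R%:E * \int[mu]_x (f x)%:E)).
      rewrite -ge0_integralZl//; apply: ge0_le_integral => //.
      - by move=> x _; rewrite mule_ge0.
      - exact: emeasurable_funM.
      - by move=> x _; rewrite lee_wpmul2r// lee_fin ge_min lexx orbT.
    by rewrite lte_mul_pinfty// lee_fin.
  have Wge0 : 0 <= \int[mu]_x ((W x)%:E * (f x)%:E).
    by apply: integral_ge0 => x _; rewrite mule_ge0.
  have mKf : measurable_fun setT (fun x => K%:E * (f x)%:E) by exact: emeasurable_funM.
  have key : \int[mu]_x (P (fun z => (W z)%:E) x * (f x)%:E) +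
      \int[mu]_x ((1 - gam) * (J x * f x))%:E <=
      \int[mu]_x ((W x)%:E * (f x)%:E) + \int[mu]_x (K%:E * (f x)%:E).
    rewrite -!ge0_integralD//; last 4 first.
    - by move=> x _; rewrite mule_ge0.
    - by move=> x _; rewrite mule_ge0.
    - by move=> x _; rewrite mule_ge0.
    - by move=> x _; rewrite lee_fin !mulr_ge0// subr_ge0 ltW.
    apply: ge0_le_integral => //.
    - move=> x _; rewrite adde_ge0 ?mule_ge0// lee_fin !mulr_ge0//.
      by rewrite subr_ge0 ltW.
    - exact: emeasurable_funD.
    - exact: emeasurable_funD.
    move=> x _; have [Sx|Sx] := pselect (S x); last first.
      by rewrite fS// !mulr0 !mule0.
    apply: (@le_trans _ _ ((Num.min (gam * V x + K) m%:R)%:E * (f x)%:E +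
       ((1 - gam) * (J x * f x))%:E)).
      by rewrite leeD2r// lee_wpmul2r// PW.
    rewrite -!EFinM -!EFinD lee_fin mulrA -!mulrDl ler_wpM2r//.
    rewrite /W /J indicE; case: (leP (V x) m%:R) => Vm.
      rewrite mem_set//= mulr1 minElt; case: ifPn => [_|]; first lra.
      by rewrite -leNgt => h; apply: le_trans (lerD h (lexx _)) _; lra.
    by rewrite memNset/= ?mulr0 ?addr0; [rewrite ge_min; apply/orP; right; rewrite lerDl
      |apply/negP; rewrite -ltNge].
  rewrite invariant_integral// (ge0_integralZl _ measurableT mfE)// in key.
  rewrite leeD2lE ?ge0_fin_numE// in key.
  have JE : \int[mu]_x ((1 - gam) * (J x * f x))%:E =
      (1 - gam)%:E * \int[mu]_x (J x * f x)%:E.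
    rewrite -ge0_integralZl ?lee_fin ?subr_ge0 ?(ltW gam1)//.
    - by apply/measurable_EFinP/measurable_funM.
    - by move=> x _; rewrite lee_fin mulr_ge0.
  rewrite JE in key.
  have g1 : (0 < 1 - gam)%R by rewrite subr_gt0.
  have -> : Kinf%:E = ((1 - gam)^-1)%:E * K%:E by rewrite -EFinM mulrC.
  rewrite -muleA -[leLHS]mul1e -[X in X%:E * _ <= _](mulVf (lt0r_neq0 g1)).
  by rewrite EFinM -muleA lee_wpmul2l// lee_fin invr_ge0 ltW.
have Tm : \bigcup_m [set x | (V x <= m%:R)%R] = setT.
  apply/seteqP; split => // x _.
  by exists (Num.bound (V x)) => //=; rewrite ltW// archi_boundP.
have ndm : nondecreasing_seq (fun m => [set x | (V x <= m%:R)%R]).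
  by move=> a b ab; apply/subsetPset => x /= /le_trans; apply; rewrite ler_nat.
pose h x := (V x * f x)%:E.
have mm i : measurable_fun [set x | (V x <= i%:R)%R] h.
  exact: measurable_funTS.
have m0 i x : [set x | (V x <= i%:R)%R] x -> 0 <= h x.
  by move=> _; rewrite lee_fin mulr_ge0.
have := @ge0_nondecreasing_set_cvg_integral _ _ _ _ h mu ndm _ mm m0.
move=> /(_ (fun i => msub _))/cvg_lim; rewrite Tm => /(_ (@ereal_hausdorff _)) <-.
apply: (@le_lt_trans _ _ (Kinf%:E * \int[mu]_x (f x)%:E)).
  apply: lime_le; last by near=> n; exact: bound.
  apply: ereal_nondecreasing_is_cvgn.
  exact: ge0_nondecreasing_set_nondecreasing_integral.
by rewrite lte_mul_pinfty// lee_fin.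
Unshelve. all: by end_near.
Qed.

Hypothesis minor : forall r, exists g : T -> R,
  [/\ measurable_fun setT g, forall z, (0 <= g z)%R,
      0 < \int[mu]_z (g z)%:E, \int[mu]_z (g z)%:E < +oo &
      forall x z, S x -> (V x <= r)%R -> (g z <= k z x)%R].

Local Close Scope ereal_scope.

Let Pr (phi : T -> R) x := \int[mu]_z (k z x * phi z).

Let ik x : S x -> mu.-integrable setT (EFin \o (k ^~ x)).
Proof. by move=> Sx; apply: ge0_integrable => //; rewrite k1// ltry. Qed.

Let ikV x : S x -> mu.-integrable setT (EFin \o (fun z => k z x * V z)).
Proof.
move=> Sx; apply: ge0_integrable => //; first exact: measurable_funM.
- by move=> z; rewrite mulr_ge0.
- by rewrite (le_lt_trans (drift Sx))// ltry.
Qed.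

Let ikphi (phi : T -> R) x : measurable_fun setT phi -> (forall z, 0 <= phi z <= 1) ->
  S x -> mu.-integrable setT (EFin \o (fun z => k z x * phi z)).
Proof.
move=> mphi phi01 Sx; apply: (le_abs_integrable _ (ik Sx)); first exact: measurable_funM.
move=> z; have /andP[p0 p1] := phi01 z.
by rewrite ger0_norm ?mulr_ge0// ler_piMr.
Qed.

Let Rk1 x : S x -> \int[mu]_z k z x = 1.
Proof. by move=> Sx; rewrite /Rintegral k1. Qed.

Let RkV x : S x -> \int[mu]_z (k z x * V z) <= gam * V x + K.
Proof.
move=> Sx; rewrite -lee_fin fineK; first exact: drift.
exact: (integrable_fin_num measurableT (ikV Sx)).
Qed.

(** The common part [g] of two transition densities cancels when a function is
    integrated against their difference; recentring [phi] by the constant [c]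
    turns a bound on its oscillation into one on its size. *)
Let diff_transition (phi g : T -> R) a beta x y :
  measurable_fun setT phi -> (forall z, 0 <= phi z <= 1) ->
  measurable_fun setT g -> (forall z, 0 <= g z) ->
  (forall z, g z <= k z x) -> (forall z, g z <= k z y) ->
  0 <= a -> 0 <= beta -> S x -> S y ->
  (forall x y, S x -> S y -> phi x - phi y <= a * (2 + beta * V x + beta * V y)) ->
  Pr phi x - Pr phi y <=
    a * (2 - 2 * \int[mu]_z g z + beta * (gam * (V x + V y) + 2 * K)).
Proof.
move=> mphi phi01 mg g0 gx gy a0 b0 Sx Sy osc.
pose E := [set phi z - a * (1 + beta * V z) | z in S].
have [c hc] : exists c, forall z, S z ->
    - (a * (1 + beta * V z)) <= phi z + c <= a * (1 + beta * V z).
  have ubE z : S z -> ubound E (phi z + a * (1 + beta * V z)).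
    by move=> Sz _ [w Sw <-]; have := osc w z Sw Sz; lra.
  have supE : has_sup E by split; [exists (phi x - a * (1 + beta * V x)), x|
    exists (phi x + a * (1 + beta * V x)); exact: ubE].
  exists (- sup E) => z Sz; apply/andP; split.
    by have := ge_sup supE.1 (ubE z Sz); lra.
  have : phi z - a * (1 + beta * V z) <= sup E by apply: sup_upper_bound => //; exists z.
  lra.
have := @Rintegral_lincomb_ge0 _ _ _ mu [:: (1, fun z => k z y * phi z); (c, k ^~ y);
  (a, k ^~ x); (a * beta, fun z => k z x * V z); (a, k ^~ y);
  (a * beta, fun z => k z y * V z); (-1, fun z => k z x * phi z);
  (- c, k ^~ x); (- (2 * a), g)].
rewrite !big_cons big_nil /= addr0 !Rk1// => h.
have ab0 : 0 <= a * beta by rewrite mulr_ge0.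
have h1 := ler_wpM2l ab0 (RkV Sx); have h2 := ler_wpM2l ab0 (RkV Sy).
rewrite -subr_ge0; apply: (le_trans (h _ _)); last by rewrite /Pr; move: h1 h2; lra.
- move=> p; do 9 (case=> [<-|]; [by first [exact: ikphi|exact: ik|exact: ikV|
    apply: (le_abs_integrable mg (ik Sx)) => z; rewrite ger0_norm]|]); by [].
- move=> z; rewrite !big_cons big_nil /= addr0.
  have [Sz|Sz] := pselect (S z); last first.
    have kz w : k z w = 0 by apply: kS; case.
    have gz : g z = 0 by apply/eqP; rewrite eq_le g0 -(kz x) gx.
    by rewrite !kz gz; lra.
  have /andP[hc1 hc2] := hc z Sz.
  have t1 : 0 <= (a * (1 + beta * V z) - (phi z + c)) * (k z x - g z).
    by rewrite mulr_ge0 ?subr_ge0.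
  have t2 : 0 <= (a * (1 + beta * V z) + (phi z + c)) * (k z y - g z).
    by rewrite mulr_ge0 ?subr_ge0//; lra.
  have t3 : 0 <= a * beta * V z * g z by rewrite !mulr_ge0.
  by move: t1 t2 t3; lra.
Qed.

(** With the weight [1 + beta V]: if [V x + V y] is large, the drift alone shrinks
    the bound; if it is at most [r], the laws of the steps from [x] and [y] share
    the mass of [g], and [beta] is so small that the growth of [V] does not undo
    this gain. *)
Let contraction : exists beta rho, [/\ 0 <= beta, 0 <= rho < 1 &
  forall a (phi : T -> R), measurable_fun setT phi -> (forall z, 0 <= phi z <= 1) ->
  0 <= a ->
  (forall x y, S x -> S y -> phi x - phi y <= a * (2 + beta * V x + beta * V y)) ->
  forall x y, S x -> S y ->
    Pr phi x - Pr phi y <= rho * a * (2 + beta * V x + beta * V y)].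
Proof.
(* If [V x + V y >= 4 Kinf], then [(1 - gam) (V x + V y)] is at least twice [2 K]. *)
pose r := 4 * Kinf + 1.
have g1 : 0 < 1 - gam by rewrite subr_gt0.
have KE : K = (1 - gam) * Kinf by rewrite /Kinf; field; rewrite gt_eqF.
have [g [mg g0 gpos goo gk]] := minor r.
pose al := Num.min 1 (\int[mu]_z g z).
have al1 : al <= 1 by rewrite ge_min lexx.
have alg : al <= \int[mu]_z g z by rewrite ge_min lexx orbT.
have al0 : 0 < al by rewrite lt_min ltr01 fine_gt0// gpos.
pose beta := al / (2 * K + 1).
have K1 : 0 < 2 * K + 1 by have := K0; lra.
have b0 : 0 < beta by rewrite divr_gt0.
have bK : 2 * (beta * K) <= al.
  have : beta * (2 * K + 1) = al by rewrite /beta; field; rewrite gt_eqF.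
  by move: b0; lra.
pose gam' := (1 + gam) / 2.
have r0 : 0 < r by rewrite /r; have := Kinf0; lra.
have br0 : 0 < beta * r by rewrite mulr_gt0.
pose rho1 := (2 + beta * gam' * r) / (2 + beta * r).
have d0 : 0 < 2 + beta * r by lra.
have rho1E : rho1 * (2 + beta * r) = 2 + beta * gam' * r.
  by rewrite /rho1; field; rewrite gt_eqF.
have rho1_1 : rho1 < 1.
  rewrite /rho1 ltr_pdivrMr// mul1r.
  have : 0 < (1 - gam) * (beta * r) by rewrite mulr_gt0.
  by rewrite /gam'; lra.
have rho1_g : gam' <= rho1.
  have : 0 <= (1 - gam) by exact: ltW.
  rewrite /rho1 ler_pdivlMr//; rewrite /gam'; lra.
pose rho := Num.max rho1 (Num.max gam (1 - al / 2)).
have rhoP : [/\ rho1 <= rho, gam <= rho & 1 - al / 2 <= rho].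
  by rewrite !le_max !lexx !orbT.
case: rhoP => rho_1 rho_2 rho_3.
exists beta, rho; split => //; first exact: ltW.
  rewrite (le_trans gam0)//= !gt_max rho1_1 gam1/=.
  by move: al0; lra.
move: (rho) rho_1 rho_2 rho_3 => {}rho rho_1 rho_2 rho_3.
clearbody rho1 beta al.
move=> a phi mphi phi01 a0 osc x y Sx Sy.
have V2 : 0 <= beta * (V x + V y) by rewrite mulr_ge0 ?addr_ge0// ltW.
rewrite mulrAC mulrC.
have [sr|rs] := leP (V x + V y) r.
  have := @diff_transition phi g a beta x y mphi phi01 mg g0.
  move=> /(_ _ _ a0 (ltW b0) Sx Sy osc)h.
  apply: (le_trans (h _ _)).
  - by move=> z; apply: gk => //; have := V0 y; lra.
  - by move=> z; apply: gk => //; have := V0 x; lra.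
  rewrite ler_wpM2l//.
  have e1 := ler_wpM2r V2 rho_2.
  by move: e1 bK alg rho_3; lra.
have := @diff_transition phi (cst 0) a beta x y mphi phi01.
move=> /(_ _ _ _ _ a0 (ltW b0) Sx Sy osc)h.
apply: (le_trans (h _ _ _ _)) => //.
rewrite ler_wpM2l// Rintegral_cst// mul0r mulr0 subr0.
have g1' := ltW g1; have b0' := ltW b0.
have e1 : 0 <= (1 - gam) * (beta * (V x + V y - r)).
  by rewrite !mulr_ge0// subr_ge0 ltW.
have e3 : 2 * (beta * K) <= (gam' - gam) * (beta * (V x + V y)).
  rewrite KE (_ : gam' - gam = (1 - gam) / 2); last by rewrite /gam'; field.
  have : 0 <= (1 - gam) * beta by exact: mulr_ge0.
  by move: e1; rewrite /r; lra.
have e2 : gam' * (beta * (V x + V y - r)) <= rho1 * (beta * (V x + V y - r)).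
  by rewrite ler_wpM2r// mulr_ge0// subr_ge0 ltW.
have e4 : rho1 * (2 + beta * V x + beta * V y) <= rho * (2 + beta * V x + beta * V y).
  by rewrite ler_wpM2r//; move: V2; lra.
apply: le_trans e4; move: e2 e3 rho1E; lra.
Qed.

Local Open Scope ereal_scope.

Lemma ntransD n (phi psi : T -> \bar R) x : measurable_fun setT phi ->
  measurable_fun setT psi -> (forall z, 0 <= phi z) -> (forall z, 0 <= psi z) ->
  ntrans n (fun z => phi z + psi z) x = ntrans n phi x + ntrans n psi x.
Proof.
move=> mp mq p0 q0; elim: n x => [//|n ih] x /=.
rewrite -transitionD//; [|exact: measurable_ntrans|exact: measurable_ntrans
  |exact: ntrans_ge0|exact: ntrans_ge0].
by congr (P _ x); apply/funext.
Qed.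

Lemma ntrans0 n x : ntrans n (cst 0) x = 0.
Proof.
elim: n x => //= n ih x; rewrite /P; apply: integral0_eq => z _.
by rewrite ih mule0.
Qed.

Lemma ntrans_sum n (I : Type) (s : seq I) (phi : I -> T -> R) x :
  (forall i, measurable_fun setT (phi i)) -> (forall i z, (0 <= phi i z)%R) ->
  ntrans n (fun z => (\sum_(i <- s) phi i z)%:E) x =
  \sum_(i <- s) ntrans n (fun z => (phi i z)%:E) x.
Proof.
move=> mp p0; elim: s => [|i s ih].
  rewrite big_nil -[RHS](ntrans0 n x); congr (ntrans n _ x).
  by apply/funext => z; rewrite big_nil.
rewrite big_cons -ih -ntransD.
- by congr (ntrans n _ x); apply/funext => z; rewrite big_cons EFinD.
- exact/measurable_EFinP.
- by apply/measurable_EFinP/measurable_sum.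
- by move=> z; rewrite lee_fin.
- by move=> z; rewrite lee_fin sumr_ge0.
Qed.

Hypothesis fpos : 0 < \int[mu]_x (f x)%:E.

Local Close Scope ereal_scope.

Let if_ : mu.-integrable setT (EFin \o f).
Proof. by apply: ge0_integrable => //; exact: invariant_finite. Qed.

Let iVf : mu.-integrable setT (EFin \o (fun x => V x * f x)).
Proof.
apply: ge0_integrable; first exact: measurable_funM.
- by move=> z; rewrite mulr_ge0.
- exact: invariant_drift_finite.
Qed.

Let iphif (phi : T -> R) : measurable_fun setT phi -> (forall z, 0 <= phi z <= 1) ->
  mu.-integrable setT (EFin \o (fun z => phi z * f z)).
Proof.
move=> mphi phi01; apply: (le_abs_integrable _ if_); first exact: measurable_funM.
move=> z; have /andP[p0 p1] := phi01 z.
by rewrite ger0_norm ?mulr_ge0// ler_piMl.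
Qed.

Let m := \int[mu]_x f x.

Let m_gt0 : 0 < m.
Proof. by rewrite /m fine_gt0// fpos invariant_finite. Qed.

(** Iterating the contraction and integrating the second state against the
    invariant distribution. *)
Let geometric_functions : exists (M : T -> R) rho, [/\ forall x, 0 <= M x, 0 <= rho < 1 &
  forall (phi : T -> R), measurable_fun setT phi -> (forall z, 0 <= phi z <= 1) ->
  forall x n, S x -> exists2 u : R, ntrans n (EFin \o phi) x = u%:E &
    `|u - (\int[mu]_z (phi z * f z)) / m| <= M x * rho ^+ n].
Proof.
have [beta [rho [b0 /andP[rho0 rho1] contr]]] := contraction.
pose v := \int[mu]_z (V z * f z).
exists (fun x => 2 + beta * V x + beta * v / m), rho; split; last first.
- move=> phi mphi phi01.
  have mphiE : measurable_fun setT (EFin \o phi) by exact/measurable_EFinP.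
  have phi0 z : (0 <= (EFin \o phi) z)%E.
    by rewrite /= lee_fin; case/andP: (phi01 z).
  have phi1 z : ((EFin \o phi) z <= 1)%E.
    by rewrite /= lee_fin; case/andP: (phi01 z).
  pose ph n x := fine (ntrans n (EFin \o phi) x).
  have phE n x : ntrans n (EFin \o phi) x = (ph n x)%:E.
    rewrite fineK// ge0_fin_numE ?ntrans_ge0//.
    by rewrite (le_lt_trans (ntrans_le1 n mphiE phi0 phi1 x))// ltry.
  have mph n : measurable_fun setT (ph n).
    apply/measurable_EFinP; rewrite (_ : _ \o _ = ntrans n (EFin \o phi)).
      exact: measurable_ntrans.
    by apply/funext => x /=; rewrite -phE.
  have ph01 n x : 0 <= ph n x <= 1.
    by rewrite -!lee_fin -phE ntrans_ge0//= ntrans_le1.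
  have osc n x y : S x -> S y ->
      ph n x - ph n y <= rho ^+ n * (2 + beta * V x + beta * V y).
    elim: n x y => [|n ih] x y Sx Sy.
      have bx : 0 <= beta * V x by rewrite mulr_ge0.
      have by_ : 0 <= beta * V y by rewrite mulr_ge0.
      rewrite expr0 mul1r; have := ph01 0%N x; have := ph01 0%N y; lra.
    have := contr _ _ (mph n) (ph01 n) (exprn_ge0 n rho0) ih x y Sx Sy.
    rewrite -exprS; congr (_ <= _).
    by congr (_ - _); rewrite /Pr /ph /= /P /Rintegral; congr fine;
      apply: eq_integral => z _; rewrite phE EFinM.
  move=> x n Sx; exists (ph n x); first exact: phE.
  have E : \int[mu]_z (phi z * f z) = \int[mu]_z (ph n z * f z).
    rewrite /Rintegral; congr fine.
    under eq_integral do rewrite EFinM.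
    rewrite -(invariant_ntrans n mphiE phi0).
    by apply: eq_integral => z _; rewrite phE EFinM.
  rewrite E.
  have pf := iphif (mph n) (ph01 n).
  have rn0 : 0 <= rho ^+ n by exact: exprn_ge0.
  have := @Rintegral_lincomb_ge0 _ _ _ mu [:: (rho ^+ n * (2 + beta * V x) - ph n x, f);
    (rho ^+ n * beta, fun z => V z * f z); (1, fun z => ph n z * f z)].
  have := @Rintegral_lincomb_ge0 _ _ _ mu [:: (rho ^+ n * (2 + beta * V x) + ph n x, f);
    (rho ^+ n * beta, fun z => V z * f z); (-1, fun z => ph n z * f z)].
  rewrite !big_cons !big_nil /= !addr0 -/m -/v => h1 h2.
  have {}h1 : 0 <= (rho ^+ n * (2 + beta * V x) + ph n x) * m +
      (rho ^+ n * beta * v + -1 * \int[mu]_z (ph n z * f z)).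
    apply: h1.
    - by move=> q; do 3 (case=> [<-//|]); by [].
    - move=> z; rewrite !big_cons big_nil /= addr0.
      have [Sz|Sz] := pselect (S z); last by rewrite fS//; lra.
      rewrite !mulrA -!mulrDl mulr_ge0//.
      by have := osc n z x Sz Sx; lra.
  have {}h2 : 0 <= (rho ^+ n * (2 + beta * V x) - ph n x) * m +
      (rho ^+ n * beta * v + 1 * \int[mu]_z (ph n z * f z)).
    apply: h2.
    - by move=> q; do 3 (case=> [<-//|]); by [].
    - move=> z; rewrite !big_cons big_nil /= addr0.
      have [Sz|Sz] := pselect (S z); last by rewrite fS//; lra.
      rewrite !mulrA -!mulrDl mulr_ge0//.
      by have := osc n x z Sx Sz; lra.
  set w := \int[mu]_z (ph n z * f z) in h1 h2 *.
  have -> : ph n x - w / m = (ph n x * m - w) / m by field; rewrite gt_eqF.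
  have -> : (2 + beta * V x + beta * v / m) * rho ^+ n =
     (((2 + beta * V x) * m + beta * v) * rho ^+ n) / m by field; rewrite gt_eqF.
  rewrite normrM [`|m^-1|]gtr0_norm ?invr_gt0// ler_pM2r ?invr_gt0//.
  rewrite ler_norml; apply/andP; split; lra.
- by rewrite rho0.
- move=> x; have v0 : 0 <= v by apply: Rintegral_ge0 => z _; rewrite mulr_ge0.
  by rewrite !addr_ge0// ?mulr_ge0// ?invr_ge0 ltW.
Qed.

(** Drift and minorization give geometric convergence in total variation: the
    families of sets in the definition of the norm are split according to the
    sign of the signed measure. *)
Theorem geometric_ergodicity : geometric_tv_bound mu S k
  (fun A => \int[mu]_(z in A `&` S) (f z / fine (\int[mu]_x (f x)%:E))%:E)%E.
Proof.
have [M [rho [M0 rho01 bnd]]] := geometric_functions.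
exists (fun x => 2 * M x), rho; split => //; first by move=> x _; rewrite mulr_ge0.
move=> x n Sx; apply: ge_ereal_sup => _ [l [F [mF FS tF ->]]].
have mi i : measurable_fun setT (\1_(F i) : T -> R) by exact: measurable_indic.
have i0 i z : 0 <= (\1_(F i) : T -> R) z by [].
have i01 i z : 0 <= (\1_(F i) : T -> R) z <= 1.
  by rewrite i0 indicE/=; case: (_ \in _).
pose Phi (Q : pred 'I_l) z : R := \sum_(i | Q i) \1_(F i) z.
have mPhi Q : measurable_fun setT (Phi Q).
  by rewrite /Phi; under eq_fun do rewrite -big_filter; exact: measurable_sum.
have Phi01 Q z : 0 <= Phi Q z <= 1.
  rewrite sumr_ge0//=; have [[i zi]|nz] := pselect (exists i, F i z).
    rewrite /Phi (eq_bigr (fun j => (j == i)%:R)).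
      apply: (@le_trans _ _ (\sum_j (j == i)%:R : R)).
        by rewrite big_mkcond ler_sum// => j _; case: (Q j).
      by rewrite (bigD1 i)//= eqxx big1 ?addr0// => j /negbTE ->.
    move=> j _; rewrite indicE; congr ((nat_of_bool _)%:R); apply/idP/idP.
      move=> /set_mem zj; apply/eqP; move/trivIsetP : tF => /(_ j i I I).
      have [//|ji /(_ isT)] := eqVneq j i.
      by move=> /seteqP[/(_ z) + _] => /(_ (conj zj zi)).
    by move=> /eqP ->; apply: mem_set.
  rewrite /Phi big1// => i _; rewrite indicE memNset// => Fz; apply: nz; by exists i.
have ex (phi : T -> R) : exists u : R, measurable_fun setT phi ->
   (forall z, 0 <= phi z <= 1) -> ntrans n (EFin \o phi) x = u%:E /\
    `|u - (\int[mu]_z (phi z * f z)) / m| <= M x * rho ^+ n.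
  have [[mphi h]|nh] := pselect (measurable_fun setT phi /\ forall z, 0 <= phi z <= 1).
    by have [u ? ?] := bnd phi mphi h x n Sx; exists u.
  by exists 0 => ? ?; exfalso; apply: nh.
have /choice[U hU] := ex.
pose nu i := U (\1_(F i)) - (\int[mu]_z (\1_(F i) z * f z)) / m.
have nuE i : (nstep mu S k n x (F i) -
    \int[mu]_(z in F i `&` S) (f z / fine (\int[mu]_x (f x)%:E))%:E)%E = (nu i)%:E.
  rewrite nstep_ntrans// (hU _ (mi i) (i01 i)).1 EFinB; congr (_ - _)%E.
  rewrite setIidl//.
  rewrite integral_mkcond /= mulrC -RintegralZl//; last exact: iphif.
  rewrite /Rintegral fineK.
    apply: eq_integral => z _; rewrite patchE indicE; case: ifPn => _.
      by rewrite mul1r mulrC.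
    by rewrite mul0r mulr0.
  have := integrableZl measurableT m^-1 (iphif (mi i) (i01 i)).
  by move=> /(integrable_fin_num measurableT); under eq_integral do rewrite /= -EFinM.
under eq_bigr do rewrite nuE abse_EFin.
rewrite sumEFin lee_fin.
have nuPhi Q : \sum_(i | Q i) nu i = U (Phi Q) - (\int[mu]_z (Phi Q z * f z)) / m.
  rewrite sumrB; congr (_ - _).
    apply: EFin_inj; rewrite -(hU _ (mPhi Q) (Phi01 Q)).1.
    rewrite /Phi -sumEFin.
    transitivity (ntrans n (fun z => (\sum_(i <- [seq i <- index_enum _ | Q i]) \1_(F i) z)%:E) x).
      rewrite ntrans_sum// big_filter.
      by apply: eq_bigr => i _; rewrite -(hU _ (mi i) (i01 i)).1.
    by congr (ntrans n _ x); apply/funext => z; rewrite big_filter.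
  rewrite -mulr_suml; congr (_ / _).
  have [|_] := @integrable_lincomb _ _ _ mu
     [seq (1, fun z => \1_(F i) z * f z) | i <- index_enum _ & Q i].
    by move=> p /List.in_map_iff[i [<- _]]; exact: iphif.
  rewrite big_map big_filter.
  under [in RHS]eq_bigr do rewrite /= mul1r.
  move=> <-; apply: eq_Rintegral => z _; rewrite big_map big_filter /= mulr_suml.
  by apply: eq_bigr => i _; rewrite mul1r.
rewrite (bigID (fun i => 0 <= nu i))/=.
rewrite (eq_bigr nu); last by move=> i /ger0_norm.
rewrite [X in _ + X](eq_bigr (fun i => - nu i)); last first.
  by move=> i; rewrite -ltNge => /ltr0_norm.
rewrite sumrN !nuPhi.
set Q1 := (fun i => 0 <= nu i); set Q2 := (fun i => ~~ (0 <= nu i)).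
have := (hU _ (mPhi Q1) (Phi01 Q1)).2; have := (hU _ (mPhi Q2) (Phi01 Q2)).2.
rewrite !ler_norml => /andP[h1 h2] /andP[h3 h4].
lra.
Qed.

End harris.

(** * Lebesgue measure on tuples *)

Section integral_aux.
Context d (T : measurableType d) (R : realType).
Variable mu : {measure set T -> \bar R}.
Local Open Scope ereal_scope.

Lemma integral_gt0 (D : set T) (h : T -> R) : measurable D -> measurable_fun D h ->
  (forall x, D x -> (0 < h x)%R) -> mu D != 0 -> 0 < \int[mu]_(x in D) (h x)%:E.
Proof.
move=> mD mh h0 muD; rewrite lt0e integral_ge0 ?andbT; last first.
  by move=> x /h0 ?; rewrite lee_fin ltW.
apply: contra_neq muD => i0.
have mhE : measurable_fun D (EFin \o h) by exact/measurable_EFinP.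
have : \int[mu]_(x in D) `|(EFin \o h) x| = 0.
  by rewrite -i0; apply: eq_integral => x /set_mem/h0 ?; rewrite gee0_abs// lee_fin ltW.
move=> /(ae_eq_integral_abs mu mD mhE)[N [mN N0 DN]].
apply: (subset_measure0 mD mN _ N0) => x Dx; apply: DN => /=.
by move=> /(_ Dx)[h00]; have := h0 x Dx; rewrite h00 ltxx.
Qed.

End integral_aux.

Section lebesgue_translation.
Context (R : realType).
Local Notation mu := (@lebesgue_measure R).
Local Open Scope ereal_scope.

Lemma measurable_addr (h : R) :
  measurable_fun setT ((fun x => x + h)%R : measurableTypeR R -> measurableTypeR R).
Proof. exact: measurable_funD. Qed.

Lemma lebesgue_measure_translation (h : R) (A : set R) : measurable A ->
  pushforward mu ((fun x => x + h)%R : measurableTypeR R -> measurableTypeR R) A = mu A.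
Proof.
move=> mA; apply/esym/lebesgue_measure_unique => //.
  exact: measurable_addr.
move=> mh X /= [[a b]] _ <-. rewrite [in RHS]/= /pushforward.
rewrite (_ : _ @^-1` _ = `](a - h)%R, (b - h)%R]%classic); last first.
  by apply/seteqP; split => x /=; rewrite !in_itv/= ltrBlDr lerBrDr.
rewrite !lebesgue_measure_itv/= !lte_fin ltrD2r.
by case: ifPn => // _; rewrite -!EFinB; congr EFin; lra.
Qed.

Lemma integral_translation (h : R) (g : R -> \bar R) : measurable_fun setT g ->
  (forall x, 0 <= g x) -> \int[mu]_x g (x + h)%R = \int[mu]_x g x.
Proof.
move=> mg g0.
rewrite -[LHS](@ge0_integral_pushforward _ _ _ _ _ _ (measurable_addr h) mu setT g)//.
apply: eq_measure_integral; first exact: measurable_addr.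
by move=> mh A mA _; exact: lebesgue_measure_translation.
Qed.

End lebesgue_translation.

Section lebesgue_vec_integral.
Context (R : realType).
Local Notation mu := (@lebesgue_measure R).
Local Notation lam := (@lebesgue_vec R).
Local Open Scope ereal_scope.

Lemma tnth_consv0 n x (t : Rvec R n) : tnth (consv (x, t)) ord0 = x.
Proof. by []. Qed.

Lemma tnth_consvS n x (t : Rvec R n) i : tnth (consv (x, t)) (lift ord0 i) = tnth t i.
Proof. by rewrite tnthS; congr tnth; apply/val_inj. Qed.

Lemma integral_lebesgue_cons n (F : Rvec R n.+1 -> \bar R) : measurable_fun setT F ->
  (forall x, 0 <= F x) ->
  \int[lam n.+1]_x F x = \int[mu]_x \int[lam n]_t F (consv (x, t)).
Proof.
move=> mF F0.
rewrite -(@fubini_tonelli1 _ _ _ _ _ mu (lam n) (F \o @consv R n)); last 2 first.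
- by apply: measurableT_comp => //; exact: measurable_consv.
- by move=> z; exact: F0.
rewrite -[RHS](@ge0_integral_pushforward _ _ _ _ _ _ (@measurable_consv R n)
  (mu \x lam n)%E setT F)//.
Qed.

Definition insertv n (i : 'I_n.+1) (z : measurableTypeR R * Rvec R n) : Rvec R n.+1 :=
  [tuple if unlift i j is Some j' then tnth z.2 j' else z.1 | j < n.+1].

Lemma insertv_eq n (i : 'I_n.+1) z : tnth (insertv i z) i = z.1.
Proof. by rewrite tnth_mktuple unlift_none. Qed.

Lemma insertv_lift n (i : 'I_n.+1) z j : tnth (insertv i z) (lift i j) = tnth z.2 j.
Proof. by rewrite tnth_mktuple liftK. Qed.

Lemma measurable_insertv n (i : 'I_n.+1) : measurable_fun setT (insertv i).
Proof.
apply/measurable_fun_tnthP => j; case: (unliftP i j) => [j'|] ->.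
  rewrite (_ : _ \o _ = (@tnth n _ ^~ j') \o snd).
    by apply: measurableT_comp => //; exact: measurable_tnth.
  by apply/funext => z /=; rewrite insertv_lift.
rewrite (_ : _ \o _ = fst); first exact: measurable_fst.
by apply/funext => z /=; rewrite insertv_eq.
Qed.

Lemma insertv0 n z : insertv (@ord0 n) z = consv z.
Proof.
case: z => x t; apply: eq_from_tnth => j; case: (unliftP ord0 j) => [j'|] ->.
  by rewrite insertv_lift tnth_consvS.
by rewrite insertv_eq tnth_consv0.
Qed.

Lemma insertvS n (i : 'I_n.+1) x x0 (t : Rvec R n) :
  insertv (lift ord0 i) (x, consv (x0, t)) = consv (x0, insertv i (x, t)).
Proof.
apply: eq_from_tnth => j; case: (unliftP (lift ord0 i) j) => [j'|] ->.
  rewrite insertv_lift /=; case: (unliftP ord0 j') => [j''|] ->.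
    have -> : lift (lift ord0 i) (lift ord0 j'') = lift ord0 (lift i j'').
      by apply/val_inj; rewrite /= /bump /= !add1n ltnS !addnS.
    by rewrite !tnth_consvS insertv_lift.
  have -> : lift (lift ord0 i) ord0 = ord0 by apply/val_inj.
  by rewrite !tnth_consv0.
by rewrite insertv_eq tnth_consvS insertv_eq.
Qed.

(** Lebesgue measure on tuples integrates the coordinates in a fixed order;
    Tonelli allows any of them to come first. *)
Lemma integral_lebesgue_insert n (i : 'I_n.+1) (F : Rvec R n.+1 -> \bar R) :
  measurable_fun setT F -> (forall x, 0 <= F x) ->
  \int[lam n.+1]_x F x = \int[lam n]_t \int[mu]_x F (insertv i (x, t)).
Proof.
move=> mF F0.
rewrite -(@fubini_tonelli _ _ _ _ _ mu (lam n) (F \o insertv i)); last 2 first.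
- by apply: measurableT_comp => //; exact: measurable_insertv.
- by move=> z; exact: F0.
elim: n i F mF F0 => [i F mF F0|n ih i F mF F0].
  rewrite (ord1 i) (integral_lebesgue_cons mF F0).
  by under [RHS]eq_integral do under eq_integral do rewrite /= insertv0.
case: (unliftP ord0 i) => [j|] ->; last first.
  rewrite (integral_lebesgue_cons mF F0).
  by under [RHS]eq_integral do under eq_integral do rewrite /= insertv0.
rewrite (integral_lebesgue_cons mF F0).
pose H (z : measurableTypeR R * measurableTypeR R) :=
  \int[lam n]_t F (consv (z.1, insertv j (z.2, t))).
have mcons : measurable_fun setT
    (fun w : (measurableTypeR R * measurableTypeR R) * Rvec R n =>
      F (consv (w.1.1, insertv j (w.1.2, w.2)))).
  apply: measurableT_comp => //.
  apply: (measurable_cons (f := fun w => w.1.1)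
    (g := fun w => insertv j (w.1.2, w.2))).
    exact: measurableT_comp.
  apply: (measurableT_comp (measurable_insertv j)
    (g := fun w : (measurableTypeR R * measurableTypeR R) * Rvec R n => (w.1.2, w.2))).
  by apply: measurable_fun_pair => //; exact: measurableT_comp.
have mH : measurable_fun setT H.
  by apply: (@measurable_fun_fubini_tonelli_F _ _ _ _ _ (lam n) _ mcons) => w.
transitivity (\int[mu]_x0 \int[mu]_x H (x0, x)).
  apply: eq_integral => x0 _; rewrite (ih j)//.
  apply: measurableT_comp => //.
  exact: (measurableT_comp (@measurable_consv R _) (pair1_measurable x0)).
rewrite (@fubini_tonelli _ _ _ _ _ mu mu H)//; last first.
  by move=> z; exact: integral_ge0.
apply: eq_integral => x _; rewrite integral_lebesgue_cons; last 2 first.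
- apply: (measurableT_comp (f := F)) => //.
  exact: (measurableT_comp (measurable_insertv _) (pair1_measurable x)).
- by move=> z; exact: F0.
by apply: eq_integral => x0 _; apply: eq_integral => t _ /=; rewrite insertvS.
Qed.

Definition shiftv n (x h : Rvec R n) : Rvec R n := [tuple (tnth x i + tnth h i)%R | i < n].

Lemma measurable_shiftv n (h : Rvec R n) : measurable_fun setT (fun x => shiftv x h).
Proof.
apply/measurable_fun_tnthP => j.
rewrite (_ : _ \o _ = fun x => (tnth x j + tnth h j)%R); last first.
  by apply/funext => x /=; rewrite tnth_mktuple.
by apply: measurable_funD => //; exact: measurable_tnth.
Qed.

Lemma shiftv_consv n x h (t u : Rvec R n) :
  shiftv (consv (x, t)) (consv (h, u)) = consv ((x + h)%R, shiftv t u).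
Proof.
apply: eq_from_tnth => j; rewrite tnth_mktuple; case: (unliftP ord0 j) => [j'|] ->.
  by rewrite !tnth_consvS tnth_mktuple.
by rewrite !tnth_consv0.
Qed.

Lemma consv_behead n (x : Rvec R n.+1) : consv (thead x, [tuple of behead x]) = x.
Proof. by apply/val_inj => /=; case: x => -[]. Qed.

Lemma integral_lebesgue_vec_translation n (h : Rvec R n) (F : Rvec R n -> \bar R) :
  measurable_fun setT F -> (forall x, 0 <= F x) ->
  \int[lam n]_x F (shiftv x h) = \int[lam n]_x F x.
Proof.
elim: n h F => [|n ih] h F mF F0.
  by apply: eq_integral => x _; congr F; rewrite [RHS]tuple0 [LHS]tuple0.
have mFs : measurable_fun setT (fun x => F (shiftv x h)).
  by apply: measurableT_comp => //; exact: measurable_shiftv.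
rewrite (integral_lebesgue_cons mFs (fun x => F0 _)) (integral_lebesgue_cons mF F0).
rewrite -(consv_behead h); set h0 := thead h; set h' := [tuple of _].
transitivity (\int[mu]_x \int[lam n]_t F (consv ((x + h0)%R, t))).
  apply: eq_integral => x _; under eq_integral do rewrite shiftv_consv.
  rewrite (ih h' (fun t => F (consv ((x + h0)%R, t))))//.
  apply: measurableT_comp => //.
  exact: (measurableT_comp (@measurable_consv R _) (pair1_measurable _)).
rewrite (integral_translation h0 (g := fun x => \int[lam n]_t F (consv (x, t))))//.
- apply: (@measurable_fun_fubini_tonelli_F _ _ _ _ _ (lam n) (F \o @consv R n)).
  by apply: measurableT_comp => //; exact: measurable_consv.
- by move=> z; exact: F0.
- by move=> x; exact: integral_ge0.
Qed.

Lemma integral_lebesgue_vec_prod n (g : 'I_n -> R -> R) :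
  (forall i, measurable_fun setT (g i)) -> (forall i x, (0 <= g i x)%R) ->
  \int[lam n]_x (\prod_i g i (tnth x i))%:E = \prod_i \int[mu]_x (g i x)%:E.
Proof.
elim: n g => [|n ih] g mg g0.
  rewrite big_ord0; under eq_integral do rewrite big_ord0.
  by rewrite integral_cst// mul1e /= diracT.
have mp m (k : 'I_m -> R -> R) : (forall i, measurable_fun setT (k i)) ->
    measurable_fun setT (fun x : Rvec R m => (\prod_i k i (tnth x i))%R).
  move=> mk; apply: measurable_prod => i _.
  exact: (measurableT_comp (mk i) (measurable_tnth i)).
rewrite integral_lebesgue_cons; last 2 first.
- by apply/measurable_EFinP; exact: mp.
- by move=> x; rewrite lee_fin prodr_ge0.
rewrite big_ord_recl -ih//.
rewrite -ge0_integralZr//.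
- apply: eq_integral => x _; rewrite -ge0_integralZl//.
  + by apply: eq_integral => t _; rewrite big_ord_recl -EFinM;
      congr (_ * _)%:E; apply: eq_bigr => i _; rewrite tnth_consvS.
  + by apply/measurable_EFinP; exact: (mp n (fun i => g (lift ord0 i))).
  + by move=> t _; rewrite lee_fin prodr_ge0.
  + by rewrite lee_fin.
- by apply/measurable_EFinP; exact: mg.
- by move=> x _; rewrite lee_fin.
- by apply: integral_ge0 => t _; rewrite lee_fin prodr_ge0.
Qed.

Lemma lebesgue_vec_hyperplane n (j : 'I_n) : lam n [set x | tnth x j = 0%R] = 0.
Proof.
pose A i : set (measurableTypeR R) := if i == j then [set 0%R] else setT.
rewrite (_ : [set _ | _] = [set x : Rvec R n | forall i, A i (tnth x i)]).
  rewrite lebesgue_vec_box; first by rewrite (bigD1 j)//= /A eqxx lebesgue_measure_set1 mul0e.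
  by move=> i; rewrite /A; case: ifP => // _; exact: measurable_set1.
apply/seteqP; split => x /=.
  by move=> xj i; rewrite /A; case: ifPn => // /eqP ->.
by move=> /(_ j); rewrite /A eqxx.
Qed.

End lebesgue_vec_integral.

(** * The gamma function and the inverse gamma law *)

Section gamma_function.
Context (R : realType).
Local Notation mu := (@lebesgue_measure R).
Implicit Types c d s t x a : R.

Lemma integral_expRN_tail x :
  (\int[mu]_(t in `]x, +oo[) (expR (- t))%:E = (expR (- x))%:E)%E.
Proof.
rewrite integral_itv_obnd_cbnd; last first.
  by apply/measurable_EFinP; apply: measurable_funTS; exact: measurableT_comp.
have dF t : is_derive t 1 (fun t => - expR (- t)) (expR (- t)).
  by apply: is_derive_eq; rewrite /GRing.scale/=; ring.
have cN : continuous (fun t : R => expR (- t)).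
  move=> t; apply: continuous_comp; last exact: continuous_expR.
  by apply: cvgN; exact: cvg_id.
rewrite (@ge0_continuous_FTC2y _ _ (fun t => - expR (- t)) _ 0)//.
- by rewrite EFinN oppeK add0e.
- exact: continuous_subspaceT.
- by rewrite -oppr0; apply: cvgN; exact: cvgr_expR.
- apply: cvgN; apply: cvg_at_right_filter; exact: cN.
- by move=> t _; rewrite derive1E; have [_ ->] := dF t.
Qed.

Lemma powR_small c e x : 0 < c -> 0 < e -> 0 <= x -> x <= e `^ c^-1 -> x `^ c <= e.
Proof.
move=> c0 e0 x0 xe.
rewrite -[leRHS](powRr1 (ltW e0)) -(mulVf (lt0r_neq0 c0)) powRrM.
by apply: ge0_ler_powR; rewrite ?nnegrE ?powR_ge0 ?(ltW c0).
Qed.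

Lemma powRN_cvg0 c : 0 < c -> t `^ (- c) @[t --> +oo] --> (0 : R).
Proof.
move=> c0; apply/cvgr0Pnorm_le => e e0; near=> t.
have t0 : 0 < t by [].
rewrite ger0_norm ?powR_ge0//.
have -> : t `^ (- c) = (t^-1) `^ c.
  by rewrite -(powR_inv1 (ltW t0)) -powRrM mulN1r.
apply: powR_small => //; first by rewrite invr_ge0 ltW.
rewrite -[leRHS]invrK lef_pV2 ?posrE ?invr_gt0 ?powR_gt0//.
Unshelve. all: by end_near.
Qed.

Lemma integral_powRN_tail a c : 0 < a -> 0 < c ->
  (\int[mu]_(t in `]a, +oo[) (t `^ (- c - 1))%:E = (a `^ (- c) / c)%:E)%E.
Proof.
move=> a0 c0.
rewrite integral_itv_obnd_cbnd; last first.
  by apply/measurable_EFinP; apply: measurable_funTS; exact: measurable_powR.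
have dF t : 0 < t -> is_derive t 1 (fun t => - c^-1 * t `^ (- c)) (t `^ (- c - 1)).
  move=> t0; have d1 := is_derive1_powR (- c) t0.
  apply: is_derive_eq; rewrite /GRing.scale/= mulrA mulrNN mulVf ?mul1r//.
  by rewrite gt_eqF.
rewrite (@ge0_continuous_FTC2y _ _ (fun t => - c^-1 * t `^ (- c)) _ 0)//.
- by rewrite sub0e -EFinN mulNr opprK mulrC.
- by move=> t _; exact: powR_ge0.
- apply: derivable_within_continuous => t; rewrite in_itv/= andbT => at_.
  by apply: derivable_powR; rewrite in_itv/= andbT (lt_le_trans a0).
- rewrite -[X in _ --> X](mulr0 (- c^-1)); apply: cvgM; first exact: cvg_cst.
  exact: powRN_cvg0.
- by move=> t at_; have [] := dF t (lt_trans a0 at_).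
- apply: cvg_at_right_filter.
  have /derivable1_diffP/differentiable_continuous : derivable (fun t => - c^-1 * t `^ (- c)) a 1.
    by have [] := dF a a0.
  exact.
- by move=> t; rewrite in_itv/= andbT => at_; rewrite derive1E;
    have [_ ->] := dF t (lt_trans a0 at_).
Qed.

Lemma integral_powR_head a c : 0 < a -> 0 < c ->
  (\int[mu]_(t in `]0%R, a]) (t `^ (c - 1))%:E = (a `^ c / c)%:E)%E.
Proof.
move=> a0 c0.
pose F n : set (measurableTypeR R) := `[a / n.+2%:R, a]%classic.
have mF n : measurable (F n) by exact: measurable_itv.
have FE : \bigcup_n F n = `]0, a]%classic.
  apply/seteqP; split => [x [n _]|x] /=; rewrite /F /= !in_itv/= => /andP[x1 x2].
    by rewrite x2 andbT (lt_le_trans _ x1)// divr_gt0.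
  exists (Num.bound (a / x)) => //=; rewrite in_itv/= x2 andbT.
  rewrite ler_pdivrMr// mulrC -ler_pdivrMr// ltW//.
  apply: (lt_le_trans (archi_boundP _)); first by rewrite divr_ge0 ?ltW.
  by rewrite ler_nat ltnW.
have ndF : nondecreasing_seq F.
  move=> m n mn; apply/subsetPset => x; rewrite /F /= !in_itv/= => /andP[x1 ->].
  by rewrite andbT (le_trans _ x1)// ler_pM2l// lef_pV2 ?posrE// ler_nat.
pose f (t : measurableTypeR R) := (t `^ (c - 1))%:E.
have mf n : measurable_fun (F n) f.
  by apply/measurable_EFinP; apply: measurable_funTS; exact: measurable_powR.
have f0 n x : F n x -> (0 <= f x)%E by move=> _; rewrite lee_fin powR_ge0.
have := @ge0_nondecreasing_set_cvg_integral _ (measurableTypeR R) _ _ f mu ndF mF mf f0.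
rewrite FE => /cvg_lim <-//; apply/cvg_lim => //.
have dG t : 0 < t -> is_derive t 1 (fun t => c^-1 * t `^ c) (t `^ (c - 1)).
  move=> t0; have d1 := is_derive1_powR c t0.
  apply: is_derive_eq; rewrite /GRing.scale/= mulrA mulVf ?mul1r//.
  by rewrite gt_eqF.
have contG t : 0 < t -> continuous_at t (fun t => c^-1 * t `^ c).
  move=> t0.
  have /derivable1_diffP/differentiable_continuous : derivable (fun t => c^-1 * t `^ c) t 1.
    by have [] := dG t t0.
  exact.
have -> : (fun n => \int[mu]_(t in F n) f t)%E =
    (fun n => (a `^ c / c - c^-1 * (a / n.+2%:R) `^ c)%:E).
  apply/funext => n; rewrite /F.
  have an0 : 0 < a / n.+2%:R by rewrite divr_gt0.
  rewrite (@continuous_FTC2 _ _ (fun t => c^-1 * t `^ c)).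
  - by rewrite -EFinB (mulrC (c^-1)).
  - by rewrite ltr_pdivrMr// ltr_pMr// ltr1n.
  - apply: derivable_within_continuous => t; rewrite in_itv/= => /andP[at_ _].
    by apply: derivable_powR; rewrite in_itv/= andbT (lt_le_trans an0).
  - split.
    + move=> t; rewrite in_itv/= => /andP[at_ _].
      by have [] := dG t (lt_trans an0 at_).
    + by apply: cvg_at_right_filter; exact: contG.
    + by apply: cvg_at_left_filter; exact: contG.
  - move=> t; rewrite in_itv/= => /andP[at_ _]; rewrite derive1E.
    by have [_ ->] := dG t (lt_trans an0 at_).
apply: cvg_EFin; first by near=> n.
rewrite -[X in _ --> X]subr0 -[X in _ - X](mulr0 c^-1).
apply: cvgB; first exact: cvg_cst.
apply: cvgM; first exact: cvg_cst.
apply/cvgr0Pnorm_le => e e0; near=> n.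
rewrite ger0_norm ?powR_ge0//; apply: powR_small => //; first by rewrite divr_ge0// ltW.
rewrite ler_pdivrMr// mulrC -ler_pdivrMr ?powR_gt0//.
near: n; exists (Num.bound (a / e `^ c^-1)) => // n /= hn.
apply: ltW; apply: (lt_le_trans (archi_boundP _)); first by rewrite divr_ge0 ?powR_ge0 ?ltW.
by rewrite ler_nat ltnW// ltnW.
Unshelve. all: by end_near.
Qed.

Lemma measurable_invr : measurable_fun setT (fun t : R => t^-1).
Proof.
have -> : (fun t : R => t^-1) = (fun t => t * (t ^+ 2) `^ (-1)).
  apply/funext => t; rewrite powR_inv1 ?sqr_ge0//.
  by have [->|t0] := eqVneq t 0; [rewrite invr0 mul0r|field].
apply: measurable_funM => //.
by apply: (measurableT_comp (measurable_powR (-1))); exact: measurable_funX.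
Qed.

Lemma measurable_expRN : measurable_fun setT (fun t : measurableTypeR R => expR (- t)).
Proof. exact: measurableT_comp. Qed.

(** Tonelli's theorem applied to [expR (- w x)] written as the integral of
    [expR (- t)] over [t > w x]. All the gamma integrals below are of this form,
    for which only powers remain to be integrated. *)
Lemma integral_layer (u w : measurableTypeR R -> R) :
  measurable_fun setT u -> measurable_fun setT w ->
  (forall x, 0 < x -> 0 <= u x) -> (forall x, 0 < x -> 0 < w x) ->
  (\int[mu]_(x in `]0%R, +oo[) (u x * expR (- w x))%:E =
   \int[mu]_(t in `]0%R, +oo[) ((expR (- t))%:E *
      \int[mu]_(x in [set x | (0 < x)%R /\ (w x < t)%R]) (u x)%:E))%E.
Proof.
move=> mu_ mw u0 w0.
pose h (z : measurableTypeR R * measurableTypeR R) : R :=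
  u z.1 * expR (- z.2) * ((0 < z.1) && (w z.1 < z.2))%:R.
have mb : measurable_fun setT (fun z : measurableTypeR R * measurableTypeR R =>
    (((0 < z.1) && (w z.1 < z.2)) : bool)).
  apply: measurable_and; apply: measurable_fun_ltr => //.
  exact: measurableT_comp.
have mh : measurable_fun setT h.
  apply: measurable_funM; last first.
    have -> : (fun z : measurableTypeR R * measurableTypeR R =>
         ((0 < z.1) && (w z.1 < z.2))%:R : R) = (fun b : bool => b%:R) \o
         (fun z => ((0 < z.1) && (w z.1 < z.2))) by [].
    exact: measurableT_comp.
  apply: measurable_funM; first exact: measurableT_comp.
  exact: (measurableT_comp measurable_expRN).
have h0 z : 0 <= h z.
  rewrite /h; have [z0|] := ltP 0 z.1; last by rewrite mulr0.
  by rewrite !mulr_ge0 ?expR_ge0 ?u0.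
have EL x : (\int[mu]_t (h (x, t))%:E =
    if (0 < x)%R then (u x * expR (- w x))%:E else 0)%E.
  case: ifPn => x0; last first.
    by apply: integral0_eq => t _; rewrite /h /= (negbTE x0) mulr0.
  rewrite EFinM -integral_expRN_tail [X in (_ = _ * X)%E]integral_mkcond/=.
  rewrite -ge0_integralZl//; last 3 first.
  - apply/(measurable_restrictT _ (measurable_itv _)).
    by apply: measurable_funTS; apply/measurable_EFinP; exact: measurable_expRN.
  - by move=> t _; rewrite patchE; case: ifPn => // _; rewrite lee_fin expR_ge0.
  - by rewrite lee_fin u0.
  apply: eq_integral => t _; rewrite patchE /h /= x0/= mem_setE in_itv/= andbT.
  case: (w x < t) => /=; last by rewrite mulr0 mule0.
  by rewrite mulr1 EFinM.
have ER t : (\int[mu]_x (h (x, t))%:E = (expR (- t))%:E *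
    \int[mu]_(x in [set x | (0 < x)%R /\ (w x < t)%R]) (u x)%:E)%E.
  have mD : measurable [set x : measurableTypeR R | (0 < x)%R /\ (w x < t)%R].
    rewrite (_ : [set _ | _] = (fun x => (0 < x) && (w x < t)) @^-1` [set true]).
      rewrite -[X in measurable X]setTI.
      have : measurable_fun setT (fun x : measurableTypeR R => (0 < x) && (w x < t)).
        by apply: measurable_and; exact: measurable_fun_ltr.
      exact.
    by apply/seteqP; split => x /= /andP.
  rewrite [X in (_ = _ * X)%E]integral_mkcond/= -ge0_integralZl//; last 2 first.
  - apply/(measurable_restrictT _ mD).
    by apply: measurable_funTS; exact/measurable_EFinP.
  - by move=> x _; rewrite patchE; case: ifPn => //; rewrite inE => -[x0 _]; rewrite lee_fin u0.
  apply: eq_integral => x _; rewrite patchE /h /=; case: ifPn => [|/negP nD].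
    by rewrite inE /= => -[-> ->]; rewrite mulr1 mulrC EFinM.
  case: (boolP ((0 < x) && (w x < t))) => [/andP h1|_]; last by rewrite mulr0 mule0.
  by exfalso; apply: nD; rewrite inE.
rewrite [LHS]integral_mkcond [RHS]integral_mkcond.
transitivity (\int[mu]_x \int[mu]_t (h (x, t))%:E)%E.
  apply: eq_integral => x _; rewrite EL patchE mem_setE in_itv/= andbT.
  by [].
rewrite (@fubini_tonelli _ _ _ _ _ mu mu (EFin \o h)); last 2 first.
- by apply/measurable_EFinP; exact: mh.
- by move=> z; rewrite lee_fin h0.
apply: eq_integral => t _; rewrite ER patchE mem_setE in_itv/= andbT.
case: ifPn => // t0; rewrite (_ : [set _ | _] = set0) ?integral_set0 ?mule0//.
apply/seteqP; split => x //= [x0 wt]; move: t0; rewrite (lt_trans (w0 x x0) wt)//.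
Qed.

(** [Gamma] as an extended real, for use until it is known to be finite. *)
Definition eGamma c : \bar R :=
  (\int[mu]_(t in `]0%R, +oo[) (t `^ (c - 1) * expR (- t))%:E)%E.

Lemma eGamma_ge0 c : (0 <= eGamma c)%E.
Proof. by apply: integral_ge0 => t _; rewrite lee_fin mulr_ge0 ?powR_ge0 ?expR_ge0. Qed.

Let mpowexp e : measurable_fun setT (fun t : measurableTypeR R => t `^ e * expR (- t)).
Proof. by apply: measurable_funM; [exact: measurable_powR|exact: measurable_expRN]. Qed.

Lemma mul_eGamma c k : 0 <= k ->
  (\int[mu]_(t in `]0%R, +oo[) (k * (t `^ (c - 1) * expR (- t)))%:E = k%:E * eGamma c)%E.
Proof.
move=> k0; under eq_integral do rewrite EFinM; rewrite ge0_integralZl ?lee_fin//.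
  by apply/measurable_EFinP; apply: measurable_funTS.
by move=> t _; rewrite lee_fin mulr_ge0 ?powR_ge0 ?expR_ge0.
Qed.

Lemma eGamma_scaleS c d : 0 < c -> 0 < d ->
  (\int[mu]_(t in `]0%R, +oo[) (t `^ (c - 1) * expR (- (d * t)))%:E =
   (d `^ (- c) / c)%:E * eGamma (c + 1))%E.
Proof.
move=> c0 d0.
rewrite (@integral_layer (fun t => t `^ (c - 1)) (fun t => d * t)).
- rewrite -mul_eGamma; last by rewrite divr_ge0 ?powR_ge0 ?ltW.
  apply: eq_integral => t; rewrite inE/= in_itv/= andbT => t0.
  rewrite (_ : [set x | _] = `]0, t / d[%classic); last first.
    by apply/seteqP; split => x /=; rewrite in_itv/= ltr_pdivlMr// mulrC => /andP.
  rewrite integral_itv_bndo_bndc; last first.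
    by apply/measurable_EFinP; apply: measurable_funTS; exact: measurable_powR.
  rewrite integral_powR_head ?divr_gt0// -EFinM; congr EFin.
  rewrite addrK powRM ?invr_ge0 ?(ltW t0) ?(ltW d0)//.
  rewrite -(powR_inv1 (ltW d0)) -powRrM mulN1r; ring.
- exact: measurable_powR.
- exact: measurable_funM.
- by move=> x _; exact: powR_ge0.
- by move=> x x0; rewrite mulr_gt0.
Qed.

Lemma eGammaS c : 0 < c -> eGamma (c + 1) = (c%:E * eGamma c)%E.
Proof.
move=> c0; have := eGamma_scaleS c0 ltr01.
under eq_integral do rewrite mul1r.
rewrite powR1 div1r -/(eGamma c) => ->.
by rewrite muleA -EFinM divff ?mul1e// gt_eqF.
Qed.

Lemma integral_inv_gamma_kernelS c d : 0 < c -> 0 < d ->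
  (\int[mu]_(v in `]0%R, +oo[) (v `^ (- c - 1) * expR (- (d / v)))%:E =
   (d `^ (- c) / c)%:E * eGamma (c + 1))%E.
Proof.
move=> c0 d0.
rewrite (@integral_layer (fun t => t `^ (- c - 1)) (fun t => d / t)).
- rewrite -mul_eGamma; last by rewrite divr_ge0 ?powR_ge0 ?ltW.
  apply: eq_integral => t; rewrite inE/= in_itv/= andbT => t0.
  rewrite (_ : [set x | _] = `]d / t, +oo[%classic); last first.
    apply/seteqP; split => x /=; rewrite in_itv/= andbT.
      by move=> [x0]; rewrite !ltr_pdivrMr// mulrC.
    move=> dx; have x0 : 0 < x by rewrite (lt_trans _ dx)// divr_gt0.
    by split => //; move: dx; rewrite !ltr_pdivrMr// mulrC.
  rewrite integral_powRN_tail ?divr_gt0// -EFinM; congr EFin.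
  rewrite addrK powRM ?invr_ge0 ?(ltW t0) ?(ltW d0)//.
  rewrite -(powR_inv1 (ltW t0)) -powRrM mulN1r opprK; ring.
- exact: measurable_powR.
- by apply: measurable_funM => //; exact: measurable_invr.
- by move=> x _; exact: powR_ge0.
- by move=> x x0; rewrite divr_gt0.
Qed.

(** Direct comparison up to [c = 1], then the functional equation. *)
Lemma eGamma_lty c : 0 < c -> (eGamma c < +oo)%E.
Proof.
have small e : 0 < e -> e <= 1 -> (eGamma e < +oo)%E.
  move=> e0 e1; rewrite /eGamma.
  rewrite (_ : `]0, +oo[%classic = `]0, 1] `|` `]1, +oo[); last first.
    apply/seteqP; split => t /=; rewrite !in_itv/= !andbT.
      by move=> ->; case: leP => _; [left|right].
    by case=> [/andP[]//|]; apply: lt_trans.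
  rewrite ge0_integral_setU//=; last 3 first.
  - by apply/measurable_EFinP; apply: measurable_funTS.
  - by move=> t _; rewrite lee_fin mulr_ge0 ?powR_ge0 ?expR_ge0.
  - apply/disj_setPLR => x /=; rewrite !in_itv/= andbT => /andP[_ x1].
    by apply/negP; rewrite -leNgt.
  apply: lte_add_pinfty.
    apply: (@le_lt_trans _ _ (\int[mu]_(t in `]0%R, 1%R]) (t `^ (e - 1))%:E)%E).
      apply: ge0_le_integral => //.
      - by move=> t _; rewrite lee_fin mulr_ge0 ?powR_ge0 ?expR_ge0.
      - by apply/measurable_EFinP; apply: measurable_funTS.
      - by apply/measurable_EFinP; apply: measurable_funTS; exact: measurable_powR.
      - move=> t; rewrite /= in_itv/= => /andP[t0 _]; rewrite lee_fin ler_piMr ?powR_ge0//.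
        by rewrite expR_le1 oppr_le0 ltW.
    by rewrite integral_powR_head// ltry.
  apply: (@le_lt_trans _ _ (\int[mu]_(t in `]1%R, +oo[) (expR (- t))%:E)%E).
    apply: ge0_le_integral => //.
    - by move=> t _; rewrite lee_fin mulr_ge0 ?powR_ge0 ?expR_ge0.
    - by apply/measurable_EFinP; apply: measurable_funTS.
    - by apply/measurable_EFinP; apply: measurable_funTS; exact: measurable_expRN.
    - move=> t; rewrite /= in_itv/= andbT => t1; rewrite lee_fin ler_piMl ?expR_ge0//.
      have e1' : e - 1 <= 0 by rewrite subr_le0.
      by apply: (le_trans (ler_powR (ltW t1) e1')); rewrite powRr0.
  by rewrite integral_expRN_tail ltry.
move=> c0.
have H (n : nat) : forall e, 0 < e -> e <= n.+1%:R -> (eGamma e < +oo)%E.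
  elim: n => [|n ih] e e0 en; first exact: small.
  have [e1|e1] := leP e 1; first exact: small.
  rewrite -(subrK 1 e) eGammaS ?subr_gt0// lte_mul_pinfty ?lee_fin ?subr_ge0 ?ltW//.
  by apply: ih; rewrite ?subr_gt0// lerBlDr natr1.
apply: (H (Num.bound c)) => //.
by rewrite ltW// (lt_le_trans (archi_boundP _)) ?ler_nat// ltW.
Qed.

Lemma eGammaE c : 0 < c -> eGamma c = (Gamma c)%:E.
Proof.
move=> c0; rewrite fineK// ge0_fin_numE ?eGamma_ge0//; exact: eGamma_lty.
Qed.

Lemma Gamma_gt0 c : 0 < c -> 0 < Gamma c.
Proof.
move=> c0; rewrite -lte_fin -eGammaE//; apply: integral_gt0 => //.
- by apply: measurable_funTS.
- by move=> t; rewrite /= in_itv/= andbT => t0; rewrite mulr_gt0 ?powR_gt0 ?expR_gt0.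
- by rewrite /= lebesgue_measure_itv/= ltry.
Qed.

Lemma GammaS c : 0 < c -> Gamma (c + 1) = c * Gamma c.
Proof.
move=> c0; apply: EFin_inj; rewrite EFinM -!eGammaE//; first exact: eGammaS.
by rewrite addr_gt0.
Qed.

Lemma integral_gamma_kernel c d : 0 < c -> 0 < d ->
  (\int[mu]_(t in `]0%R, +oo[) (t `^ (c - 1) * expR (- (d * t)))%:E =
   (d `^ (- c) * Gamma c)%:E)%E.
Proof.
move=> c0 d0; rewrite eGamma_scaleS// eGammaS// eGammaE// -!EFinM; congr EFin.
by field; rewrite gt_eqF.
Qed.

Lemma integral_inv_gamma_kernel c d : 0 < c -> 0 < d ->
  (\int[mu]_(v in `]0%R, +oo[) (v `^ (- c - 1) * expR (- (d / v)))%:E =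
   (d `^ (- c) * Gamma c)%:E)%E.
Proof.
move=> c0 d0; rewrite integral_inv_gamma_kernelS// eGammaS// eGammaE// -!EFinM.
by congr EFin; field; rewrite gt_eqF.
Qed.

Let sqr_lt_mul (u v w : R) : 0 < w -> 2 * (v / w) * v < u + (v / w) ^+ 2 * w -> v ^+ 2 < u * w.
Proof.
move=> w0; rewrite -(ltr_pM2r w0).
have -> : 2 * (v / w) * v * w = 2 * v ^+ 2 by field; rewrite gt_eqF.
have -> : (u + (v / w) ^+ 2 * w) * w = u * w + v ^+ 2 by field; rewrite gt_eqF.
by lra.
Qed.

(** Strict logarithmic convexity of [Gamma] at a midpoint: the polynomial
    [kappa |-> int (t^((c-1)/2) - kappa t^((d-1)/2))^2 e^-t] is positive. *)
Lemma Gamma_midpoint c d : 0 < c -> c < d ->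
  Gamma ((c + d) / 2) ^+ 2 < Gamma c * Gamma d.
Proof.
move=> c0 cd; have d0 := lt_trans c0 cd.
set e := (c + d) / 2; have e0 : 0 < e by rewrite divr_gt0// addr_gt0.
have Gd := Gamma_gt0 d0.
pose kap := Gamma e / Gamma d.
have kapE : kap = Gamma e / Gamma d := erefl.
have Ge := Gamma_gt0 e0.
have kap0 : 0 < kap by exact: divr_gt0 Ge Gd.
have kap0' := ltW kap0.
clearbody kap.
pose g (t : measurableTypeR R) : R := t `^ (c - 1) * expR (- t) +
   kap ^+ 2 * (t `^ (d - 1) * expR (- t)).
pose g2 (t : measurableTypeR R) : R := (2 * kap) * (t `^ (e - 1) * expR (- t)).
pose h (t : measurableTypeR R) := (t `^ ((c - 1) / 2) - kap * t `^ ((d - 1) / 2)) ^+ 2 * expR (- t).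
have sq (a t : R) : 0 < t -> t `^ a = (t `^ (a / 2)) ^+ 2.
  by move=> t0; rewrite expr2 -powRD ?(gt_eqF t0) ?implybT//; congr (_ `^ _); field.
have gE t : 0 < t -> g t = g2 t + h t.
  move=> t0; rewrite /g /g2 /h (sq (c - 1))// (sq (d - 1))//.
  have -> : e - 1 = (c - 1) / 2 + (d - 1) / 2 by rewrite /e; field.
  rewrite powRD ?(gt_eqF t0) ?implybT//; ring.
have mg2 : measurable_fun setT g2 by exact: measurable_funM.
have mh : measurable_fun setT h.
  apply: measurable_funM; last exact: measurable_expRN.
  apply: measurable_funX; apply: measurable_funB; first exact: measurable_powR.
  by apply: measurable_funM => //; exact: measurable_powR.
have h0 t : 0 <= h t by rewrite mulr_ge0 ?sqr_ge0 ?expR_ge0.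
have Eg : (\int[mu]_(t in `]0%R, +oo[) (g t)%:E = (Gamma c + kap ^+ 2 * Gamma d)%:E)%E.
  under eq_integral do rewrite EFinD.
  rewrite ge0_integralD//=.
  - rewrite mul_eGamma ?sqr_ge0// -/(eGamma c) !eGammaE//.
  - by move=> t _; rewrite lee_fin mulr_ge0 ?powR_ge0 ?expR_ge0.
  - by apply/measurable_EFinP; apply: measurable_funTS.
  - by move=> t _; rewrite lee_fin mulr_ge0 ?sqr_ge0// mulr_ge0 ?powR_ge0 ?expR_ge0.
  - by apply/measurable_EFinP; apply: measurable_funTS; exact: measurable_funM.
have Eh : (\int[mu]_(t in `]0%R, +oo[) (g t)%:E =
    (2 * kap * Gamma e)%:E + \int[mu]_(t in `]0%R, +oo[) (h t)%:E)%E.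
  rewrite EFinM -eGammaE// -mul_eGamma; last by rewrite mulr_ge0 ?ltW.
  rewrite -ge0_integralD//=.
  - apply: eq_integral => t; rewrite inE/= in_itv/= andbT => t0.
    by rewrite gE// EFinD.
  - by move=> t _; rewrite lee_fin /g2 !mulr_ge0 ?powR_ge0 ?expR_ge0.
  - by apply/measurable_EFinP; apply: measurable_funTS.
  - by move=> t _; rewrite lee_fin.
  - by apply/measurable_EFinP; apply: measurable_funTS.
pose t0 : R := kap `^ (2 / (c - d)).
have hpos : (0 < \int[mu]_(t in `]0%R, +oo[) (h t)%:E)%E.
  apply: (@lt_le_trans _ _ (\int[mu]_(t in `]t0, +oo[) (h t)%:E)%E); last first.
    apply: ge0_subset_integral => //.
    - by apply/measurable_EFinP; apply: measurable_funTS.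
    - by move=> t _; rewrite lee_fin.
    - move=> t /=; rewrite !in_itv/= !andbT => tt; apply: lt_trans tt.
      exact: powR_gt0.
  apply: integral_gt0 => //; first by apply: measurable_funTS.
    move=> t; rewrite /= in_itv/= andbT => tt.
    have t00 : 0 < t by apply: lt_trans tt; exact: powR_gt0.
    rewrite mulr_gt0 ?expR_gt0// lt0r sqr_ge0 andbT expf_neq0// subr_eq0.
    apply/negP => /eqP E.
    have cd2 : (c - d) / 2 != 0 by rewrite mulf_neq0 ?invr_eq0// subr_eq0 lt_eqF.
    have E2 : t `^ ((c - d) / 2) = kap.
      have -> : (c - d) / 2 = (c - 1) / 2 - (d - 1) / 2 by field.
      rewrite powRB ?(gt_eqF t00) ?implybT// E mulfK//.
      by rewrite gt_eqF// powR_gt0.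
    move: tt; rewrite /t0 -E2 -powRrM.
    have -> : (c - d) / 2 * (2 / (c - d)) = 1 by field; rewrite subr_eq0 lt_eqF.
    by rewrite powRr1 ?ltxx// ltW.
  by rewrite /= lebesgue_measure_itv/= ltry.
have key : 2 * kap * Gamma e < Gamma c + kap ^+ 2 * Gamma d.
  rewrite -lte_fin -Eg Eh.
  move: hpos; have : (\int[mu]_(t in `]0%R, +oo[) (h t)%:E)%E \is a fin_num.
    rewrite ge0_fin_numE; last by apply: integral_ge0 => t _; rewrite lee_fin.
    rewrite (@le_lt_trans _ _ (\int[mu]_(t in `]0%R, +oo[) (g t)%:E)%E)//.
      rewrite Eh leeDr// lee_fin; apply: mulr_ge0; last exact: ltW Ge.
      exact: mulr_ge0 (ler0n _ _) kap0'.
    by rewrite Eg ltry.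
  move=> /fineK <-; rewrite lte_fin => hint0.
  by rewrite -EFinD lte_fin ltrDl.
by apply: (sqr_lt_mul Gd); rewrite -kapE.
Qed.

End gamma_function.

Section inverse_gamma.
Context (R : realType).
Local Notation mu := (@lebesgue_measure R).
Implicit Types c d s v : R.

Lemma ig_pdfE c d v : 0 < v ->
  ig_pdf c d v = d `^ c / Gamma c * (v `^ (- c - 1) * expR (- (d / v))).
Proof.
move=> v0; rewrite /ig_pdf v0 invfM mulNr -!mulrA; congr (_ * (_ * (_ * _))).
by rewrite -opprD powRN.
Qed.

Lemma ig_pdf_ge0 c d v : 0 < c -> 0 <= ig_pdf c d v.
Proof.
move=> c0; rewrite /ig_pdf; case: ifP => // v0.
by rewrite mulr_ge0 ?expR_ge0// divr_ge0 ?powR_ge0// mulr_ge0 ?powR_ge0// ltW// Gamma_gt0.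
Qed.

Lemma measurable_ig_pdf c disp (T : measurableType disp) (f g : T -> R) :
  measurable_fun setT f -> measurable_fun setT g ->
  measurable_fun setT (fun x => ig_pdf c (f x) (g x)).
Proof.
move=> mf mg; apply: measurable_fun_ifT => //; first exact: measurable_fun_ltr.
have minv (h : T -> R) : measurable_fun setT h -> measurable_fun setT (fun x => (h x)^-1).
  by move=> mh; exact: (measurableT_comp (@measurable_invr R)).
have mpow e (h : T -> R) : measurable_fun setT h -> measurable_fun setT (fun x => h x `^ e).
  by move=> mh; exact: (measurableT_comp (@measurable_powR R e)).
apply: measurable_funM; last first.
  apply: measurableT_comp => //; apply: measurable_funM; last exact: minv.
  exact: measurableT_comp.
apply: measurable_funM; first exact: mpow.
by apply: minv; apply: measurable_funM => //; exact: mpow.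
Qed.

(** The factor [v^s] turns the shape [c] into [c - s]. *)
Lemma ig_moment c d s : 0 < c -> 0 < d -> s < c ->
  (\int[mu]_v (ig_pdf c d v * v `^ s)%:E = (d `^ s * Gamma (c - s) / Gamma c)%:E)%E.
Proof.
move=> c0 d0 sc; have cs : 0 < c - s by rewrite subr_gt0.
transitivity (\int[mu]_(v in `]0%R, +oo[) ((d `^ c / Gamma c)%:E *
    (v `^ (- (c - s) - 1) * expR (- (d / v)))%:E))%E.
  rewrite [RHS]integral_mkcond; apply: eq_integral => v _.
  rewrite patchE mem_setE in_itv/= andbT; case: ifPn => v0; last first.
    by rewrite /ig_pdf (negbTE v0) mul0r.
  have E : v `^ (- (c - s) - 1) = v `^ (- c - 1) * v `^ s.
    by rewrite -powRD ?(gt_eqF v0) ?implybT//; congr (_ `^ _); ring.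
  by rewrite ig_pdfE// -EFinM E; congr EFin; ring.
rewrite ge0_integralZl//; last 3 first.
- apply/measurable_EFinP; apply: measurable_funTS.
  apply: measurable_funM; first exact: measurable_powR.
  apply: measurableT_comp => //; apply: measurableT_comp => //.
  by apply: measurable_funM => //; exact: measurable_invr.
- by move=> v _; rewrite lee_fin mulr_ge0 ?powR_ge0 ?expR_ge0.
- by rewrite lee_fin divr_ge0 ?powR_ge0// ltW// Gamma_gt0.
rewrite integral_inv_gamma_kernel// -EFinM; congr EFin.
rewrite opprB powRB ?(gt_eqF d0) ?implybT//; field.
by rewrite !gt_eqF ?Gamma_gt0 ?powR_gt0.
Qed.

Lemma integral_ig_pdf c d : 0 < c -> 0 < d -> (\int[mu]_v (ig_pdf c d v)%:E = 1)%E.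
Proof.
move=> c0 d0; have := ig_moment c0 d0 c0.
under eq_integral do rewrite powRr0 mulr1.
by move=> ->; rewrite powRr0 mul1r subr0 divff// gt_eqF// Gamma_gt0.
Qed.

End inverse_gamma.

(** * Euclidean norms and orthogonal projections *)

Section euclidean.
Context (R : realType).

Definition sqnorm n (v : 'cV[R]_n) : R := \sum_i v i 0 ^+ 2.

Lemma sqnorm_ge0 n (v : 'cV[R]_n) : 0 <= sqnorm v.
Proof. by apply: sumr_ge0 => i _; exact: sqr_ge0. Qed.

Lemma enorm_sqr n (v : 'cV[R]_n) : enorm v ^+ 2 = sqnorm v.
Proof. by rewrite /enorm sqr_sqrtr// -/(sqnorm v) sqnorm_ge0. Qed.

Lemma sqnormE n (v : 'cV[R]_n) : sqnorm v = (v^T *m v) 0 0.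
Proof. by rewrite mxE; apply: eq_bigr => i _; rewrite mxE expr2. Qed.

Lemma sqnorm0 n : sqnorm (0 : 'cV[R]_n) = 0.
Proof. by rewrite /sqnorm big1// => i _; rewrite mxE expr0n. Qed.

Lemma dotC n (u v : 'cV[R]_n) : (u^T *m v) 0 0 = (v^T *m u) 0 0.
Proof. by rewrite !mxE; apply: eq_bigr => i _; rewrite !mxE mulrC. Qed.

Lemma sqnormZ n a (v : 'cV[R]_n) : sqnorm (a *: v) = a ^+ 2 * sqnorm v.
Proof. by rewrite /sqnorm mulr_sumr; apply: eq_bigr => i _; rewrite mxE exprMn. Qed.

Lemma sqnorm_eq0 n (v : 'cV[R]_n) : sqnorm v = 0 -> v = 0.
Proof.
move=> /eqP; rewrite psumr_eq0; last by move=> i _; exact: sqr_ge0.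
move=> /allP h; apply/colP => i; rewrite mxE; apply/eqP; rewrite -sqrf_eq0.
by apply: h; rewrite mem_index_enum.
Qed.

Lemma sqnormN n (v : 'cV[R]_n) : sqnorm (- v) = sqnorm v.
Proof. by apply: eq_bigr => i _; rewrite mxE sqrrN. Qed.

Lemma sqr_coord_le n (v : 'cV[R]_n) i : v i 0 ^+ 2 <= sqnorm v.
Proof. by rewrite /sqnorm (bigD1 i)//= lerDl sumr_ge0// => j _; exact: sqr_ge0. Qed.

Lemma cauchy_schwarz n (u v : 'cV[R]_n) : ((u^T *m v) 0 0) ^+ 2 <= sqnorm u * sqnorm v.
Proof.
rewrite mxE; under eq_bigr do rewrite mxE.
set s := \sum_i _.
have key : 0 <= \sum_i (sqnorm v * u i 0 - s * v i 0) ^+ 2.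
  by apply: sumr_ge0 => i _; exact: sqr_ge0.
have E : \sum_i (sqnorm v * u i 0 - s * v i 0) ^+ 2 =
    sqnorm v * (sqnorm u * sqnorm v - s ^+ 2).
  transitivity (\sum_i (sqnorm v ^+ 2 * u i 0 ^+ 2 - 2 * sqnorm v * s * (u i 0 * v i 0)
     + s ^+ 2 * v i 0 ^+ 2)); first by apply: eq_bigr => i _; ring.
  rewrite !big_split/= sumrN -!mulr_sumr -/s -/(sqnorm u) -/(sqnorm v); ring.
have [v0|v0] := eqVneq (sqnorm v) 0.
  rewrite v0 mulr0 le_eqVlt; apply/orP; left; rewrite sqrf_eq0; apply/eqP.
  by rewrite /s (sqnorm_eq0 v0) big1// => i _; rewrite mxE mulr0.
have vp : 0 < sqnorm v by rewrite lt0r v0 sqnorm_ge0.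
by move: key; rewrite E pmulr_rge0// subr_ge0.
Qed.

Definition sqnormM m n (A : 'M[R]_(m, n)) : R := \sum_i \sum_j A i j ^+ 2.

Lemma sqnormM_ge0 m n (A : 'M[R]_(m, n)) : 0 <= sqnormM A.
Proof. by apply: sumr_ge0 => i _; apply: sumr_ge0 => j _; exact: sqr_ge0. Qed.

Lemma sqnorm_mul m n (A : 'M[R]_(m, n)) x : sqnorm (A *m x) <= sqnormM A * sqnorm x.
Proof.
rewrite /sqnorm /sqnormM mulr_suml; apply: ler_sum => i _.
have := cauchy_schwarz (row i A)^T x; rewrite trmxK -row_mul mxE.
by move=> /le_trans; apply; rewrite ler_wpM2r ?sqnorm_ge0// ler_sum// => j _; rewrite !mxE.
Qed.

Lemma sqnorm_block m n (u : 'cV[R]_m) (v : 'cV[R]_n) : sqnorm (col_mx u v) = sqnorm u + sqnorm v.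
Proof.
rewrite /sqnorm big_split_ord; congr (_ + _); apply: eq_bigr => i _.
  by rewrite col_mxEu.
by rewrite col_mxEd.
Qed.

Lemma sqnormD n (u v : 'cV[R]_n) : sqnorm (u + v) = sqnorm u + sqnorm v + 2 * (u^T *m v) 0 0.
Proof.
rewrite mxE mulr_sumr /sqnorm -!big_split/=; apply: eq_bigr => i _.
by rewrite !mxE; ring.
Qed.

Lemma sqnormD_le n (u v : 'cV[R]_n) : sqnorm (u + v) <= 2 * sqnorm u + 2 * sqnorm v.
Proof.
rewrite /sqnorm !mulr_sumr -big_split/=; apply: ler_sum => i _; rewrite mxE.
by have := sqr_ge0 (u i 0 - v i 0); lra.
Qed.

(** In a full rank factorization [P = C B], idempotence means [B C = 1]. *)
Lemma mxtrace_idempotent n (P : 'M[R]_n) : P *m P = P -> \tr P = (\rank P)%:R.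
Proof.
move=> PP; have E := mulmx_base P.
have I : row_base P *m col_base P = 1%:M.
  have : col_base P *m (row_base P *m col_base P) *m row_base P =
      col_base P *m 1%:M *m row_base P.
    by rewrite mulmx1 E mulmxA -mulmxA E PP.
  by move=> /(row_free_inj (row_base_free P))/(row_full_inj (col_base_full P)).
by rewrite -[in LHS]E mxtrace_mulC I mxtrace1.
Qed.

Section projection.
Context m n (A : 'M[R]_(m, n)).
Let P := orthoproj A.

Lemma orthoproj_tr : P^T = P. Proof. by have [] := orthoprojP A. Qed.
Lemma orthoproj_idem : P *m P = P. Proof. by have [] := orthoprojP A. Qed.

Lemma mxtrace_orthoproj : \tr P = (\rank A)%:R.
Proof.
rewrite mxtrace_idempotent ?orthoproj_idem//.
have [_ _ E] := orthoprojP A.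
by rewrite -[in LHS]mxrank_tr E mxrank_tr.
Qed.

Lemma orthoproj_id : P *m A = A.
Proof.
have [_ _ E] := orthoprojP A.
have /submxP[B AE] : (A^T <= P^T)%MS by rewrite E.
apply: trmx_inj; rewrite trmx_mul AE -mulmxA.
by rewrite -trmx_mul orthoproj_idem.
Qed.

Lemma orthoproj_factor : exists B, P = A *m B.
Proof.
have [_ _ E] := orthoprojP A.
have /submxP[B PE] : (P^T <= A^T)%MS by rewrite E.
by exists B^T; rewrite -[LHS]trmxK PE trmx_mul trmxK.
Qed.

Let Q := 1%:M - P.

Lemma coproj_tr : Q^T = Q.
Proof. by rewrite /Q linearB/= trmx1 orthoproj_tr. Qed.

Lemma coproj_idem : Q *m Q = Q.
Proof.
by rewrite /Q mulmxBl mulmxBr mulmx1 mul1mx mulmxBr mulmx1 orthoproj_idem subrr subr0.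
Qed.

Lemma coproj_mul0 : Q *m A = 0.
Proof. by rewrite /Q mulmxBl mul1mx orthoproj_id subrr. Qed.

End projection.

Lemma sqnorm_proj_le n (P : 'M[R]_n) x : P^T = P -> P *m P = P -> sqnorm (P *m x) <= sqnorm x.
Proof.
move=> PT PP.
have E : ((P *m x)^T *m (x - P *m x)) 0 0 = 0.
  by rewrite mulmxBr trmx_mul PT -!mulmxA (mulmxA P P) PP subrr mxE.
have -> : sqnorm x = sqnorm (P *m x) + sqnorm (x - P *m x).
  by rewrite -{1}(subrK (P *m x) x) addrC sqnormD E mulr0 addr0.
by rewrite lerDl sqnorm_ge0.
Qed.

(** As [P] is symmetric and idempotent, [|P e_j|^2 = e_j^T P e_j]. *)
Lemma sqnorm_col_proj n (P : 'M[R]_n) j : P^T = P -> P *m P = P -> sqnorm (col j P) = P j j.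
Proof.
move=> PT PP; rewrite sqnormE tr_col PT -[in RHS]PP.
by rewrite mxE [RHS]mxE; apply: eq_bigr => k _; rewrite !mxE.
Qed.

Lemma sum_sqnorm_col_proj n (P : 'M[R]_n) : P^T = P -> P *m P = P ->
  \sum_j sqnorm (col j P) = \tr P.
Proof. by move=> PT PP; apply: eq_bigr => j _; exact: sqnorm_col_proj. Qed.

Lemma mxrank_gram m n (A : 'M[R]_(m, n)) : \rank (A^T *m A) = \rank A.
Proof.
rewrite -(mxrank_tr A); apply/eqP; rewrite eqn_leq mxrankM_maxl/=.
suff : (kermx (A^T *m A) <= kermx A^T)%MS.
  move=> /mxrankS; rewrite !mxrank_ker; have := rank_leq_row A^T.
  have := rank_leq_row (A^T *m A); lia.
apply/sub_kermxP; apply/row_matrixP => i; rewrite row_mul row0.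
set u := row i _.
have uK : u *m (A^T *m A) = 0 by apply/sub_kermxP; exact: row_sub.
apply: trmx_inj; rewrite trmx0; apply: sqnorm_eq0.
by rewrite sqnormE trmxK trmx_mul trmxK mulmxA -(mulmxA u) uK mul0mx mxE.
Qed.

(** Modulo the columns of [X], those of [Z] are the columns of [(I - P_X) Z], whose
    rank is that of its Gram matrix. *)
Lemma rank_row_mx_coproj N p q (X : 'M[R]_(N, p)) (Z : 'M[R]_(N, q)) :
  (\rank (row_mx X Z) <=
   \rank X + \rank (Z^T *m (1%:M - orthoproj X) *m Z))%N.
Proof.
set Q := 1%:M - orthoproj X.
have -> : Z^T *m Q *m Z = (Q *m Z)^T *m (Q *m Z).
  by rewrite trmx_mul coproj_tr -!mulmxA (mulmxA Q Q) coproj_idem.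
rewrite mxrank_gram -mxrank_tr -[\rank X]mxrank_tr -[\rank (Q *m Z)]mxrank_tr.
apply: leq_trans (mxrank_adds_leqif _ _).1.
apply: mxrankS; rewrite tr_row_mx col_mx_sub addsmxSl/=.
have [B PE] := orthoproj_factor X.
have ZE : Z = X *m (B *m Z) + Q *m Z.
  by rewrite /Q mulmxBl mul1mx mulmxA -PE addrC subrK.
rewrite [X in (X^T <= _)%MS]ZE linearD/= addmx_sub_adds//.
by rewrite trmx_mul submxMl.
Qed.

(** Weighted orthogonality to a subspace [K] bounds the [K]-component of a
    vector by its remainder, uniformly in the weights. If [u = k + e] with
    [k \in K] and all the nonzero coordinates of [k] exceed those of [e], then [u] and [k]
    have the same signs and the weighted product of [u] with [k] cannot vanish.
    So some coordinate of [k] that is not identically zero on [K] is small;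
    subtracting a fixed multiple of it from [k] lands in a smaller subspace. *)
Lemma weighted_orthogonal_bound n (K : 'cV[R]_n -> Prop) :
  (forall a k h, K k -> K h -> K (k + a *: h)) ->
  exists2 C, 0 <= C & forall (w : 'I_n -> R) (k e : 'cV[R]_n) B, (forall j, 0 < w j) -> K k ->
    (forall h, K h -> \sum_j w j * (k j 0 + e j 0) * h j 0 = 0) ->
    (forall j, `|e j 0| <= B) -> forall j, `|k j 0| <= C * B.
Proof.
pose supp (K : 'cV[R]_n -> Prop) := [set j | `[< exists2 h, K h & h j 0 != 0 >]]%SET.
move: {2}(#|supp K|) (leqnn #|supp K|) => N; elim: N K => [|N ih] K.
  rewrite leqn0 cards_eq0 => /eqP K0 _; exists 0 => // w k e B _ Kk _ _ j.
  rewrite mul0r normr_le0; apply: contraT => kj.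
  have : j \in supp K by rewrite inE; apply/asboolP; exists k.
  by rewrite K0 inE.
move=> leN lin.
have hex : forall j : 'I_n, exists c : R, 0 <= c /\
    forall (w : 'I_n -> R) (k e : 'cV[R]_n) B, (forall j, 0 < w j) -> K k ->
    (forall h, K h -> \sum_j w j * (k j 0 + e j 0) * h j 0 = 0) ->
    (forall j, `|e j 0| <= B) -> j \in supp K -> `|k j 0| <= B ->
    forall i, `|k i 0| <= c * B.
  move=> j.
  have [|nj] := boolP (j \in supp K); last by exists 0; split.
  rewrite inE => /asboolP[g0 Kg0 g0j].
  pose g := (g0 j 0)^-1 *: g0.
  have K0 : K 0 by have := lin (-1) g0 g0 Kg0 Kg0; rewrite scaleN1r subrr.
  have Kg : K g by rewrite -[g]add0r; exact: lin.
  have gj : g j 0 = 1 by rewrite mxE mulVf.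
  clearbody g.
  pose Kj h := K h /\ h j 0 = 0.
  have linj a k h : Kj k -> Kj h -> Kj (k + a *: h).
    move=> [Kk kj] [Kh hj]; split; first exact: lin.
    by rewrite !mxE kj hj mulr0 addr0.
  have suppj : (#|supp Kj| <= N)%N.
    rewrite -ltnS; apply: leq_trans leN; apply: proper_card; apply/properP; split.
      apply/fintype.subsetP => i; rewrite inE => /asboolP[h [Kh _] hi].
      by rewrite inE; apply/asboolP; exists h.
    exists j; rewrite inE; first by apply/asboolP; exists g0.
    by apply/negP => /asboolP[h [_ ->]]; rewrite eqxx.
  have [C C0 hC] := ih Kj suppj linj.
  pose G := \sum_i `|g i 0|.
  have G0 : 0 <= G by apply: sumr_ge0.
  have gG i : `|g i 0| <= G by rewrite /G (bigD1 i)//= lerDl sumr_ge0.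
  exists (C * (1 + G) + G); split; first by rewrite addr_ge0 ?mulr_ge0 ?addr_ge0.
  move=> w k e B w0 Kk orth eB _ kjB i.
  have B0 : 0 <= B by exact: le_trans kjB.
  have kG l : `|k j 0 * g l 0| <= G * B by rewrite normrM mulrC ler_pM.
  have := hC w (k + (- k j 0) *: g) (e + k j 0 *: g) ((1 + G) * B) w0.
  move=> /(_ _ _ _ i)h.
  have {h} : `|(k + (- k j 0) *: g) i 0| <= C * ((1 + G) * B).
    apply: h.
    - by split; [exact: lin|rewrite !mxE gj mulr1 subrr].
    - move=> h [Kh _]; rewrite -[RHS](orth h Kh); apply: eq_bigr => l _.
      by congr (_ * _ * _); rewrite !mxE; ring.
    - move=> l; rewrite !mxE mulrDl mul1r (le_trans (ler_normD _ _))// lerD//.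
  rewrite !mxE => h.
  have := ler_normD (k i 0 + - k j 0 * g i 0) (k j 0 * g i 0).
  have -> : k i 0 + - k j 0 * g i 0 + k j 0 * g i 0 = k i 0 by ring.
  by move=> /le_trans; apply; have := kG i; move: h; lra.
have [Cj hC] := choice hex.
exists (\sum_j Cj j); first by apply: sumr_ge0 => j _; have [] := hC j.
move=> w k e B w0 Kk orth eB i.
have B0 : 0 <= B by exact: le_trans (eB i).
have Cle j : Cj j * B <= (\sum_j Cj j) * B.
  rewrite ler_wpM2r// (bigD1 j)//= lerDl sumr_ge0// => l _; by have [] := hC l.
have [[j js kjB]|nj] := pselect (exists2 j, j \in supp K & `|k j 0| <= B).
  by apply: le_trans (Cle j); have [_ h] := hC j; exact: (h w k e B).
have pos j : 0 <= w j * (k j 0 + e j 0) * k j 0 ?= iff (k j 0 == 0).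
  apply/leifP; have [->|kj] := eqVneq (k j 0) 0; first by rewrite mulr0.
  have js : j \in supp K by rewrite inE; apply/asboolP; exists k.
  have kB : B < `|k j 0| by rewrite ltNge; apply/negP => kB; apply: nj; exists j.
  rewrite -mulrA mulr_gt0//.
  have : `|e j 0 * k j 0| < `|k j 0| ^+ 2.
    rewrite normrM expr2 ltr_pM2r ?normr_gt0//; exact: le_lt_trans (eB j) kB.
  rewrite real_normK ?num_real//; have := ler_norm (- (e j 0 * k j 0)).
  by rewrite normrN mulrDl -expr2; lra.
have : k i 0 == 0.
  have /eqP := orth k Kk; rewrite psumr_eq0; last by move=> j _; exact: (pos j).1.
  by move=> /allP/(_ i); rewrite mem_index_enum => /(_ isT); rewrite eq_sym (pos i).2.
by move=> /eqP ->; rewrite normr0 mulr_ge0// sumr_ge0// => l _; have [] := hC l.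
Qed.

End euclidean.

(** * Gaussian integrals on tuples *)

Section exponential_bounds.
Context (R : realType).
Lemma le_sinh (x : R) : 0 <= x -> 2 * x <= expR x - expR (- x).
Proof.
move=> x0.
pose f (x : R) := expR x - expR (- x) - 2 * x.
have dF (t : R) : is_derive t 1 f (expR t + expR (- t) - 2).
  by apply: is_derive_eq; rewrite /GRing.scale/=; ring.
have : f 0 <= f x.
  apply: (@ger0_derive1_ndecry _ f 0) => //.
  - move=> y _; rewrite derive1E; have [_ ->] := dF y.
    have := sqr_ge0 (expR (y / 2) - expR (- (y / 2))).
    rewrite sqrrB -!expRM_natl -expRD subrr expR0 mulrN.
    have -> : 2 * (y / 2) = y by field.
    by lra.
  - by apply: derivable_within_continuous => y _; have [] := dF y.
by rewrite /f oppr0 expR0; lra.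
Qed.

Lemma le_cosh (x : R) : x ^+ 2 <= expR x + expR (- x) - 2.
Proof.
wlog x0 : x / 0 <= x.
  move=> h; have [/h//|/ltW x0] := leP 0 x.
  by have := h (- x); rewrite oppr_ge0 sqrrN opprK => /(_ x0); lra.
have -> : expR x + expR (- x) - 2 = (expR (x / 2) - expR (- (x / 2))) ^+ 2.
  rewrite sqrrB -!expRM_natl -expRD subrr expR0 mulrN.
  have -> : 2 * (x / 2) = x by field.
  lra.
rewrite ler_sqr ?nnegrE//.
  by have := @le_sinh (x / 2); rewrite mulrCA divff// mulr1; apply; lra.
by have := @le_sinh (x / 2); lra.
Qed.

Lemma expR_le_quad (x : R) : 0 <= x -> x <= 2^-1 -> expR x <= 1 + x + 2 * x ^+ 2.
Proof.
move=> x0 x2; have x1 : 0 < 1 - x by lra.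
have : 1 - x <= (expR x)^-1 by rewrite -expRN; exact: expR_ge1Dx.
rewrite -[in X in X -> _](invrK (1 - x)) lef_pV2 ?posrE ?invr_gt0 ?expR_gt0// => /le_trans; apply.
rewrite -[leLHS]mul1r ler_pdivrMr//.
have : 0 <= x ^+ 2 * (1 - 2 * x) by rewrite mulr_ge0 ?sqr_ge0//; lra.
rewrite expr2; lra.
Qed.
End exponential_bounds.

Section gaussian_line.
Context (R : realType).
Local Notation mu := (@lebesgue_measure R).

Lemma integral_gaussian (al be : R) : 0 < al ->
  (\int[mu]_x (expR (- (al * x ^+ 2 / 2) + be * x))%:E =
   (Num.sqrt (2 * pi / al) * expR (be ^+ 2 / (2 * al)))%:E)%E.
Proof.
move=> al0; pose s := Num.sqrt al^-1; pose m := be / al.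
have s2 : s ^+ 2 = al^-1 by rewrite sqr_sqrtr// invr_ge0 ltW.
have s0 : s != 0 by rewrite gt_eqF// sqrtr_gt0 invr_gt0.
have pk : 0 < normal_peak s by exact: normal_peak_gt0.
have := integral_normal_pdf m s; rewrite normal_pdfE// => h.
transitivity (\int[mu]_x ((expR (be ^+ 2 / (2 * al)) / normal_peak s)%:E *
    (normal_peak s * normal_fun m s x)%:E))%E.
  apply: eq_integral => x _; rewrite -EFinM; congr EFin.
  rewrite [RHS]mulrA divfK ?gt_eqF// /normal_fun -expRD s2; congr expR.
  by rewrite /m; field; rewrite gt_eqF.
rewrite ge0_integralZl//.
- rewrite h mule1 mulrC; congr (_ * _)%:E.
  by rewrite /normal_peak invrK s2; congr Num.sqrt; field; rewrite gt_eqF.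
- apply/measurable_EFinP; apply: measurable_funM => //; exact: measurable_normal_fun.
- by move=> x _; rewrite lee_fin mulr_ge0 ?normal_fun_ge0 ?ltW.
- by rewrite lee_fin divr_ge0 ?expR_ge0 ?ltW.
Qed.

(** By completing the square, the tilt multiplies the integral by at most
    [sqrt(al / (al + tau))], which increases with [al]. *)
Lemma le_integral_gaussian_tilt (al be tau kap : R) : 0 < al -> al <= kap -> 0 <= tau ->
  (\int[mu]_x (expR (- (tau * x ^+ 2 / 2)) * expR (- (al * x ^+ 2 / 2) + be * x))%:E <=
   (Num.sqrt (kap / (kap + tau)))%:E *
   \int[mu]_x (expR (- (al * x ^+ 2 / 2) + be * x))%:E)%E.
Proof.
move=> al0 ak tau0; have kap0 := lt_le_trans al0 ak.
have at0 : 0 < al + tau by rewrite ltr_wpDr.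
have kt0 : 0 < kap + tau by rewrite ltr_wpDr.
have -> : (\int[mu]_x (expR (- (tau * x ^+ 2 / 2)) * expR (- (al * x ^+ 2 / 2) + be * x))%:E =
   \int[mu]_x (expR (- ((al + tau) * x ^+ 2 / 2) + be * x))%:E)%E.
  by apply: eq_integral => x _; rewrite -expRD; congr (expR _)%:E; field.
have kk : 0 <= kap / (kap + tau) by rewrite divr_ge0// ltW.
rewrite !integral_gaussian// -EFinM lee_fin mulrA -sqrtrM//.
rewrite ler_pM ?sqrtr_ge0 ?expR_ge0//.
- rewrite ler_sqrt; last by rewrite mulr_ge0// divr_ge0 ?mulr_ge0 ?pi_ge0 ?ltW.
  have -> : 2 * pi / (al + tau) = (2 * pi / al) * (al / (al + tau)).
    by field; rewrite !gt_eqF.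
  have pa : 0 <= 2 * pi / al by rewrite divr_ge0 ?mulr_ge0 ?pi_ge0 ?ltW.
  rewrite mulrC ler_wpM2r//.
  rewrite ler_pdivrMr// mulrAC ler_pdivlMr//.
  have : 0 <= (kap - al) * tau by rewrite mulr_ge0 ?subr_ge0.
  lra.
- rewrite ler_expR ler_wpM2l ?sqr_ge0// lef_pV2 ?posrE ?mulr_gt0//.
  by rewrite ler_pM2l// lerDl.
Qed.

End gaussian_line.

Section gaussian_vector.
Context (R : realType).
Local Notation mu := (@lebesgue_measure R).
Local Notation lam := (@lebesgue_vec R).

Lemma measurable_mulmx_col m n (A : 'M[R]_(m, n)) i :
  measurable_fun setT (fun x : Rvec R n => (A *m col_of x) i 0).
Proof.
have -> : (fun x : Rvec R n => (A *m col_of x) i 0) =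
    (fun x => \sum_j A i j * (tnth x j : R)).
  by apply/funext => x; rewrite mxE; apply: eq_bigr => j _; rewrite mxE.
apply: measurable_sum => j; apply: measurable_funM => //; exact: measurable_tnth.
Qed.

Lemma measurable_sqnorm_affine m n (A : 'M[R]_(m, n)) (c : 'cV[R]_m) :
  measurable_fun setT (fun x : Rvec R n => sqnorm (A *m col_of x - c)).
Proof.
apply: measurable_sum => i; apply: measurable_funX.
have -> : (fun x : Rvec R n => (A *m col_of x - c) i 0) =
    (fun x => (A *m col_of x) i 0 - c i 0).
  by apply/funext => x; rewrite !mxE.
by apply: measurable_funB => //; exact: measurable_mulmx_col.
Qed.

Lemma col_of_shiftv n (x h : Rvec R n) : col_of (shiftv x h) = col_of x + col_of h.
Proof. by apply/colP => i; rewrite !mxE tnth_mktuple. Qed.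

Definition tuple_of_col n (v : 'cV[R]_n) : Rvec R n := [tuple v i 0 | i < n].

Lemma tuple_of_colK n (v : 'cV[R]_n) : col_of (tuple_of_col v) = v.
Proof. by apply/colP => i; rewrite !mxE tnth_mktuple. Qed.

Lemma lebesgue_vec_posvec_neq0 k : lam k (@posvec R k) != 0%E.
Proof.
have mb (B : 'I_k -> set (measurableTypeR R)) : (forall i, measurable (B i)) ->
    measurable [set x : Rvec R k | forall i, B i (tnth x i)].
  move=> mB; rewrite [X in measurable X](_ : _ =
    \bigcap_(i in setT) (@tnth k _ ^~ i @^-1` B i)).
    apply: fin_bigcap_measurable => // i _.
    by rewrite -[X in measurable X]setTI; exact: measurable_tnth.
  by apply/seteqP; split=> [x + i _|x + i]; [exact|exact].
rewrite gt_eqF// (@lt_le_trans _ _ (lam k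
   [set x : Rvec R k | forall i, (fun=> `]0%R, 1%R]%classic) i (tnth x i)]))//.
  rewrite (@lebesgue_vec_box R k (fun=> `]0%R, 1%R]%classic))// big1 ?lte01// => i _.
  by rewrite /= lebesgue_measure_itv/= lte_fin ltr01 sube0.
apply: le_measure; rewrite ?inE.
- exact: (mb (fun=> `]0%R, 1%R]%classic)).
- rewrite [X in measurable X](_ : _ =
    [set x : Rvec R k | forall i, (fun=> `]0%R, +oo[%classic) i (tnth x i)]).
    exact: (mb (fun=> `]0%R, +oo[%classic)).
  apply/seteqP; split => x /= h i; have := h i; by rewrite /= in_itv/= andbT.
- by move=> x /= h i; have := h i; rewrite /= in_itv/= => /andP[].
Qed.

Lemma measurable_posvec k : measurable (@posvec R k).
Proof.
rewrite [X in measurable X](_ : _ =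
    \bigcap_(i in setT) (@tnth k _ ^~ i @^-1` `]0%R, +oo[%classic)).
  apply: fin_bigcap_measurable => // i _.
  by rewrite -[X in measurable X]setTI; exact: measurable_tnth.
apply/seteqP; split=> [x h i _|x h i]; have := h i; rewrite /= in_itv/= andbT//.
exact.
Qed.

Lemma lebesgue_vec_setT_neq0 k : lam k setT != 0%E.
Proof.
apply: contra_neq (lebesgue_vec_posvec_neq0 k) => h.
apply/eqP; rewrite -measure_le0 -h le_measure ?inE//.
exact: measurable_posvec.
Qed.

Context m n (A : 'M[R]_(m, n)) (c : 'cV[R]_m).
Hypothesis A_inj : \rank A = n.

(** Up to a constant factor, the density of a Gaussian vector with precision
    matrix [A^T A]; the factor [A] carries the same data as a positive definite
    quadratic form. *)
Definition gauss (x : Rvec R n) : R := expR (- (sqnorm (A *m col_of x - c) / 2)).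

Lemma gauss_gt0 x : 0 < gauss x. Proof. exact: expR_gt0. Qed.
Lemma gauss_ge0 x : 0 <= gauss x. Proof. exact: expR_ge0. Qed.

Lemma measurable_gauss : measurable_fun setT gauss.
Proof.
apply: measurableT_comp => //; apply: measurableT_comp => //.
by apply: measurable_funM => //; exact: measurable_sqnorm_affine.
Qed.

Let gram_unit : A^T *m A \in unitmx.
Proof. by rewrite -row_full_unit /row_full mxrank_gram A_inj. Qed.

(** [A] has a left inverse. *)
Lemma gauss_coercive : exists2 eps, 0 < eps & forall x, eps * sqnorm x <= sqnorm (A *m x).
Proof.
pose L := invmx (A^T *m A) *m A^T.
have LA : L *m A = 1%:M by rewrite -mulmxA mulVmx.
have M0 : 0 < sqnormM L + 1 by rewrite ltr_wpDl ?sqnormM_ge0.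
exists (sqnormM L + 1)^-1; first by rewrite invr_gt0.
move=> x; rewrite mulrC ler_pdivrMr// mulrC.
have -> : sqnorm x = sqnorm (L *m (A *m x)) by rewrite mulmxA LA mul1mx.
by apply: (le_trans (sqnorm_mul _ _)); rewrite ler_wpM2r ?sqnorm_ge0// lerDl.
Qed.

(** By coercivity a product of one-dimensional Gaussian functions dominates. *)
Lemma integral_gauss_fin : (\int[lam n]_x (gauss x)%:E < +oo)%E.
Proof.
have [eps eps0 coer] := gauss_coercive.
pose g (i : 'I_n) (x : R) : R := expR (- (eps / 2 * x ^+ 2 / 2) + 0 * x).
have mg i : measurable_fun setT (g i).
  apply: measurableT_comp => //; apply: measurable_funD; last exact: measurable_funM.
  by apply: measurableT_comp => //; do 2 (apply: measurable_funM => //).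
have g0 i x : 0 <= g i x by exact: expR_ge0.
apply: (@le_lt_trans _ _ (\int[lam n]_x ((expR (sqnorm c / 2))%:E *
    (\prod_i g i (tnth x i))%:E))%E).
  have mpg : measurable_fun setT (fun x : Rvec R n => \prod_i g i (tnth x i)).
    apply: measurable_prod => i _.
    exact: (measurableT_comp (mg i) (measurable_tnth i)).
  apply: ge0_le_integral => //.
  - by move=> x _; rewrite lee_fin gauss_ge0.
  - by apply/measurable_EFinP; exact: measurable_gauss.
  - by apply: emeasurable_funM => //; exact/measurable_EFinP.
  move=> x _; rewrite -EFinM lee_fin /g /gauss -expR_sum -expRD ler_expR.
  have -> : \sum_i (- (eps / 2 * (tnth x i : R) ^+ 2 / 2) + 0 * (tnth x i : R)) =
      - (eps / 2 * sqnorm (col_of x) / 2).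
    rewrite /sqnorm mulr_sumr mulr_suml -sumrN; apply: eq_bigr => i _.
    by rewrite mul0r addr0 mxE.
  have := coer (col_of x); have := sqnormD_le (A *m col_of x - c) c.
  by rewrite subrK; lra.
rewrite ge0_integralZl//; last 2 first.
- apply/measurable_EFinP; apply: measurable_prod => i _.
  exact: (measurableT_comp (mg i) (measurable_tnth i)).
- by move=> x _; rewrite lee_fin prodr_ge0.
rewrite integral_lebesgue_vec_prod//.
rewrite (eq_bigr (fun=> (Num.sqrt (2 * pi / (eps / 2)) * expR (0 ^+ 2 / (2 * (eps / 2))))%:E)).
  by rewrite prodEFin -EFinM ltry.
by move=> i _; rewrite integral_gaussian// divr_gt0.
Qed.

Lemma integral_gauss_gt0 : (0 < \int[lam n]_x (gauss x)%:E)%E.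
Proof.
apply: integral_gt0 => //; first exact: measurable_gauss.
- by move=> x _; exact: gauss_gt0.
- exact: lebesgue_vec_setT_neq0.
Qed.

(** The mean of the Gaussian vector, which is also the least squares solution of
    [A x = c]. *)
Definition gauss_mean := invmx (A^T *m A) *m (A^T *m c).

Lemma gauss_mean_normal : A^T *m (A *m gauss_mean - c) = 0.
Proof. by rewrite mulmxBr /gauss_mean !mulmxA mulmxV// mul1mx subrr. Qed.

Lemma sqnorm_gauss_mean x : sqnorm (A *m x - c) =
  sqnorm (A *m (x - gauss_mean)) + sqnorm (A *m gauss_mean - c).
Proof.
have -> : A *m x - c = A *m (x - gauss_mean) + (A *m gauss_mean - c).
  by rewrite mulmxBr addrA subrK.
by rewrite sqnormD trmx_mul -mulmxA gauss_mean_normal mulmx0 mxE mulr0 addr0.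
Qed.

Section linear_form.
Variable l : 'cV[R]_n.
Let S (x : Rvec R n) : R := (l^T *m (col_of x - gauss_mean)) 0 0.
Let v := invmx (A^T *m A) *m l.

Let mS : measurable_fun setT S.
Proof.
have -> : S = (fun x => (l^T *m col_of x) 0 0 - (l^T *m gauss_mean) 0 0).
  by apply/funext => x; rewrite /S mulmxBr !mxE.
by apply: measurable_funB => //; exact: measurable_mulmx_col.
Qed.

(** The moment generating function of a linear form, by completing the square
    and translation invariance. *)
Let mgf t : (\int[lam n]_x (expR (t * S x) * gauss x)%:E =
  (expR (t ^+ 2 * (l^T *m v) 0 0 / 2))%:E * \int[lam n]_x (gauss x)%:E)%E.
Proof.
pose h := tuple_of_col (- (t *: v)).
have gE x : expR (t * S x) * gauss x =
    expR (t ^+ 2 * (l^T *m v) 0 0 / 2) * gauss (shiftv x h).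
  rewrite /gauss -!expRD; congr expR.
  rewrite col_of_shiftv tuple_of_colK.
  have -> : A *m (col_of x - t *: v) - c = (A *m col_of x - c) + (- t) *: (A *m v).
    by rewrite mulmxBr scaleNr -scalemxAr addrAC.
  have Av : A^T *m (A *m v) = l by rewrite /v !mulmxA mulmxV// mul1mx.
  have q1 : sqnorm ((- t) *: (A *m v)) = t ^+ 2 * (l^T *m v) 0 0.
    by rewrite sqnormZ sqrrN sqnormE trmx_mul -mulmxA Av dotC.
  have q2 : ((A *m col_of x - c)^T *m ((- t) *: (A *m v))) 0 0 = - t * S x.
    rewrite -scalemxAr mxE dotC trmx_mul -mulmxA; congr (_ * _).
    have -> : A^T *m (A *m col_of x - c) = A^T *m A *m (col_of x - gauss_mean).
      have /eqP := gauss_mean_normal; rewrite mulmxBr subr_eq0 => /eqP E.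
      by rewrite !mulmxBr -E !mulmxA.
    by rewrite /S -[in RHS]Av [in RHS]trmx_mul trmxK [in RHS](trmx_mul A v) -!mulmxA.
  rewrite (sqnormD (A *m col_of x - c) ((- t) *: (A *m v))) q1 q2; lra.
have mgh : measurable_fun setT (fun x => (gauss (shiftv x h))%:E).
  by apply/measurable_EFinP; apply: (measurableT_comp measurable_gauss); exact: measurable_shiftv.
have gh0 x : setT x -> (0 <= (gauss (shiftv x h))%:E)%E by rewrite lee_fin gauss_ge0.
move: (t ^+ 2 * _ / 2) gE => e gE.
have e0 : (0 <= (expR e)%:E)%E by rewrite lee_fin expR_ge0.
transitivity (\int[lam n]_x ((expR e)%:E * (gauss (shiftv x h))%:E))%E.
  by apply: eq_integral => x _; rewrite gE EFinM.
transitivity ((expR e)%:E * \int[lam n]_x (gauss (shiftv x h))%:E)%E.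
  exact: (ge0_integralZl _ measurableT mgh gh0 e0).
have mg : measurable_fun setT (fun x => (gauss x)%:E).
  by apply/measurable_EFinP; exact: measurable_gauss.
have g0 x : (0 <= (gauss x)%:E)%E by rewrite lee_fin gauss_ge0.
by rewrite (@integral_lebesgue_vec_translation _ _ h _ mg g0).
Qed.

Let q := (l^T *m v) 0 0.

(** The moment generating function controls the second moment through
    [x^2 <= e^x + e^-x - 2] applied to [t S], with [t] tending to [0]. *)
Lemma gauss_moment2 C a : 0 <= C ->
  (forall x, ((l^T *m x) 0 0) ^+ 2 <= C * sqnorm (A *m x)) ->
  (\int[lam n]_x (((l^T *m col_of x) 0 0 - a) ^+ 2 * gauss x)%:E <=
   (C + ((l^T *m gauss_mean) 0 0 - a) ^+ 2)%:E * \int[lam n]_x (gauss x)%:E)%E.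
Proof.
move=> C0 hC; set de := (l^T *m gauss_mean) 0 0 - a.
have q0C : 0 <= q <= C.
  have qE : q = sqnorm (A *m v).
    have Av : A^T *m (A *m v) = l by rewrite /v !mulmxA mulmxV// mul1mx.
    by rewrite sqnormE trmx_mul -mulmxA Av dotC.
  have q0 : 0 <= q by rewrite qE sqnorm_ge0.
  rewrite q0/=; have := hC v; rewrite -qE -/q => qq.
  have [->//|qn0] := eqVneq q 0.
  have qp : 0 < q by rewrite lt0r qn0.
  by rewrite -(ler_pM2r qp) -expr2.
have /andP[q0 qC] := q0C.
have SE x : (l^T *m col_of x) 0 0 - a = S x + de.
  by rewrite /S /de mulmxBr !mxE; ring.
under eq_integral do rewrite SE.
have mexp t : measurable_fun setT (fun x => expR (t * S x) * gauss x).
  apply: measurable_funM; last exact: measurable_gauss.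
  by apply: measurableT_comp => //; exact: measurable_funM.
have mI2 : measurable_fun setT (fun x => (S x + de) ^+ 2 * gauss x).
  apply: measurable_funM; last exact: measurable_gauss.
  by apply: measurable_funX; exact: measurable_funD.
have ig : (lam n).-integrable setT (EFin \o gauss).
  apply: ge0_integrable => //; [exact: measurable_gauss|exact: gauss_ge0|].
  exact: integral_gauss_fin.
set j := \int[lam n]_x gauss x.
have jE : (\int[lam n]_x (gauss x)%:E = j%:E)%E.
  by rewrite fineK//; exact: (integrable_fin_num measurableT ig).
have j0 : 0 < j by rewrite -lte_fin -jE integral_gauss_gt0.
have iexp t : (lam n).-integrable setT (EFin \o (fun x => expR (t * S x) * gauss x)).
  apply: ge0_integrable => //; first by move=> x; rewrite mulr_ge0 ?expR_ge0 ?gauss_ge0.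
  by rewrite mgf jE -EFinM ltry.
have Rmgf t : \int[lam n]_x (expR (t * S x) * gauss x) = expR (t ^+ 2 * q / 2) * j.
  by rewrite /Rintegral mgf jE -EFinM.
have pw t x : t ^+ 2 * (S x + de) ^+ 2 + 4 <=
    expR (t * S x) + expR ((- t) * S x) + 2 * expR (de * t ^+ 2 * S x) + de ^+ 2 * t ^+ 2.
  have := le_cosh (t * S x); have := expR_ge1Dx (de * t ^+ 2 * S x).
  rewrite mulNr; lra.
have i2 : (lam n).-integrable setT (EFin \o (fun x => (S x + de) ^+ 2 * gauss x)).
  have [iw _] := @integrable_lincomb _ _ _ (lam n) [:: (1, fun x => expR (1 * S x) * gauss x);
    (1, fun x => expR ((- 1) * S x) * gauss x); (2, fun x => expR (de * 1 ^+ 2 * S x) * gauss x);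
    (de ^+ 2, gauss)] ltac:(by move=> r; do 4 (case=> [<-|]; [by first [exact: iexp|exact: ig]|]); by []).
  apply: (le_abs_integrable mI2 iw) => x.
  rewrite !big_cons big_nil addr0/= ger0_norm; last by rewrite mulr_ge0 ?sqr_ge0 ?gauss_ge0.
  rewrite !mulrA -!mulrDl !mul1r ler_wpM2r; [by []|exact: gauss_ge0|].
  by have := pw 1 x; rewrite !expr1n !mulr1 !mul1r; lra.
set I2 := \int[lam n]_x ((S x + de) ^+ 2 * gauss x).
have I2E : (\int[lam n]_x ((S x + de) ^+ 2 * gauss x)%:E = I2%:E)%E.
  by rewrite fineK//; exact: (integrable_fin_num measurableT i2).
rewrite I2E jE -EFinM lee_fin.
have key t : t ^+ 2 * I2 + 4 * j <=
    (2 * expR (t ^+ 2 * q / 2) + 2 * expR ((de * t ^+ 2) ^+ 2 * q / 2) +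
      de ^+ 2 * t ^+ 2) * j.
  have := @Rintegral_lincomb_ge0 _ _ _ (lam n) [:: (1, fun x => expR (t * S x) * gauss x);
    (1, fun x => expR ((- t) * S x) * gauss x);
    (2, fun x => expR (de * t ^+ 2 * S x) * gauss x);
    (de ^+ 2 * t ^+ 2, gauss); (- 4, gauss); (- t ^+ 2, fun x => (S x + de) ^+ 2 * gauss x)].
  rewrite !big_cons !big_nil !addr0/= !Rmgf -/j -/I2 sqrrN => h.
  rewrite -subr_ge0; apply: (le_trans (h _ _)); last by lra.
    move=> r; do 6 (case=> [<-|]; [by first [exact: iexp|exact: ig|exact: i2]|]); by [].
  move=> x; rewrite !big_cons big_nil addr0/=.
  rewrite [leRHS](_ : _ = (expR (t * S x) + expR ((- t) * S x) +
    2 * expR (de * t ^+ 2 * S x) + de ^+ 2 * t ^+ 2 -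
    (t ^+ 2 * (S x + de) ^+ 2 + 4)) * gauss x); last by ring.
  by rewrite mulr_ge0 ?gauss_ge0// subr_ge0.
have step s : 0 < s -> s <= 1 -> s * C <= 1 -> s * (de ^+ 2 * C) <= 1 ->
    I2 <= (C + de ^+ 2 + s * (C ^+ 2 + de ^+ 2 * C + de ^+ 4 * C ^+ 2)) * j.
  move=> s0 s1 sC sdC.
  have e1 : expR (s * q / 2) <= 1 + s * C / 2 + 2 * (s * C / 2) ^+ 2.
    apply: (@le_trans _ _ (expR (s * C / 2))).
      by rewrite ler_expR ler_wpM2r// ler_wpM2l// ltW.
    by apply: expR_le_quad; [rewrite !mulr_ge0// ltW|lra].
  have ss : s ^+ 2 <= s by rewrite expr2 ler_piMl// ltW.
  have de2 := sqr_ge0 de.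
  have dC : 0 <= de ^+ 2 * C by rewrite mulr_ge0.
  have sd : s ^+ 2 * (de ^+ 2 * C) <= 1.
    by apply: le_trans sdC; rewrite ler_wpM2r.
  have e2 : expR (de ^+ 2 * s ^+ 2 * q / 2) <= 1 + s ^+ 2 * (de ^+ 2 * C) / 2 +
      2 * (s ^+ 2 * (de ^+ 2 * C) / 2) ^+ 2.
    apply: (@le_trans _ _ (expR (s ^+ 2 * (de ^+ 2 * C) / 2))).
      by rewrite ler_expR ler_wpM2r// [leRHS]mulrA [s ^+ 2 * _]mulrC ler_wpM2l// mulr_ge0 ?sqr_ge0.
    have sd0 := mulr_ge0 (sqr_ge0 s) dC.
    by apply: expR_le_quad; lra.
  have := key (Num.sqrt s); rewrite exprMn sqr_sqrtr ?(ltW s0)// => k.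
  rewrite -(ler_pM2l s0).
  have b1 : 2 * expR (s * q / 2) + 2 * expR (de ^+ 2 * s ^+ 2 * q / 2) + de ^+ 2 * s - 4 <=
      s * (C + de ^+ 2 + s * (C ^+ 2 + de ^+ 2 * C + de ^+ 4 * C ^+ 2)).
    have f1 : s ^+ 2 * (s ^+ 2 * (de ^+ 4 * C ^+ 2)) <= s * (s * (de ^+ 4 * C ^+ 2)).
      have -> : s * (s * (de ^+ 4 * C ^+ 2)) = s ^+ 2 * (de ^+ 4 * C ^+ 2) by ring.
      rewrite ler_wpM2l ?sqr_ge0//; apply: ler_piMl.
        by rewrite mulr_ge0 ?sqr_ge0// (_ : 4 = 2 * 2)%N// exprM sqr_ge0.
      by apply: le_trans ss _.
    move: e1 e2 f1; lra.
  have := ler_wpM2r (ltW j0) b1.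
  move: k; lra.
apply/ler_addgt0Pr => eps eps0.
pose Kc := (C ^+ 2 + de ^+ 2 * C + de ^+ 4 * C ^+ 2) * j.
have dC : 0 <= de ^+ 2 * C by rewrite mulr_ge0 ?sqr_ge0.
have Kc0 : 0 <= Kc.
  have de4 : 0 <= de ^+ 4 by rewrite (_ : 4 = 2 * 2)%N// exprM sqr_ge0.
  have C2 := sqr_ge0 C; have h := mulr_ge0 de4 C2.
  by rewrite /Kc mulr_ge0 ?(ltW j0)//; lra.
pose d := 1 + C + de ^+ 2 * C + Kc / eps.
have Ke : 0 <= Kc / eps by rewrite divr_ge0// ltW.
have d1 : 1 <= d by rewrite /d; lra.
have d0 : 0 < d by lra.
have di0 : 0 < d^-1 by rewrite invr_gt0.
apply: (le_trans (step d^-1 _ _ _ _)) => //.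
- by rewrite invf_le1.
- by rewrite mulrC ler_pdivrMr// mul1r /d; lra.
- by rewrite mulrC ler_pdivrMr// mul1r /d; lra.
rewrite mulrDl -mulrA -/Kc lerD2l mulrC ler_pdivrMr// mulrC -ler_pdivrMr//.
by rewrite /d; lra.
Qed.

End linear_form.

End gaussian_vector.

Section gaussian_laplace.
Context (R : realType).
Local Notation mu := (@lebesgue_measure R).
Local Notation lam := (@lebesgue_vec R).

Lemma col_of_insertv n (j : 'I_n.+1) s (t : Rvec R n) :
  col_of (insertv j (s, t)) = col_of (insertv j (0 : R, t)) + (s : R) *: delta_mx j 0.
Proof.
apply/colP => i; rewrite !mxE eqxx andbT; case: (unliftP j i) => [i'|] ->.
  by rewrite !insertv_lift eq_sym (negbTE (neq_lift _ _)) mulr0 addr0.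
by rewrite !insertv_eq eqxx mulr1 add0r.
Qed.

(** For fixed values of the others, coordinate [j] is Gaussian with precision
    [|A e_j|^2]. *)
Lemma le_integral_gauss_coord m n (A : 'M[R]_(m, n.+1)) (c : 'cV[R]_m) j tau kap
    (G : Rvec R n.+1 -> R) :
  measurable_fun setT G -> (forall x, 0 <= G x) ->
  (forall s t, G (insertv j (s, t)) = G (insertv j (0 : R, t))) ->
  0 < sqnorm (col j A) -> sqnorm (col j A) <= kap -> 0 <= tau ->
  (\int[lam n.+1]_x (expR (- (tau * (tnth x j : R) ^+ 2 / 2)) * (G x * gauss A c x))%:E <=
   (Num.sqrt (kap / (kap + tau)))%:E * \int[lam n.+1]_x (G x * gauss A c x)%:E)%E.
Proof.
move=> mG G0 Gj al0 alk tau0.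
have mGg : measurable_fun setT (fun x => G x * gauss A c x).
  by apply: measurable_funM => //; exact: measurable_gauss.
have mtau : measurable_fun setT (fun x : Rvec R n.+1 =>
    expR (- (tau * (tnth x j : R) ^+ 2 / 2))).
  apply: measurableT_comp => //; apply: measurableT_comp => //.
  apply: measurable_funM => //; apply: measurable_funM => //.
  by apply: measurable_funX; exact: measurable_tnth.
have GG0 x : 0 <= G x * gauss A c x by rewrite mulr_ge0 ?gauss_ge0.
have k0 : (0 <= (Num.sqrt (kap / (kap + tau)))%:E)%E by rewrite lee_fin sqrtr_ge0.
have mins (F : Rvec R n.+1 -> R) : measurable_fun setT F ->
    measurable_fun setT (fun z : measurableTypeR R * Rvec R n => (F (insertv j z))%:E).
  move=> mF; apply/measurable_EFinP; apply: measurableT_comp => //.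
  exact: measurable_insertv.
rewrite !(integral_lebesgue_insert j); last 4 first.
- exact/measurable_EFinP.
- by move=> x; rewrite lee_fin.
- by apply/measurable_EFinP; exact: measurable_funM.
- by move=> x; rewrite lee_fin mulr_ge0 ?expR_ge0.
have mI (F : Rvec R n.+1 -> R) : measurable_fun setT F -> (forall x, 0 <= F x) ->
    measurable_fun setT (fun t => \int[mu]_s (F (insertv j (s, t)))%:E)%E.
  move=> mF F0; apply: (@measurable_fun_fubini_tonelli_G _ _ _ _ _ mu
    (fun z => (F (insertv j z))%:E)); first exact: mins.
  by move=> z; rewrite lee_fin.
rewrite -ge0_integralZl//; last 2 first.
- exact: (mI (fun x => G x * gauss A c x) mGg GG0).
- by move=> t _; apply: integral_ge0 => s _; rewrite lee_fin.
apply: ge0_le_integral => //.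
- by move=> t _; apply: integral_ge0 => s _; rewrite lee_fin mulr_ge0 ?expR_ge0.
- apply: (mI (fun x => expR (- (tau * (tnth x j : R) ^+ 2 / 2)) * (G x * gauss A c x))).
    exact: measurable_funM.
  by move=> x; rewrite mulr_ge0 ?expR_ge0.
- by apply: emeasurable_funM => //; exact: (mI (fun x => G x * gauss A c x) mGg GG0).
move=> t _.
pose r := A *m col_of (insertv j (0 : R, t)) - c.
pose be := - (r^T *m col j A) 0 0.
pose Kt := G (insertv j (0 : R, t)) * expR (- (sqnorm r / 2)).
pose al := sqnorm (col j A).
have E s : G (insertv j (s, t)) * gauss A c (insertv j (s, t)) =
    Kt * expR (- (al * (s : R) ^+ 2 / 2) + be * s).
  rewrite Gj /Kt /gauss -!mulrA -expRD; congr (_ * expR _).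
  have -> : A *m col_of (insertv j (s, t)) - c = r + (s : R) *: col j A.
    by rewrite col_of_insertv mulmxDr -scalemxAr -colE addrAC.
  rewrite sqnormD sqnormZ -/al -scalemxAr mxE /be; lra.
have Kt0 : 0 <= Kt by rewrite mulr_ge0 ?expR_ge0.
have mq (b : R) : measurable_fun setT (fun s : measurableTypeR R =>
    expR (- (b * (s : R) ^+ 2 / 2) + be * s)).
  apply: measurableT_comp => //; apply: measurable_funD; last exact: measurable_funM.
  apply: measurableT_comp => //; apply: measurable_funM => //.
  by apply: measurable_funM => //; exact: measurable_funX.
have mt : measurable_fun setT (fun s : measurableTypeR R => expR (- (tau * (s : R) ^+ 2 / 2))).
  apply: measurableT_comp => //; apply: measurableT_comp => //.
  apply: measurable_funM => //; apply: measurable_funM => //.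
under eq_integral do rewrite E insertv_eq/= mulrCA EFinM.
under [X in (_ <= _ * X)%E]eq_integral do rewrite E EFinM.
rewrite ge0_integralZl; [|by []| |by move=> x _; rewrite lee_fin mulr_ge0 ?expR_ge0|by rewrite lee_fin]; last first.
  by apply/measurable_EFinP; exact: measurable_funM.
rewrite ge0_integralZl; [|by []| |by move=> x _; rewrite lee_fin expR_ge0|by rewrite lee_fin]; last first.
  by apply/measurable_EFinP.
rewrite muleCA lee_wpmul2l ?lee_fin//.
exact: le_integral_gaussian_tilt.
Qed.

(** The coordinates are treated one at a time: the factors of the others do not
    involve the current one and can be absorbed in the function [G] of
    [le_integral_gauss_coord]. *)
Lemma gauss_laplace m n (A : 'M[R]_(m, n)) (c : 'cV[R]_m) tau kap (s : seq 'I_n) :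
  \rank A = n -> 0 <= tau -> uniq s -> (forall j, j \in s -> sqnorm (col j A) <= kap) ->
  (\int[lam n]_x (expR (- (tau * (\sum_(j <- s) (tnth x j : R) ^+ 2) / 2)) * gauss A c x)%:E <=
   (Num.sqrt (kap / (kap + tau)) ^+ size s)%:E * \int[lam n]_x (gauss A c x)%:E)%E.
Proof.
move=> rA tau0; elim: s => [|j s ih].
  move=> _ _; rewrite expr0 mul1e le_eqVlt; apply/orP; left; apply/eqP.
  apply: eq_integral => x _; rewrite big_nil -[in RHS](mul1r (gauss A c x)) -expR0.
  by congr ((expR _ * _)%:E); lra.
move=> /= /andP[js us] hs.
case: n A s j rA js us hs ih => [|n] A s j rA js us hs ih; first by case: j js hs.
have jk : sqnorm (col j A) <= kap by apply: hs; rewrite inE eqxx.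
have j0 : 0 < sqnorm (col j A).
  have [eps eps0 coer] := gauss_coercive rA.
  rewrite colE; apply: lt_le_trans (coer (delta_mx j 0)).
  rewrite mulr_gt0// lt0r sqnorm_ge0 andbT; apply/negP => /eqP /sqnorm_eq0 /matrixP /(_ j 0).
  by rewrite !mxE !eqxx => /eqP; rewrite oner_eq0.
pose G (x : Rvec R n.+1) := expR (- (tau * (\sum_(i <- s) (tnth x i : R) ^+ 2) / 2)).
have mG : measurable_fun setT G.
  apply: measurableT_comp => //; apply: measurableT_comp => //.
  apply: measurable_funM => //; apply: measurable_funM => //.
  by apply: measurable_sum => i; apply: measurable_funX; exact: measurable_tnth.
have G0 x : 0 <= G x by exact: expR_ge0.
have Gj s' t : G (insertv j (s', t)) = G (insertv j (0 : R, t)).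
  rewrite /G; congr (expR (- (tau * _ / 2))).
  rewrite !big_seq; apply: eq_bigr => i si.
  case: (unliftP j i) si => [i'|] -> si; first by rewrite !insertv_lift.
  by rewrite si in js.
have := le_integral_gauss_coord c mG G0 Gj j0 jk tau0.
under eq_integral do rewrite mulrA -expRD.
rewrite (eq_integral (fun x : Rvec R n.+1 => (expR (- (tau * (\sum_(i <- j :: s) (tnth x i : R) ^+ 2) / 2)) *
    gauss A c x)%:E)); last first.
  by move=> x _; congr ((expR _ * _)%:E); rewrite big_cons; lra.
move=> /le_trans; apply.
rewrite exprS EFinM -muleA lee_wpmul2l ?lee_fin ?sqrtr_ge0//.
by apply: ih => // i si; apply: hs; rewrite inE si orbT.
Qed.

End gaussian_laplace.

(** * Negative moments of Gaussian vectors *)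

Section negative_moments.
Context (R : realType).
Local Notation mu := (@lebesgue_measure R).
Local Notation lam := (@lebesgue_vec R).

(** Integrals over the positive reals become integrals over [R], to which
    Tonelli applies directly. *)
Definition heaviside (x : measurableTypeR R) : R := (0 < x)%R%:R.

Lemma heaviside_ge0 x : 0 <= heaviside x. Proof. exact: ler0n. Qed.

Lemma heaviside1 x : 0 < x -> heaviside x = 1.
Proof. by rewrite /heaviside => ->. Qed.

Lemma heaviside0 x : x <= 0 -> heaviside x = 0.
Proof. by rewrite /heaviside ltNge => ->. Qed.

Lemma integral_positive (f : R -> R) :
  (\int[mu]_(x in `]0%R, +oo[) (f x)%:E = \int[mu]_x (f x * heaviside x)%:E)%E.
Proof.
rewrite integral_mkcond; apply: eq_integral => x _.
rewrite patchE mem_setE in_itv/= andbT /heaviside.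
by case: ifPn => _; rewrite ?mulr1 ?mulr0.
Qed.

Lemma measurable_heaviside : measurable_fun setT heaviside.
Proof.
have -> : heaviside = (fun b : bool => b%:R) \o (fun x : measurableTypeR R => 0 < x) by [].
by apply: measurableT_comp => //; exact: measurable_fun_ltr.
Qed.

Lemma measurable_expRZ (e : R) :
  measurable_fun setT (fun t : measurableTypeR R => expR (- (e * t))).
Proof.
have h : measurable_fun setT (fun t : measurableTypeR R => e * t) by exact: measurable_funM.
exact: (measurableT_comp (@measurable_expRN R) h).
Qed.

(** Tonelli for a double integral that is a gamma integral in either variable. *)
Lemma integral_beta s b kap : 0 < s -> s < b -> 0 < kap ->
  (\int[mu]_(t in `]0%R, +oo[) (t `^ (s - 1) * (kap / (kap + t)) `^ b)%:E =
   (kap `^ s * Gamma s * Gamma (b - s) / Gamma b)%:E)%E.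
Proof.
(* From here on, Gamma is any positive function with this integral representation. *)
move: (@Gamma R) (@Gamma_gt0 R) (@integral_gamma_kernel R) => G G_gt0 Gkernel.
move=> s0 sb kap0; have b0 := lt_trans s0 sb; have bs0 : 0 < b - s by rewrite subr_gt0.
have Gb := G_gt0 _ b0; have Gs := G_gt0 _ s0.
pose h (z : measurableTypeR R * measurableTypeR R) : R :=
  (z.1 `^ (s - 1) * heaviside z.1) * (z.2 `^ (b - 1) * heaviside z.2) *
  expR (- ((1 + z.1 / kap) * z.2)).
have h0 z : 0 <= h z by rewrite !mulr_ge0 ?powR_ge0 ?expR_ge0 ?heaviside_ge0.
have mpow e : measurable_fun setT (fun x : measurableTypeR R => x `^ e * heaviside x).
  by apply: measurable_funM; [exact: measurable_powR|exact: measurable_heaviside].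
have mh : measurable_fun setT h.
  apply: measurable_funM.
    apply: measurable_funM.
      exact: (measurableT_comp (mpow (s - 1)) measurable_fst).
    exact: (measurableT_comp (mpow (b - 1)) measurable_snd).
  apply: measurableT_comp => //; apply: measurableT_comp => //.
  apply: measurable_funM; last exact: measurable_snd.
  apply: measurable_funD => //; apply: measurable_funM => //; exact: measurable_fst.
have E1 t : (\int[mu]_r (h (t, r))%:E =
    (t `^ (s - 1) * (kap / (kap + t)) `^ b * G b * heaviside t)%:E)%E.
  have [t0|t0] := ltP 0 t; last first.
    rewrite heaviside0// mulr0; apply: integral0_eq => r _.
    by rewrite /h /= heaviside0// mulr0 !mul0r.
  have d0 : 0 < 1 + t / kap by rewrite addr_gt0// divr_gt0.
  transitivity ((t `^ (s - 1))%:E * \int[mu]_(r in `]0%R, +oo[)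
      (r `^ (b - 1) * expR (- ((1 + t / kap) * r)))%:E)%E.
    rewrite integral_positive -ge0_integralZl//.
    - by apply: eq_integral => r _; rewrite -EFinM /h/= (heaviside1 t0); congr EFin; ring.
    - apply/measurable_EFinP; apply: measurable_funM; last exact: measurable_heaviside.
      apply: measurable_funM; first exact: measurable_powR.
      exact: measurable_expRZ.
    - by move=> r _; rewrite lee_fin !mulr_ge0 ?powR_ge0 ?expR_ge0 ?heaviside_ge0.
    - by rewrite lee_fin powR_ge0.
  rewrite Gkernel// heaviside1// -EFinM mulr1 mulrA; congr (_ * _ * _)%:E.
  have -> : kap / (kap + t) = (1 + t / kap)^-1.
    by field; rewrite !gt_eqF// addr_gt0.
  by rewrite -(powR_inv1 (ltW d0)) -powRrM mulN1r.
have E2 r : (\int[mu]_t (h (t, r))%:E =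
    (kap `^ s * G s * (r `^ (b - s - 1) * expR (- (1 * r))) * heaviside r)%:E)%E.
  have [r0|r0] := ltP 0 r; last first.
    rewrite heaviside0// mulr0; apply: integral0_eq => t _.
    by rewrite /h /= (heaviside0 r0) !mulr0 mul0r.
  have d0 : 0 < r / kap by rewrite divr_gt0.
  transitivity ((r `^ (b - 1) * expR (- r))%:E * \int[mu]_(t in `]0%R, +oo[)
      (t `^ (s - 1) * expR (- (r / kap * t)))%:E)%E.
    rewrite integral_positive -ge0_integralZl//.
    - apply: eq_integral => t _; rewrite -EFinM /h/= (heaviside1 r0); congr EFin.
      have -> : - ((1 + t / kap) * r) = - r + - (r / kap * t) by ring.
      by rewrite expRD; ring.
    - apply/measurable_EFinP; apply: measurable_funM; last exact: measurable_heaviside.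
      apply: measurable_funM; first exact: measurable_powR.
      exact: measurable_expRZ.
    - by move=> t _; rewrite lee_fin !mulr_ge0 ?powR_ge0 ?expR_ge0 ?heaviside_ge0.
    - by rewrite lee_fin mulr_ge0 ?powR_ge0 ?expR_ge0.
  rewrite Gkernel// heaviside1// -EFinM mulr1 mul1r; congr EFin.
  rewrite powRM ?invr_ge0 ?(ltW kap0) ?(ltW r0)//.
  rewrite -(powR_inv1 (ltW kap0)) -powRrM mulN1r opprK.
  have -> : b - s - 1 = (b - 1) - s by ring.
  have -> : r `^ (b - 1 - s) = r `^ (b - 1) * r `^ (- s).
    by rewrite -powRD// (gt_eqF r0) implybT.
  ring.
have mhE : measurable_fun setT (EFin \o h) by exact/measurable_EFinP.
have h0E z : (0 <= (EFin \o h) z)%E by rewrite lee_fin.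
have := @fubini_tonelli _ _ _ _ _ mu mu (EFin \o h) mhE h0E.
under eq_integral do rewrite /= E1.
under [in RHS]eq_integral do rewrite /= E2.
have kG : 0 <= kap `^ s * G s by rewrite mulr_ge0 ?powR_ge0// ltW.
have mgam : measurable_fun setT (fun r : measurableTypeR R => r `^ (b - s - 1) * expR (- (1 * r))).
  by apply: measurable_funM; [exact: measurable_powR|exact: measurable_expRZ].
have -> : (\int[mu]_r (kap `^ s * G s * (r `^ (b - s - 1) * expR (- (1 * r))) * heaviside r)%:E =
    (kap `^ s * G s * G (b - s))%:E)%E.
  rewrite -(integral_positive (fun r => kap `^ s * G s * (r `^ (b - s - 1) * expR (- (1 * r))))).
  under eq_integral do rewrite EFinM.
  rewrite ge0_integralZl//; last 2 first.
  - by apply/measurable_EFinP; apply: measurable_funTS.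
  - by move=> r _; rewrite lee_fin mulr_ge0 ?powR_ge0 ?expR_ge0.
  by rewrite Gkernel// powR1 mul1r.
have mk : measurable_fun setT (fun t : measurableTypeR R => t `^ (s - 1) * (kap / (kap + t)) `^ b).
  apply: measurable_funM; first exact: measurable_powR.
  apply: (measurableT_comp (measurable_powR b)); apply: measurable_funM => //.
  apply: (measurableT_comp (@measurable_invr R)); exact: measurable_funD.
have -> : (\int[mu]_t (t `^ (s - 1) * (kap / (kap + t)) `^ b * G b * heaviside t)%:E =
   (G b)%:E * \int[mu]_(t in `]0%R, +oo[) (t `^ (s - 1) * (kap / (kap + t)) `^ b)%:E)%E.
  rewrite -ge0_integralZl//; last 3 first.
  - by apply/measurable_EFinP; apply: measurable_funTS.
  - by move=> t _; rewrite lee_fin mulr_ge0 ?powR_ge0.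
  - by rewrite lee_fin ltW.
  rewrite (integral_positive (fun t => G b * (t `^ (s - 1) * (kap / (kap + t)) `^ b))).
  by apply: eq_integral => t _; congr EFin; ring.
move=> E.
have -> : (kap `^ s * G s * G (b - s) / G b)%:E =
    (((G b)^-1)%:E * (kap `^ s * G s * G (b - s))%:E)%E.
  by rewrite -EFinM mulrC.
by rewrite -E muleA -EFinM mulVf ?mul1e// gt_eqF.
Qed.

(** Negative moments of the squared norm of a block of coordinates, from its
    Laplace transform: [d^-s = int t^(s-1) e^(-td) dt / Gamma s]. *)
Lemma gauss_neg_moment m n (A : 'M[R]_(m, n)) (c : 'cV[R]_m) kap s (js : seq 'I_n) :
  \rank A = n -> uniq js -> (forall j, j \in js -> sqnorm (col j A) <= kap) ->
  0 < s -> s < (size js)%:R / 2 -> 0 < kap ->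
  (\int[lam n]_x (((\sum_(j <- js) (tnth x j : R) ^+ 2) / 2) `^ (- s) * gauss A c x)%:E <=
   (kap `^ s * Gamma ((size js)%:R / 2 - s) / Gamma ((size js)%:R / 2))%:E *
   \int[lam n]_x (gauss A c x)%:E)%E.
Proof.
move: (@Gamma R) (@Gamma_gt0 R) (@integral_gamma_kernel R) integral_beta => G G_gt0 Gkernel Gbeta.
move=> rA ujs hjs s0; set b := (size js)%:R / 2 => sb kap0.
have b0 := lt_trans s0 sb; have bs0 : 0 < b - s by rewrite subr_gt0.
have Gb := G_gt0 _ b0; have Gs := G_gt0 _ s0; have Gbs := G_gt0 _ bs0.
pose d (x : Rvec R n) : R := (\sum_(j <- js) (tnth x j : R) ^+ 2) / 2.
have d0 x : 0 <= d x by rewrite divr_ge0// sumr_ge0// => j _; exact: sqr_ge0.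
have md : measurable_fun setT d.
  apply: measurable_funM => //; apply: measurable_sum => j; apply: measurable_funX.
  exact: measurable_tnth.
pose h (z : measurableTypeR R * Rvec R n) : R :=
  z.1 `^ (s - 1) * heaviside z.1 * (expR (- (d z.2 * z.1)) * gauss A c z.2).
have h0 z : 0 <= h z.
  by rewrite !mulr_ge0 ?powR_ge0 ?expR_ge0 ?heaviside_ge0 ?gauss_ge0.
have mh : measurable_fun setT h.
  apply: measurable_funM.
    apply: measurable_funM.
      exact: (measurableT_comp (measurable_powR (s - 1)) measurable_fst).
    exact: (measurableT_comp measurable_heaviside measurable_fst).
  apply: measurable_funM.
    apply: measurableT_comp => //; apply: measurableT_comp => //.
    apply: measurable_funM; last exact: measurable_fst.
    exact: (measurableT_comp md measurable_snd).
  exact: (measurableT_comp (measurable_gauss A c) measurable_snd).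
have mg : measurable_fun setT (fun x => (gauss A c x)%:E).
  by apply/measurable_EFinP; exact: measurable_gauss.
have mhE : measurable_fun setT (EFin \o h) by exact/measurable_EFinP.
have h0E z : (0 <= (EFin \o h) z)%E by rewrite lee_fin.
have F := @fubini_tonelli _ _ _ _ _ mu (lam n) (EFin \o h) mhE h0E.
set J := (\int[lam n]_x (gauss A c x)%:E)%E.
have J0 : (0 <= J)%E by apply: integral_ge0 => x _; rewrite lee_fin gauss_ge0.
have mpe (e : R) : measurable_fun setT (fun t : measurableTypeR R => t `^ (s - 1) * expR (- (e * t))).
  by apply: measurable_funM; [exact: measurable_powR|exact: measurable_expRZ].
have low x : ((d x `^ (- s) * gauss A c x)%:E <=
    ((G s)^-1)%:E * \int[mu]_t (h (t, x))%:E)%E.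
  have [dx0|dx] := eqVneq (d x) 0.
    rewrite dx0 powR0 ?oppr_eq0 ?gt_eqF// mul0r mule_ge0 ?lee_fin ?invr_ge0 ?(ltW Gs)//.
    by apply: integral_ge0 => t _; rewrite lee_fin.
  have dp : 0 < d x by rewrite lt0r dx d0.
  have -> : (\int[mu]_t (h (t, x))%:E = (gauss A c x)%:E *
      \int[mu]_(t in `]0%R, +oo[) (t `^ (s - 1) * expR (- (d x * t)))%:E)%E.
    rewrite integral_positive -ge0_integralZl//.
    - by apply: eq_integral => t _; rewrite -EFinM /h/=; congr EFin; ring.
    - apply/measurable_EFinP; apply: measurable_funM => //; exact: measurable_heaviside.
    - by move=> t _; rewrite lee_fin !mulr_ge0 ?powR_ge0 ?expR_ge0 ?heaviside_ge0.
    - by rewrite lee_fin gauss_ge0.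
  rewrite Gkernel// -!EFinM lee_fin le_eqVlt; apply/orP; left; apply/eqP.
  by field; rewrite gt_eqF.
apply: (@le_trans _ _ (\int[lam n]_x (((G s)^-1)%:E * \int[mu]_t (h (t, x))%:E))%E).
  apply: ge0_le_integral => //.
  - by move=> x _; rewrite lee_fin mulr_ge0 ?powR_ge0 ?gauss_ge0.
  - apply/measurable_EFinP; apply: measurable_funM; last exact: measurable_gauss.
    exact: (measurableT_comp (measurable_powR (- s))).
  - apply: emeasurable_funM => //.
    exact: (@measurable_fun_fubini_tonelli_G _ _ _ _ _ mu (EFin \o h)).
  - by move=> x _; exact: low.
have mI2 : measurable_fun setT (fun x => \int[mu]_t (h (t, x))%:E)%E.
  exact: (@measurable_fun_fubini_tonelli_G _ _ _ _ _ mu (EFin \o h)).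
have I20 x : setT x -> (0 <= \int[mu]_t (h (t, x))%:E)%E.
  by move=> _; apply: integral_ge0 => t _; rewrite lee_fin.
have Gs0 : (0 <= ((G s)^-1)%:E)%E by rewrite lee_fin invr_ge0; exact: ltW.
have -> : (\int[lam n]_x (((G s)^-1)%:E * \int[mu]_t (h (t, x))%:E) =
    ((G s)^-1)%:E * \int[lam n]_x \int[mu]_t (h (t, x))%:E)%E.
  exact: (ge0_integralZl (lam n) measurableT mI2 I20 Gs0).
rewrite -F.
have up t : (\int[lam n]_x (h (t, x))%:E <=
    (t `^ (s - 1) * (kap / (kap + t)) `^ b * heaviside t)%:E * J)%E.
  have [t0|t0] := ltP 0 t; last first.
    rewrite heaviside0// mulr0 mul0e integral0_eq// => x _.
    by rewrite /h/= heaviside0// mulr0 mul0r.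
  have kt : 0 <= kap / (kap + t) by rewrite divr_ge0 ?addr_ge0// ltW.
  have -> : (kap / (kap + t)) `^ b = Num.sqrt (kap / (kap + t)) ^+ size js.
    by rewrite -powR12_sqrt// -powR_mulrn ?powR_ge0// -powRrM [2^-1 * _]mulrC.
  rewrite heaviside1// mulr1 EFinM -muleA.
  have := gauss_laplace c rA (ltW t0) ujs hjs.
  have ts0 : (0 <= (t `^ (s - 1))%:E)%E by rewrite lee_fin powR_ge0.
  move=> /(lee_wpmul2l ts0); apply: le_trans.
  rewrite -ge0_integralZl//; last 2 first.
  - apply/measurable_EFinP; apply: measurable_funM; last exact: measurable_gauss.
    apply: measurableT_comp => //; apply: measurableT_comp => //.
    apply: measurable_funM => //; apply: measurable_funM => //.
    apply: measurable_sum => j; apply: measurable_funX; exact: measurable_tnth.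
  - by move=> x _; rewrite lee_fin mulr_ge0 ?expR_ge0 ?gauss_ge0.
  rewrite le_eqVlt; apply/orP; left; apply/eqP; apply: eq_integral => x _.
  rewrite -EFinM /h/= heaviside1// mulr1; congr (_ * (expR _ * _))%:E.
  by rewrite /d; ring.
have mub : measurable_fun setT (fun t : measurableTypeR R =>
    t `^ (s - 1) * (kap / (kap + t)) `^ b * heaviside t).
  apply: measurable_funM; last exact: measurable_heaviside.
  apply: measurable_funM; first exact: measurable_powR.
  apply: (measurableT_comp (measurable_powR b)); apply: measurable_funM => //.
  apply: (measurableT_comp (@measurable_invr R)); exact: measurable_funD.
apply: (@le_trans _ _ (((G s)^-1)%:E * \int[mu]_t
    ((t `^ (s - 1) * (kap / (kap + t)) `^ b * heaviside t)%:E * J))%E).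
  rewrite lee_wpmul2l//; apply: ge0_le_integral => //.
  - by move=> t _; apply: integral_ge0 => x _; rewrite lee_fin.
  - exact: (@measurable_fun_fubini_tonelli_F _ _ _ _ _ (lam n) (EFin \o h)).
  - by apply: emeasurable_funM => //; exact/measurable_EFinP.
  - by move=> t _; exact: up.
rewrite ge0_integralZr//; last 2 first.
- exact/measurable_EFinP.
- by move=> t _; rewrite lee_fin !mulr_ge0 ?powR_ge0 ?heaviside_ge0.
rewrite -(integral_positive (fun t => t `^ (s - 1) * (kap / (kap + t)) `^ b)).
rewrite Gbeta// muleA -EFinM lee_wpmul2r// lee_fin le_eqVlt; apply/orP; left.
apply/eqP; move: Gs Gb => {Gbs Gs0 low}.
move: (kap `^ s) (G (b - s)) (G b) (G s) => k g1 g2 g3 g3p g2p.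
by field; rewrite (gt_eqF g3p) (gt_eqF g2p).
Qed.

End negative_moments.

(** * Gibbs samplers with inverse gamma updates *)

Section sigma_finite_product.
Local Open Scope ereal_scope.
Context d1 d2 (T1 : measurableType d1) (T2 : measurableType d2) (R : realType).
Variables (m1 : {sigma_finite_measure set T1 -> \bar R})
          (m2 : {sigma_finite_measure set T2 -> \bar R}).

Let sigma_finite_prod : sigma_finite setT (m1 \x m2).
Proof.
have /sigma_finiteP[F [TF ndF Foo]] := sigma_finiteT m1.
have /sigma_finiteP[G [TG ndG Goo]] := sigma_finiteT m2.
exists (fun i => F i `*` G i).
  rewrite -setXTT TF TG predeqE => -[x y]; split.
    move=> [/= [i _ Fx] [k _ Gy]]; exists (maxn i k) => //; split.
    - by move: x Fx; exact/subsetPset/ndF/leq_maxl.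
    - by move: y Gy; exact/subsetPset/ndG/leq_maxr.
  by move=> [i _ []/= ? ?]; split; exists i.
move=> i; have [? ?] := Foo i; have [? ?] := Goo i.
split; first exact: measurableX.
by rewrite product_measure1E// lte_mul_pinfty// ge0_fin_numE.
Qed.

(** A name for the product measure to which its sigma-finiteness is attached. *)
Definition sigma_finite_product : set (T1 * T2) -> \bar R := m1 \x m2.

HB.instance Definition _ := Measure.copy sigma_finite_product (m1 \x m2).

HB.instance Definition _ :=
  Measure_isSigmaFinite.Build _ _ _ sigma_finite_product sigma_finite_prod.

End sigma_finite_product.

Section nstep_congruence.
Context d (T : measurableType d) (R : realType).
Variables (mu : {measure set T -> \bar R}) (S : set T).

Lemma eq_nstep (k k' : T -> T -> R) : (forall z x, S z -> S x -> k z x = k' z x) ->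
  forall n x A, S x -> nstep mu S k n x A = nstep mu S k' n x A.
Proof.
move=> kk; elim=> [//|n ih] x A Sx /=; apply: eq_integral => z /set_mem Sz.
by rewrite kk// ih.
Qed.

(** Only the values of the density on the state space matter. *)
Lemma eq_geometric_tv_bound (k k' : T -> T -> R) (Pi Pi' : set T -> \bar R) :
  (forall z x, S z -> S x -> k z x = k' z x) -> (forall A, Pi A = Pi' A) ->
  geometric_tv_bound mu S k Pi -> geometric_tv_bound mu S k' Pi'.
Proof.
move=> kk pp [M [rho [M0 rho01 H]]]; exists M, rho; split=> // x n Sx.
have -> : (fun A => nstep mu S k' n x A - Pi' A)%E = (fun A => nstep mu S k n x A - Pi A)%E.
  by apply/funext => A; rewrite pp (eq_nstep kk).
exact: H.
Qed.

End nstep_congruence.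

Section gibbs_core.
Context dT (Theta : measurableType dT) (R : realType) (n : nat).
Variable nu : {sigma_finite_measure set Theta -> \bar R}.
Local Notation lam := (@lebesgue_vec R n).
Local Notation T := (Theta * Rvec R n)%type.
Variables (c : 'I_n -> R) (d : 'I_n -> Theta -> R) (kap : R).
Hypothesis c0 : forall j, 0 < c j.
Hypothesis d_ge0 : forall j th, 0 <= d j th.
Hypothesis md : forall j, measurable_fun setT (d j).
Hypothesis kap0 : 0 < kap.
Hypothesis nu0 : nu setT != 0%E.
Hypothesis dnull : forall j, nu.-negligible [set th | d j th = 0].

(** The set on which the inverse gamma laws for all the variances make sense. *)
Definition regular th := [forall j, 0 < d j th].

(** The part of the joint density that depends on [th]. *)
Definition energy th (s : Rvec R n) : R := expR (- \sum_j d j th / (tnth s j : R)).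

Definition energy_mass s : \bar R := (\int[nu]_th (energy th s)%:E)%E.

Hypothesis mass_gt0 : forall s, posvec s -> (0 < energy_mass s)%E.
Hypothesis mass_lty : forall s, posvec s -> (energy_mass s < +oo)%E.

Definition pos (s : Rvec R n) : R := \1_(@posvec R n) s.

Definition joint_density th s : R :=
  kap * \prod_j ((tnth s j : R) `^ (- c j - 1) * expR (- (d j th / (tnth s j : R)))) * pos s.

Definition theta_cond th s : R := energy th s / fine (energy_mass s).

Definition var_cond s th : R :=
  if regular th then \prod_j ig_pdf (c j) (d j th) (tnth s j)
  else \prod_j ig_pdf 1 1 (tnth s j).

(** Extended by zero outside the state space, so that one can integrate over the
    whole product. *)
Definition gibbs_kernel (z x : T) : R := var_cond z.2 z.1 * theta_cond z.1 x.2 * pos z.2 * pos x.2.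

Lemma pos1 s : posvec s -> pos s = 1.
Proof. by move=> ps; rewrite /pos indicE mem_set. Qed.

Lemma pos0 s : ~ posvec s -> pos s = 0.
Proof. by move=> ps; rewrite /pos indicE memNset. Qed.

Lemma pos_ge0 s : 0 <= pos s. Proof. by []. Qed.

Lemma measurable_pos : measurable_fun setT pos.
Proof. apply: measurable_indic; exact: measurable_posvec. Qed.

Lemma energy_gt0 th s : 0 < energy th s. Proof. exact: expR_gt0. Qed.

Lemma measurable_energy : measurable_fun setT (fun z : T => energy z.1 z.2).
Proof.
apply: measurableT_comp => //; apply: measurableT_comp => //.
apply: measurable_sum => j; apply: measurable_funM.
  exact: (measurableT_comp (md j) measurable_fst).
apply: (measurableT_comp (@measurable_invr R)).
exact: (measurableT_comp (measurable_tnth j) measurable_snd).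
Qed.

Lemma massE s : posvec s -> energy_mass s = (fine (energy_mass s))%:E.
Proof.
move=> ps; rewrite fineK// ge0_fin_numE ?mass_lty//.
by rewrite ltW// mass_gt0.
Qed.

Lemma fine_mass_gt0 s : posvec s -> 0 < fine (energy_mass s).
Proof. by move=> ps; rewrite -lte_fin -massE// mass_gt0. Qed.

Lemma theta_cond_gt0 th s : posvec s -> 0 < theta_cond th s.
Proof. by move=> ps; rewrite divr_gt0 ?energy_gt0 ?fine_mass_gt0. Qed.

Lemma var_cond_ge0 s th : 0 <= var_cond s th.
Proof. by rewrite /var_cond; case: ifP => _; apply: prodr_ge0 => j _; exact: ig_pdf_ge0. Qed.

Lemma var_cond0 s th : ~ posvec s -> var_cond s th = 0.
Proof.
move=> ps; have [j sj] : exists j, ~ (0 < (tnth s j : R)) by exact/existsNP.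
have ig0 a b : ig_pdf a b (tnth s j) = 0.
  by rewrite /ig_pdf; case: ifPn => // sj'; exfalso; apply: sj.
by rewrite /var_cond; case: ifP => _; rewrite (bigD1 j)//= ig0 mul0r.
Qed.

Lemma measurable_regular : measurable_fun setT regular.
Proof.
have -> : regular = fun th => all (fun j => 0 < d j th) (enum 'I_n).
  apply/funext => th; apply/forallP/allP => h j; first by move=> _; exact: h.
  by apply: h; rewrite mem_enum.
elim: (enum 'I_n) => [|j l ih] /=; first exact: measurable_cst.
by apply: measurable_and => //; exact: measurable_fun_ltr.
Qed.

Lemma measurable_var_cond : measurable_fun setT (fun z : T => var_cond z.2 z.1).
Proof.
have mt j : measurable_fun setT (fun z : T => tnth z.2 j : R).
  exact: (measurableT_comp (measurable_tnth j) measurable_snd).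
apply: measurable_fun_ifT.
- exact: (measurableT_comp measurable_regular measurable_fst).
- apply: measurable_prod => j _; apply: measurable_ig_pdf => //.
  exact: (measurableT_comp (md j) measurable_fst).
- by apply: measurable_prod => j _; exact: measurable_ig_pdf.
Qed.

Lemma measurable_energy_mass : measurable_fun setT energy_mass.
Proof.
have mE : measurable_fun setT (fun z : T => (energy z.1 z.2)%:E).
  by apply/measurable_EFinP; exact: measurable_energy.
have E0 (z : T) : (0 <= (energy z.1 z.2)%:E)%E by rewrite lee_fin ltW// energy_gt0.
exact: (@measurable_fun_fubini_tonelli_G _ _ _ _ _ nu _ mE E0).
Qed.

Lemma measurable_theta_cond : measurable_fun setT (fun z : T => theta_cond z.1 z.2).
Proof.
apply: measurable_funM; first exact: measurable_energy.
apply: (measurableT_comp (@measurable_invr R)).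
apply: (measurableT_comp (measurableT_comp (fine_measurable measurableT) measurable_energy_mass) measurable_snd).
Qed.

Lemma measurable_gibbs_kernel : measurable_fun setT (fun zx : T * T => gibbs_kernel zx.1 zx.2).
Proof.
apply: measurable_funM; last first.
  exact: (measurableT_comp measurable_pos (measurableT_comp measurable_snd measurable_snd)).
apply: measurable_funM; last first.
  exact: (measurableT_comp measurable_pos (measurableT_comp measurable_snd measurable_fst)).
apply: measurable_funM.
  exact: (measurableT_comp measurable_var_cond measurable_fst).
apply: (measurableT_comp (f := fun z : T => theta_cond z.1 z.2)
  (g := fun zx : T * T => (zx.1.1, zx.2.2))); first exact: measurable_theta_cond.
apply/measurable_fun_pairP; split.
  exact: (measurableT_comp measurable_fst measurable_fst).
exact: (measurableT_comp measurable_snd measurable_snd).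
Qed.

Let mig (a e : R) : measurable_fun setT (fun v : R => ig_pdf a e v).
Proof. exact: measurable_ig_pdf. Qed.

Lemma integral_var_cond th : (\int[lam]_s (var_cond s th)%:E = 1)%E.
Proof.
have ig1 (a e : 'I_n -> R) : (forall j, 0 < a j) -> (forall j, 0 < e j) ->
    (\int[lam]_s (\prod_j ig_pdf (a j) (e j) (tnth s j))%:E = 1)%E.
  move=> a0 e0; have ig0 j v : 0 <= ig_pdf (a j) (e j) v by exact: ig_pdf_ge0.
  have -> := integral_lebesgue_vec_prod (fun j => mig (a j) (e j)) ig0.
  by rewrite big1// => j _; exact: integral_ig_pdf.
rewrite /var_cond; have [reg|_] := boolP (regular th); last exact: (ig1 (fun=> 1) (fun=> 1)).
by apply: ig1 => //; exact/forallP.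
Qed.

Lemma var_cond_moment th j e : regular th -> e < c j ->
  (\int[lam]_s (var_cond s th * (tnth s j : R) `^ e)%:E =
   (d j th `^ e * Gamma (c j - e) / Gamma (c j))%:E)%E.
Proof.
move=> reg ej; have h i : 0 < d i th by move/forallP : reg; exact.
pose g i v := ig_pdf (c i) (d i th) v * (if i == j then v `^ e else 1).
have mg i : measurable_fun setT (g i).
  apply: measurable_funM; first exact: mig.
  by case: (i == j) => //; exact: measurable_powR.
have g0 i v : 0 <= g i v.
  by apply: mulr_ge0; [exact: ig_pdf_ge0|case: ifP => _ //; exact: powR_ge0].
transitivity (\int[lam]_s (\prod_i g i (tnth s i))%:E)%E.
  apply: eq_integral => s _; congr EFin; rewrite /var_cond reg big_split/=; congr (_ * _).
  rewrite (bigD1 j)//= eqxx big1 ?mulr1// => i /negbTE ij; by rewrite ij.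
rewrite integral_lebesgue_vec_prod// (bigD1 j)//= big1.
  by rewrite mule1; under eq_integral do rewrite /g eqxx; exact: ig_moment.
move=> i /negbTE ij; under eq_integral do rewrite /g ij mulr1.
exact: integral_ig_pdf.
Qed.

Let mcsg th : measurable_fun setT (fun s => var_cond s th).
Proof. exact: (measurableT_comp measurable_var_cond (pair1_measurable th)). Qed.

Let mcth s : measurable_fun setT (fun th => theta_cond th s).
Proof. exact: (measurableT_comp measurable_theta_cond (pair2_measurable s)). Qed.

Let mu := (nu \x lam)%E.

Lemma integral_gibbs_kernel x (h : Theta -> Rvec R n -> R) :
  measurable_fun setT (fun z : T => h z.1 z.2) -> (forall th s, 0 <= h th s) -> posvec x.2 ->
  (\int[mu]_z (gibbs_kernel z x * h z.1 z.2)%:E =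
   \int[nu]_th ((theta_cond th x.2)%:E * \int[lam]_s (var_cond s th * h th s)%:E))%E.
Proof.
move=> mh h0 px.
have kE z : gibbs_kernel z x * h z.1 z.2 = theta_cond z.1 x.2 * (var_cond z.2 z.1 * h z.1 z.2).
  rewrite /gibbs_kernel (pos1 px) mulr1; have [pz|pz] := pselect (posvec z.2).
    by rewrite pos1// mulr1 [var_cond _ _ * _]mulrC mulrA.
  by rewrite var_cond0// !mul0r mulr0.
have mch : measurable_fun setT (fun z : T => var_cond z.2 z.1 * h z.1 z.2).
  by apply: measurable_funM => //; exact: measurable_var_cond.
have mf : measurable_fun setT (fun z : T => (theta_cond z.1 x.2 * (var_cond z.2 z.1 * h z.1 z.2))%:E).
  apply/measurable_EFinP; apply: measurable_funM => //.
  exact: (measurableT_comp (mcth x.2) measurable_fst).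
have c0' th : 0 <= theta_cond th x.2 by rewrite ltW// theta_cond_gt0.
have f0 (z : T) : (0 <= (theta_cond z.1 x.2 * (var_cond z.2 z.1 * h z.1 z.2))%:E)%E.
  by rewrite lee_fin mulr_ge0// mulr_ge0// var_cond_ge0.
under eq_integral do rewrite kE.
rewrite /mu (@fubini_tonelli1 _ _ _ _ _ nu lam _ mf f0).
apply: eq_integral => th _; rewrite /fubini_F/=.
under eq_integral do rewrite EFinM.
apply: (ge0_integralZl _ measurableT _ _ _).
- apply/measurable_EFinP; exact: (measurableT_comp mch (pair1_measurable th)).
- by move=> s _; rewrite lee_fin mulr_ge0// var_cond_ge0.
- by rewrite lee_fin.
Qed.

Lemma integral_theta_cond s : posvec s -> (\int[nu]_th (theta_cond th s)%:E = 1)%E.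
Proof.
move=> ps; have m0 := fine_mass_gt0 ps.
transitivity (\int[nu]_th ((fine (energy_mass s))^-1%:E * (energy th s)%:E))%E.
  by apply: eq_integral => th _; rewrite /theta_cond mulrC EFinM.
rewrite ge0_integralZl//.
- by rewrite -/(energy_mass s) massE// -EFinM mulVf// gt_eqF.
- apply/measurable_EFinP; exact: (measurableT_comp measurable_energy (pair2_measurable s)).
- by move=> th _; rewrite lee_fin ltW// energy_gt0.
- by rewrite lee_fin invr_ge0 ltW.
Qed.

Lemma integral_gibbs_kernel1 x : posvec x.2 -> (\int[mu]_z (gibbs_kernel z x)%:E = 1)%E.
Proof.
move=> px; have := @integral_gibbs_kernel x (fun _ _ => 1) _ _ px.
under eq_integral do rewrite mulr1.
move=> -> //; rewrite -[RHS](integral_theta_cond px); apply: eq_integral => th _.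
by under eq_integral do rewrite mulr1; rewrite integral_var_cond mule1.
Qed.

Lemma ae_regular : {ae nu, forall th, regular th}.
Proof.
have h : {ae nu, forall th, forall j, 0 < d j th}.
  apply: filter_forall => j; apply: negligibleS (dnull j) => th /= /negP.
  by rewrite -leNgt => dj; apply/eqP; rewrite eq_le dj d_ge0.
by apply: filterS h => th h; exact/forallP.
Qed.

(** Given [th], the new variance is inverse gamma with scale [d j th], whose moments
    are explicit; there remains a moment of [d j th] given the old variances. *)
Lemma gibbs_kernel_moment x j e : posvec x.2 -> e < c j ->
  (\int[mu]_z (gibbs_kernel z x * (tnth z.2 j : R) `^ e)%:E =
   (Gamma (c j - e) / Gamma (c j))%:E * \int[nu]_th (theta_cond th x.2 * d j th `^ e)%:E)%E.
Proof.
move=> px ej.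
have md' : measurable_fun setT (fun th => d j th `^ e).
  exact: (measurableT_comp (measurable_powR e) (md j)).
rewrite (@integral_gibbs_kernel x (fun _ s => (tnth s j : R) `^ e))//; last 2 first.
- apply: (measurableT_comp (measurable_powR e)).
  exact: (measurableT_comp (measurable_tnth j) measurable_snd).
- by move=> _ s; exact: powR_ge0.
rewrite -ge0_integralZl//; last 3 first.
- by apply/measurable_EFinP; apply: measurable_funM.
- by move=> th _; rewrite lee_fin mulr_ge0 ?powR_ge0// ltW// theta_cond_gt0.
- by rewrite lee_fin divr_ge0// ltW// Gamma_gt0// subr_gt0.
apply: ae_eq_integral => //.
- apply: emeasurable_funM; first exact/measurable_EFinP.
  have mch : measurable_fun setT (fun z : T => (var_cond z.2 z.1 * (tnth z.2 j : R) `^ e)%:E).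
    apply/measurable_EFinP; apply: measurable_funM; first exact: measurable_var_cond.
    apply: (measurableT_comp (measurable_powR e)).
    exact: (measurableT_comp (measurable_tnth j) measurable_snd).
  have h0 (z : T) : (0 <= (var_cond z.2 z.1 * (tnth z.2 j : R) `^ e)%:E)%E.
    by rewrite lee_fin mulr_ge0 ?powR_ge0// var_cond_ge0.
  exact: (@measurable_fun_fubini_tonelli_F _ _ _ _ _ lam _ mch h0).
- by apply: emeasurable_funM => //; apply/measurable_EFinP; apply: measurable_funM.
- apply: filterS ae_regular => th reg _; rewrite var_cond_moment// -!EFinM; congr EFin.
  by rewrite mulrCA mulrA -mulrA mulrCA mulrC; ring.
Qed.

Lemma joint_density_ge0 th s : 0 <= joint_density th s.
Proof.
rewrite mulr_ge0 ?pos_ge0// mulr_ge0 ?(ltW kap0)// prodr_ge0// => j _.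
by rewrite mulr_ge0 ?powR_ge0// expR_ge0.
Qed.

Lemma joint_density0 th s : ~ posvec s -> joint_density th s = 0.
Proof. by move=> ps; rewrite /joint_density pos0// mulr0. Qed.

Lemma jointE th s : posvec s ->
  joint_density th s = kap * \prod_j (tnth s j : R) `^ (- c j - 1) * energy th s.
Proof.
move=> ps; rewrite /joint_density pos1// mulr1 big_split/= mulrA; congr (_ * _).
by rewrite /energy -sumrN expR_sum.
Qed.

Lemma joint_density_gt0 th s : posvec s -> 0 < joint_density th s.
Proof.
move=> ps; rewrite jointE// mulr_gt0 ?energy_gt0// mulr_gt0//.
by apply: prodr_gt0 => j _; rewrite powR_gt0.
Qed.

Lemma measurable_joint_density : measurable_fun setT (fun z : T => joint_density z.1 z.2).
Proof.
have mt j : measurable_fun setT (fun z : T => tnth z.2 j : R).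
  exact: (measurableT_comp (measurable_tnth j) measurable_snd).
apply: measurable_funM; last exact: (measurableT_comp measurable_pos measurable_snd).
apply: measurable_funM => //; apply: measurable_prod => j _; apply: measurable_funM.
  exact: (measurableT_comp (measurable_powR _)).
apply: measurableT_comp => //; apply: measurableT_comp => //; apply: measurable_funM.
  exact: (measurableT_comp (md j) measurable_fst).
exact: (measurableT_comp (@measurable_invr R)).
Qed.

Definition joint_density_mass th : R := kap * \prod_j (d j th `^ (- c j) * Gamma (c j)).

Lemma integral_joint_density_var th : regular th ->
  (\int[lam]_s (joint_density th s)%:E = (joint_density_mass th)%:E)%E.
Proof.
move=> reg; have h i : 0 < d i th by move/forallP : reg; exact.
pose g i (v : R) := (v `^ (- c i - 1) * expR (- (d i th / v))) * \1_(`]0, +oo[%classic : set R) v.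
have mg i : measurable_fun setT (g i).
  apply: measurable_funM; last exact: measurable_indic.
  apply: measurable_funM; first exact: measurable_powR.
  apply: measurableT_comp => //; apply: measurableT_comp => //; apply: measurable_funM => //.
  exact: measurable_invr.
have g0 i v : 0 <= g i v by rewrite !mulr_ge0 ?powR_ge0 ?expR_ge0.
have posE s : pos s = \prod_j \1_(`]0, +oo[%classic : set R) (tnth s j).
  have [ps|ps] := pselect (posvec s).
    by rewrite pos1// big1// => j _; rewrite indicE mem_set//= in_itv/= andbT; exact: ps.
  rewrite pos0//; have [j sj] : exists j, ~ (0 < (tnth s j : R)) by exact/existsNP.
  by rewrite (bigD1 j)//= indicE memNset ?mul0r//= in_itv/= andbT.
transitivity (\int[lam]_s (kap%:E * (\prod_i g i (tnth s i))%:E))%E.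
  by apply: eq_integral => s _; rewrite /joint_density posE -mulrA -big_split EFinM.
rewrite ge0_integralZl//; last 3 first.
- apply/measurable_EFinP; apply: measurable_prod => i _.
  exact: (measurableT_comp (mg i) (measurable_tnth i)).
- by move=> s _; rewrite lee_fin prodr_ge0.
- by rewrite lee_fin ltW.
have -> := integral_lebesgue_vec_prod mg g0.
rewrite /joint_density_mass EFinM -prodEFin; congr (_ * _)%E.
apply: eq_bigr => j _; rewrite -integral_inv_gamma_kernel// [RHS]integral_mkcond.
by apply: eq_integral => v _; rewrite patchE/g indicE; case: ifP; rewrite ?mulr1 ?mulr0.
Qed.

Lemma var_cond_joint_density_mass th s : regular th -> posvec s -> var_cond s th * joint_density_mass th = joint_density th s.
Proof.
move=> reg ps; have h i : 0 < d i th by move/forallP : reg; exact.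
rewrite /var_cond reg /joint_density_mass mulrCA -big_split /joint_density pos1// mulr1; congr (_ * _).
apply: eq_bigr => j _ /=; rewrite ig_pdfE// powRN.
by field; rewrite !gt_eqF ?Gamma_gt0 ?powR_gt0.
Qed.

(** The joint density is a function of [s] times [theta_cond], and almost everywhere
    a function of [th] times [var_cond]; each half of the step preserves it. *)
Lemma gibbs_kernel_invariant :
  ae_eq mu setT (fun z => \int[mu]_x (gibbs_kernel z x * joint_density x.1 x.2)%:E)%E
    (EFin \o (fun z => joint_density z.1 z.2)).
Proof.
have reg : {ae mu, forall z, regular z.1}.
  have [A [mA nuA sA]] := ae_regular.
  exists (A `*` setT); split.
  - exact: measurableX.
  - by have := product_measure1E nu lam mA measurableT; rewrite [X in (_ = X * _)%E]nuA mul0e.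
  - by move=> z nz; split => //; exact: sA.
apply: filterS reg => z reg _.
have jE (x : T) : gibbs_kernel z x * joint_density x.1 x.2 =
    (var_cond z.2 z.1 * pos z.2) * (theta_cond z.1 x.2 * joint_density x.1 x.2).
  have [px|px] := pselect (posvec x.2); last by rewrite joint_density0// !mulr0.
  by rewrite /gibbs_kernel (pos1 px); ring.
have mf : measurable_fun setT (fun x : T => (theta_cond z.1 x.2 * joint_density x.1 x.2)%:E).
  apply/measurable_EFinP; apply: measurable_funM; last exact: measurable_joint_density.
  apply: (measurableT_comp (f := fun s => theta_cond z.1 s)); last exact: measurable_snd.
  exact: (measurableT_comp measurable_theta_cond (pair1_measurable z.1)).
have ctj th s : 0 <= theta_cond z.1 s * joint_density th s.
  have [px|px] := pselect (posvec s); last by rewrite joint_density0// mulr0.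
  by rewrite mulr_ge0 ?joint_density_ge0// ltW// theta_cond_gt0.
have f0 (x : T) : (0 <= (theta_cond z.1 x.2 * joint_density x.1 x.2)%:E)%E by rewrite lee_fin.
under eq_integral do rewrite jE EFinM.
rewrite (ge0_integralZl _ measurableT mf)//; last first.
  by rewrite lee_fin mulr_ge0 ?pos_ge0 ?var_cond_ge0.
rewrite /mu (@fubini_tonelli2 _ _ _ _ _ nu lam _ mf f0).
transitivity ((var_cond z.2 z.1 * pos z.2)%:E * \int[lam]_s (joint_density z.1 s)%:E)%E.
  congr (_ * _)%E; apply: eq_integral => s _; rewrite /fubini_G/=.
  have [ps|ps] := pselect (posvec s); last first.
    rewrite joint_density0//; under eq_integral do rewrite joint_density0// mulr0.
    by rewrite integral0.
  pose K := kap * \prod_j (tnth s j : R) `^ (- c j - 1).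
  have K0 : 0 <= theta_cond z.1 s * K.
    rewrite mulr_ge0 ?(ltW (theta_cond_gt0 _ ps))// mulr_ge0 ?(ltW kap0)//.
    by rewrite prodr_ge0// => j _; rewrite powR_ge0.
  transitivity (\int[nu]_th ((theta_cond z.1 s * K)%:E * (energy th s)%:E))%E.
    by apply: eq_integral => th _; rewrite jointE// -EFinM mulrA.
  rewrite ge0_integralZl//.
  - rewrite -/(energy_mass s) massE// -EFinM jointE//; congr EFin.
    rewrite /theta_cond -/K; field; by rewrite gt_eqF ?fine_mass_gt0.
  - apply/measurable_EFinP; exact: (measurableT_comp measurable_energy (pair2_measurable s)).
  - by move=> th _; rewrite lee_fin ltW// energy_gt0.
rewrite integral_joint_density_var// -EFinM /=; congr EFin.
have [ps|ps] := pselect (posvec z.2); last by rewrite joint_density0// pos0// mulr0 mul0r.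
by rewrite pos1// mulr1 var_cond_joint_density_mass.
Qed.

Let cst_vec (v : R) : Rvec R n := [tuple v | _ < n].

Let tnth_cst v j : tnth (cst_vec v) j = v. Proof. by rewrite tnth_mktuple. Qed.

Lemma energy_le th s s' : (forall j, 0 < (tnth s j : R) <= tnth s' j) ->
  energy th s <= energy th s'.
Proof.
move=> ss'; rewrite /energy ler_expR lerN2; apply: ler_sum => j _.
have /andP[s0 sj] := ss' j; rewrite ler_wpM2l ?d_ge0// lef_pV2// posrE//.
exact: lt_le_trans sj.
Qed.

Variables (V : T -> R) (gam K : R).
Hypothesis mV : measurable_fun setT V.
Hypothesis V0 : forall x, 0 <= V x.
Hypothesis drift : forall x, posvec x.2 ->
  (\int[mu]_z (gibbs_kernel z x * V z)%:E <= (gam * V x + K)%:E)%E.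
Hypothesis (gam0 : 0 <= gam) (gam1 : gam < 1) (K0 : 0 <= K).
Hypothesis boxes : forall rho, exists lo hi, [/\ 0 < lo, lo <= hi &
  forall x, posvec x.2 -> V x <= rho -> forall j, lo <= (tnth x.2 j : R) <= hi].

Let S : set T := setT `*` @posvec R n.

Let gibbs_kernel0 z x : 0 <= gibbs_kernel z x.
Proof.
have [px|px] := pselect (posvec x.2); last by rewrite /gibbs_kernel (pos0 px) mulr0.
have c1 := ltW (theta_cond_gt0 z.1 px).
by apply: mulr_ge0 => //; apply: mulr_ge0 => //; apply: mulr_ge0 => //; exact: var_cond_ge0.
Qed.

Let kernS z x : ~ (S z /\ S x) -> gibbs_kernel z x = 0.
Proof.
move=> h; rewrite /gibbs_kernel; have [px|px] := pselect (posvec x.2); last by rewrite (pos0 px) mulr0.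
have [pz|pz] := pselect (posvec z.2); last by rewrite (pos0 pz) mulr0 mul0r.
by exfalso; apply: h.
Qed.

(** On a box for the variances, the joint density is at most a multiple of
    [energy th hi], which is integrable in [th]. *)
Let floc rho : (\int[mu]_(x in [set x | (V x <= rho)%R]) (joint_density x.1 x.2)%:E < +oo)%E.
Proof.
have [lo [hi [lo0 lohi hb]]] := boxes rho.
pose box : set (Rvec R n) := [set s | forall j, (`[lo, hi]%classic : set (measurableTypeR R)) (tnth s j)].
have mbox : measurable box.
  rewrite [X in measurable X](_ : _ =
    \bigcap_(i in setT) (@tnth n _ ^~ i @^-1` `[lo, hi]%classic)).
    apply: fin_bigcap_measurable => // i _.
    by rewrite -[X in measurable X]setTI; exact: measurable_tnth.
  by apply/seteqP; split => s + i; [move=> h _; exact: h|move=> h; exact: h].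
have lbox : (lam box < +oo)%E.
  rewrite /box (@lebesgue_vec_box R n (fun=> `[lo, hi]%classic))//.
  suff /andP[_ h] : (0 <= \prod_(i < n) lebesgue_measure (`[lo, hi]%classic : set (measurableTypeR R)) < +oo)%E by exact: h.
  apply: (big_ind (fun e : \bar R => is_true (0 <= e < +oo)%E)).
  - by rewrite lee01 ltry.
  - by move=> a b /andP[a0 a1] /andP[b0 b1]; rewrite mule_ge0// lte_mul_pinfty// ge0_fin_numE.
  - move=> j _; rewrite measure_ge0/= lebesgue_measure_itv/=; case: ifP => // _.
    by rewrite -EFinB ltry.
pose C := kap * \prod_j lo `^ (- c j - 1).
have C0 : 0 <= C by rewrite mulr_ge0 ?(ltW kap0)// prodr_ge0// => j _; rewrite powR_ge0.
have phi : posvec (cst_vec hi) by move=> j; rewrite tnth_cst; exact: lt_le_trans lohi.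
have mE : measurable_fun setT (fun th => (C * energy th (cst_vec hi))%:E).
  apply/measurable_EFinP; apply: measurable_funM => //.
  exact: (measurableT_comp measurable_energy (pair2_measurable _)).
have mg : measurable_fun setT (fun x : T => (C * energy x.1 (cst_vec hi) * \1_box x.2)%:E).
  apply/measurable_EFinP; apply: measurable_funM.
    apply/measurable_EFinP; exact: (measurableT_comp mE measurable_fst).
  exact: (measurableT_comp (measurable_indic mbox) measurable_snd).
have g0 (x : T) : (0 <= (C * energy x.1 (cst_vec hi) * \1_box x.2)%:E)%E.
  by rewrite lee_fin mulr_ge0// mulr_ge0// ltW// energy_gt0.
have mj : measurable_fun setT (fun x : T => (joint_density x.1 x.2)%:E).
  by apply/measurable_EFinP; exact: measurable_joint_density.
apply: (@le_lt_trans _ _ (\int[mu]_x (C * energy x.1 (cst_vec hi) * \1_box x.2)%:E)%E).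
  have mVr : measurable [set x | (V x <= rho)%R].
    rewrite [X in measurable X](_ : _ = V @^-1` `]-oo, rho]).
      by rewrite -[X in measurable X]setTI; exact: mV.
    by apply/seteqP; split => x /=; rewrite in_itv.
  rewrite [leLHS]integral_mkcond; apply: ge0_le_integral => //.
  - by move=> x _; rewrite patchE; case: ifP => // _; rewrite lee_fin joint_density_ge0.
  - by apply/(measurable_restrictT _ mVr); exact: measurable_funTS.
  move=> x _; rewrite patchE; case: ifPn => [/set_mem/= xr|_]; last exact: g0.
  have [px|px] := pselect (posvec x.2); last by rewrite joint_density0//; exact: g0.
  have xb := hb _ px xr.
  rewrite lee_fin jointE// indicE mem_set/=; last by move=> j; rewrite /= in_itv/=; exact: xb.
  rewrite mulr1; apply: ler_pM.
  - by rewrite mulr_ge0 ?(ltW kap0)// prodr_ge0// => j _; rewrite powR_ge0.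
  - by rewrite ltW// energy_gt0.
  - rewrite /C ler_wpM2l ?(ltW kap0)//; apply: ler_prod => j _; rewrite powR_ge0/=.
    have /andP[lj _] := xb j; have cj : 0 <= c j + 1 by rewrite addr_ge0// ltW.
    have -> : - c j - 1 = - (c j + 1) by rewrite opprD.
    rewrite !powRN lef_pV2 ?posrE ?powR_gt0//; first exact: ge0_ler_powR (ltW _) (ltW _) lj.
  - by apply: energy_le => j; rewrite tnth_cst px; case/andP: (xb j).
rewrite /mu (@fubini_tonelli1 _ _ _ _ _ nu lam _ mg g0).
have mEh : measurable_fun setT (fun th => (energy th (cst_vec hi))%:E).
  apply/measurable_EFinP; exact: (measurableT_comp measurable_energy (pair2_measurable _)).
have CE0 th : (0 <= (C * energy th (cst_vec hi))%:E)%E.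
  by rewrite lee_fin mulr_ge0// ltW// energy_gt0.
have -> : (\int[nu]_th fubini_F lam (fun x : T => (C * energy x.1 (cst_vec hi) * \1_box x.2)%:E) th =
    lam box * (C * fine (energy_mass (cst_vec hi)))%:E)%E.
  transitivity (\int[nu]_th ((lam box) * (C * energy th (cst_vec hi))%:E))%E.
    apply: eq_integral => th _; rewrite /fubini_F/=; under eq_integral do rewrite EFinM.
    have m1 : measurable_fun setT (fun s => (\1_box s : R)%:E).
      by apply/measurable_EFinP; exact: measurable_indic.
    rewrite (ge0_integralZl _ measurableT m1)//.
    by rewrite integral_indic// setIT muleC.
  rewrite (ge0_integralZl _ measurableT mE)//; congr (_ * _)%E.
  under eq_integral do rewrite EFinM.
  rewrite (ge0_integralZl _ measurableT mEh)//.
  - by rewrite -/(energy_mass _) massE.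
  - by move=> th _; rewrite lee_fin ltW// energy_gt0.
by rewrite muleC lte_mul_pinfty// lee_fin mulr_ge0// ltW// fine_mass_gt0.
Qed.

(** On a box for the variances, the density of [th] is at least [energy th lo]
    divided by the mass at [hi]. *)
Let minor rho : exists g : T -> R,
  [/\ measurable_fun setT g, forall z, 0 <= g z, (0 < \int[mu]_z (g z)%:E)%E,
      (\int[mu]_z (g z)%:E < +oo)%E
    & forall x z, S x -> V x <= rho -> g z <= gibbs_kernel z x].
Proof.
have [lo [hi [lo0 lohi hb]]] := boxes rho.
have plo : posvec (cst_vec lo) by move=> j; rewrite tnth_cst.
have phi : posvec (cst_vec hi) by move=> j; rewrite tnth_cst; exact: lt_le_trans lohi.
have /set0P[th0 _] : (setT : set Theta) != set0.
  by apply: contra_neq nu0 => ->; rewrite measure0.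
pose C := fine (energy_mass (cst_vec lo)) / fine (energy_mass (cst_vec hi)).
have C0 : 0 < C by rewrite divr_gt0// fine_mass_gt0.
pose g z := C * gibbs_kernel z (th0, cst_vec lo).
have mk : measurable_fun setT (fun z => (gibbs_kernel z (th0, cst_vec lo))%:E).
  apply/measurable_EFinP; exact: (measurableT_comp measurable_gibbs_kernel (pair2_measurable _)).
have ig : (\int[mu]_z (g z)%:E = C%:E)%E.
  rewrite /g; under eq_integral do rewrite EFinM.
  rewrite (ge0_integralZl _ measurableT mk).
  - by rewrite integral_gibbs_kernel1// mule1.
  - by move=> z _; rewrite lee_fin.
  - by rewrite lee_fin ltW.
exists g; split.
- by apply: measurable_funM => //; exact/measurable_EFinP.
- by move=> z; rewrite mulr_ge0// ltW.
- by rewrite ig lte_fin.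
- by rewrite ig ltry.
move=> x z [_ px] xr; have xb := hb _ px xr.
have pE : gibbs_kernel z (th0, cst_vec lo) = var_cond z.2 z.1 * pos z.2 * theta_cond z.1 (cst_vec lo).
  by rewrite /gibbs_kernel/= (pos1 plo); ring.
have -> : gibbs_kernel z x = var_cond z.2 z.1 * pos z.2 * theta_cond z.1 x.2 by rewrite /gibbs_kernel (pos1 px); ring.
rewrite /g pE mulrCA; apply: ler_wpM2l; first by rewrite mulr_ge0 ?var_cond_ge0.
have -> : C * theta_cond z.1 (cst_vec lo) = energy z.1 (cst_vec lo) / fine (energy_mass (cst_vec hi)).
  have alg (u v w : R) : 0 < u -> u / v * (w / u) = w / v.
    by move=> u0; rewrite mulrACA mulrC mulrA mulfVK ?gt_eqF// mulrC.
  exact: alg (fine_mass_gt0 plo).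
rewrite /theta_cond; apply: ler_pM.
- by rewrite ltW// energy_gt0.
- by rewrite invr_ge0 ltW// fine_mass_gt0.
- by apply: energy_le => j; rewrite tnth_cst lo0; case/andP: (xb j).
rewrite lef_pV2 ?posrE; [|exact: fine_mass_gt0|exact: fine_mass_gt0].
rewrite -lee_fin -(massE px) -(massE phi).
apply: ge0_le_integral => //.
- by move=> th _; rewrite lee_fin ltW// energy_gt0.
- apply/measurable_EFinP; exact: (measurableT_comp measurable_energy (pair2_measurable _)).
- apply/measurable_EFinP; exact: (measurableT_comp measurable_energy (pair2_measurable _)).
- by move=> th _; rewrite lee_fin; apply: energy_le => j; rewrite tnth_cst px; case/andP: (xb j).
Qed.

Let fpos : (0 < \int[mu]_z (joint_density z.1 z.2)%:E)%E.
Proof.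
have mS : measurable S by apply: measurableX => //; exact: measurable_posvec.
have h : (0 < \int[mu]_(z in S) (joint_density z.1 z.2)%:E)%E.
  apply: integral_gt0 => //.
  - by apply: measurable_funTS; exact: measurable_joint_density.
  - by move=> z [_ pz]; exact: joint_density_gt0.
  - have e := product_measure1E nu lam measurableT (@measurable_posvec R n).
    have h : (nu setT * lam (@posvec R n) != 0)%E.
      by rewrite mule_eq0 negb_or nu0 lebesgue_vec_posvec_neq0.
    by rewrite -e in h; exact: h.
apply: (lt_le_trans h); apply: ge0_subset_integral => //.
- by apply/measurable_EFinP; exact: measurable_joint_density.
- by move=> z _; rewrite lee_fin joint_density_ge0.
Qed.

(** [boxes] bounds the variances only: the next state does not depend on the
    present [th]. *)
Theorem gibbs_core_geometric : (\int[mu]_z (joint_density z.1 z.2)%:E < +oo)%E /\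
  geometric_tv_bound mu S gibbs_kernel (fun A => \int[mu]_(z in A `&` S)
    (joint_density z.1 z.2 / fine (\int[mu]_z (joint_density z.1 z.2)%:E))%:E)%E.
Proof.
have k1 x : S x -> (\int[mu]_z (gibbs_kernel z x)%:E = 1)%E by move=> [_ px]; exact: integral_gibbs_kernel1.
have dr x : S x -> (\int[mu]_z (gibbs_kernel z x * V z)%:E <= (gam * V x + K)%:E)%E.
  by move=> [_ px]; exact: drift.
have j0 (z : T) : 0 <= joint_density z.1 z.2 by exact: joint_density_ge0.
have jS z : ~ S z -> joint_density z.1 z.2 = 0 by move=> nS; apply: joint_density0 => pz; exact: nS.
pose f (z : T) := joint_density z.1 z.2.
pose nu_lam : {sigma_finite_measure set T -> \bar R} := sigma_finite_product nu lam.
split.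
  apply: (@invariant_finite _ T R nu_lam S gibbs_kernel V f gam K) => //; last exact: gibbs_kernel_invariant.
- exact: measurable_gibbs_kernel.
- exact: measurable_joint_density.
apply: (@geometric_ergodicity _ T R nu_lam S gibbs_kernel V f gam K) => //; last exact: gibbs_kernel_invariant.
- exact: measurable_gibbs_kernel.
- exact: measurable_joint_density.
Qed.

End gibbs_core.

(** * A Lyapunov function for the variances *)

Section integral_bounds.
Context d (T : measurableType d) (R : realType).
Variable mu : {measure set T -> \bar R}.

Lemma le_integralD (f g : T -> R) a b :
  measurable_fun setT f -> measurable_fun setT g ->
  (forall z, 0 <= f z) -> (forall z, 0 <= g z) ->
  (\int[mu]_z (f z)%:E <= a%:E)%E -> (\int[mu]_z (g z)%:E <= b%:E)%E ->
  (\int[mu]_z (f z + g z)%:E <= (a + b)%:E)%E.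
Proof.
move=> mf mg f0 g0 fa gb; under eq_integral do rewrite EFinD.
have mfE : measurable_fun setT (fun z => (f z)%:E) by exact/measurable_EFinP.
have mgE : measurable_fun setT (fun z => (g z)%:E) by exact/measurable_EFinP.
rewrite ge0_integralD//; last 2 first.
- by move=> z _; rewrite lee_fin.
- by move=> z _; rewrite lee_fin.
by rewrite EFinD leeD.
Qed.

Lemma le_integralZ (f : T -> R) w a : measurable_fun setT f -> (forall z, 0 <= f z) -> 0 <= w ->
  (\int[mu]_z (f z)%:E <= a%:E)%E -> (\int[mu]_z (w * f z)%:E <= (w * a)%:E)%E.
Proof.
move=> mf f0 w0 fa; under eq_integral do rewrite EFinM.
have mfE : measurable_fun setT (fun z => (f z)%:E) by exact/measurable_EFinP.
have f0E z : setT z -> (0 <= (f z)%:E)%E by move=> _; rewrite lee_fin.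
have w0E : (0 <= w%:E)%E by rewrite lee_fin.
rewrite (ge0_integralZl _ measurableT mfE f0E w0E).
by rewrite EFinM lee_wpmul2l.
Qed.

Lemma le_integral_sum (I : finType) (f : I -> T -> R) (a : I -> R) :
  (forall i, measurable_fun setT (f i)) -> (forall i z, 0 <= f i z) ->
  (forall i, \int[mu]_z (f i z)%:E <= (a i)%:E)%E ->
  (\int[mu]_z (\sum_i f i z)%:E <= (\sum_i a i)%:E)%E.
Proof.
move=> mf f0 fa; under eq_integral do rewrite -sumEFin.
rewrite ge0_integral_sum//.
- by rewrite -sumEFin; apply: lee_sum => i _; exact: fa.
- by move=> i; exact/measurable_EFinP.
- by move=> i z _; rewrite lee_fin.
Qed.

End integral_bounds.

Section lyapunov.
Context dT (Theta : measurableType dT) (R : realType) (r : nat).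
Local Notation T := (Theta * Rvec R r.+1)%type.
Variables (A : R) (B s : 'I_r -> R).
Hypothesis A1 : 1 <= A.
Hypothesis B1 : forall i, 1 <= B i.
Hypothesis s0 : forall i, 0 < s i.

Let e0 : 'I_r.+1 := ord0.
Let e1 (i : 'I_r) : 'I_r.+1 := lift ord0 i.

(** Positive powers control large variances and negative powers small ones. The
    weights [A] and [B i] leave room for what the error variance contributes to
    the moments of the other variances. *)
Definition lyapunov_term (v : Rvec R r.+1) i : R :=
  A * (tnth v e0 : R) `^ 1 + (tnth v (e1 i) : R) `^ 1 + (tnth v (e1 i) : R) `^ (- s i) +
  B i * (tnth v e0 : R) `^ (- s i).

Definition lyapunov (x : T) : R := (\sum_i lyapunov_term x.2 i) * pos x.2.

Let A0 : 0 <= A. Proof. exact: le_trans A1. Qed.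
Let B0 i : 0 <= B i. Proof. exact: le_trans (B1 i). Qed.

Lemma lyapunov_term_ge0 v i : 0 <= lyapunov_term v i.
Proof. by rewrite /lyapunov_term !addr_ge0 ?powR_ge0// mulr_ge0 ?powR_ge0. Qed.

Lemma lyapunov_ge0 x : 0 <= lyapunov x.
Proof. by rewrite mulr_ge0 ?pos_ge0// sumr_ge0// => i _; exact: lyapunov_term_ge0. Qed.

Let mt j e : measurable_fun setT (fun v : Rvec R r.+1 => (tnth v j : R) `^ e).
Proof. exact: (measurableT_comp (measurable_powR e) (measurable_tnth j)). Qed.

Lemma measurable_lyapunov : measurable_fun setT lyapunov.
Proof.
apply: measurable_funM; last exact: (measurableT_comp (@measurable_pos R r.+1) measurable_snd).
apply: (measurableT_comp (f := fun v => \sum_i lyapunov_term v i)); last exact: measurable_snd.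
apply: measurable_sum => i.
by repeat apply: measurable_funD => //; apply: measurable_funM.
Qed.

(** A bound on [v] and on [v^-s] confines [v] to a compact subset of the positive
    reals. *)
Lemma lyapunov_boxes : (0 < r)%N -> forall rho, exists lo hi : R, [/\ 0 < lo, lo <= hi &
  forall x : T, posvec x.2 -> lyapunov x <= rho -> forall j, lo <= (tnth x.2 j : R) <= hi].
Proof.
move=> r0 rho; pose hi := Num.max rho 1; have hi1 : 1 <= hi by rewrite le_max lexx orbT.
have hi0 : 0 < hi by exact: lt_le_trans hi1.
pose lo := \big[Num.min/1]_(i < r) hi `^ (- (s i)^-1).
have lo1 : lo <= 1 by exact: bigmin_le_id.
have loi i : lo <= hi `^ (- (s i)^-1) by exact: bigmin_le.
exists lo, hi; split.
- by apply: lt_bigmin => // i _; rewrite powR_gt0.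
- exact: le_trans hi1.
move=> x px; rewrite /lyapunov pos1// mulr1 => Vr.
have termr i : lyapunov_term x.2 i <= hi.
  apply: (@le_trans _ _ rho); last by rewrite le_max lexx.
  apply: le_trans Vr; rewrite (bigD1 i)//= lerDl sumr_ge0// => k _.
  exact: lyapunov_term_ge0.
have inv_pow (v : R) i : 0 < v -> v `^ (- s i) <= hi -> lo <= v.
  move=> v0 vh; apply: (le_trans (loi i)).
  have -> : v = (v `^ (- s i)) `^ (- (s i)^-1).
    by rewrite -powRrM mulrNN divff ?gt_eqF// powRr1// ltW.
  rewrite (powRN hi) (powRN (v `^ _)) lef_pV2 ?posrE ?powR_gt0//.
  apply: ge0_ler_powR => //; rewrite ?nnegrE ?powR_ge0//; last exact: ltW.
  by rewrite invr_ge0 ltW.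
have terms i : [/\ (tnth x.2 e0 : R) <= hi, (tnth x.2 (e1 i) : R) <= hi,
    (tnth x.2 (e1 i) : R) `^ (- s i) <= hi & (tnth x.2 e0 : R) `^ (- s i) <= hi].
  have x0 := px e0; have xi := px (e1 i); have := termr i.
  rewrite /lyapunov_term !powRr1 ?(ltW x0) ?(ltW xi)//.
  have p1 := powR_ge0 (tnth x.2 (e1 i)) (- s i); have p2 := powR_ge0 (tnth x.2 e0) (- s i).
  have q1 : (tnth x.2 e0 : R) <= A * tnth x.2 e0 by rewrite ler_peMl// ltW.
  have q2 : (tnth x.2 e0 : R) `^ (- s i) <= B i * (tnth x.2 e0 : R) `^ (- s i).
    by rewrite ler_peMl.
  by move: x0 xi p1 p2 q1 q2; split; lra.
move=> j; case: (unliftP ord0 j) => [i|] ->.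
  have [_ h2 h3 _] := terms i; rewrite h2 andbT; apply: (inv_pow _ i) => //.
have [h1 _ _ h4] := terms (Ordinal r0); rewrite h1 andbT.
exact: (inv_pow _ (Ordinal r0)).
Qed.

Variables (mu : {measure set T -> \bar R}) (k : T -> T -> R).
Hypothesis mk : forall x, measurable_fun setT (fun z => k z x).
Hypothesis k0 : forall z x, 0 <= k z x.
Hypothesis kpos : forall z x, ~ posvec z.2 -> k z x = 0.
Variables (rhoe beta C1 C2 C3 C4 : R) (alpha rho D : 'I_r -> R) (gam : R).
Hypothesis C_ge0 : [/\ 0 <= C1, 0 <= C2, 0 <= C3 & 0 <= C4].

Local Notation moment x j e := (\int[mu]_z (k z x * (tnth z.2 j : R) `^ e)%:E)%E.

Hypothesis moment_e : forall x, posvec x.2 ->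
  (moment x e0 1 <= (rhoe * (tnth x.2 e0 : R) + C1)%:E)%E.
Hypothesis moment_u : forall x i, posvec x.2 ->
  (moment x (e1 i) 1 <=
    (alpha i * (\sum_l (tnth x.2 (e1 l) : R)) + beta * (tnth x.2 e0 : R) + C2)%:E)%E.
Hypothesis moment_uN : forall x i, posvec x.2 ->
  (moment x (e1 i) (- s i) <= (rho i * (tnth x.2 (e1 i) : R) `^ (- s i) +
    D i * (tnth x.2 e0 : R) `^ (- s i) + C3)%:E)%E.
Hypothesis moment_eN : forall x i, posvec x.2 -> (moment x e0 (- s i) <= C4%:E)%E.
Hypothesis gamA : A * rhoe + beta <= gam * A.
Hypothesis gam_alpha : \sum_i alpha i <= gam.
Hypothesis gam_rho : forall i, rho i <= gam.
Hypothesis gamB : forall i, D i <= gam * B i.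

(** The error variance enters the bounds on the moments of the others, through
    [beta] and [D], but they do not enter its own; so these terms can be absorbed
    in those of weights [A] and [B i], as expressed by [gamA] and [gamB]. *)
Lemma lyapunov_drift : exists2 K, 0 <= K & forall x, posvec x.2 ->
  (\int[mu]_z (k z x * lyapunov z)%:E <= (gam * lyapunov x + K)%:E)%E.
Proof.
have [C10 C20 C30 C40] := C_ge0.
exists (\sum_i (A * C1 + C2 + C3 + B i * C4)).
  by apply: sumr_ge0 => i _; rewrite !addr_ge0// mulr_ge0.
move=> x px.
pose f j e (z : T) := k z x * (tnth z.2 j : R) `^ e.
have f0 j e z : 0 <= f j e z by rewrite mulr_ge0 ?powR_ge0.
have mf j e : measurable_fun setT (f j e).
  apply: measurable_funM => //.
  exact: (measurableT_comp (mt j e) measurable_snd).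
pose g i z := A * f e0 1 z + f (e1 i) 1 z + f (e1 i) (- s i) z + B i * f e0 (- s i) z.
have kV z : k z x * lyapunov z = \sum_i g i z.
  have [pz|pz] := pselect (posvec z.2); last first.
    by rewrite kpos// mul0r big1// => i _; rewrite /g /f kpos// !mul0r !mulr0 !addr0.
  rewrite /lyapunov pos1// mulr1 mulr_sumr; apply: eq_bigr => i _.
  by rewrite /lyapunov_term /g /f; ring.
under eq_integral do rewrite kV.
have mA : measurable_fun setT (fun z => A * f e0 1 z) by apply: measurable_funM.
have mB i : measurable_fun setT (fun z => B i * f e0 (- s i) z) by apply: measurable_funM.
have bound i := le_integralD
  (measurable_funD (measurable_funD mA (mf (e1 i) 1)) (mf (e1 i) (- s i))) (mB i)
  (fun z => addr_ge0 (addr_ge0 (mulr_ge0 A0 (f0 _ _ z)) (f0 _ _ z)) (f0 _ _ z))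
  (fun z => mulr_ge0 (B0 i) (f0 _ _ z))
  (le_integralD (measurable_funD mA (mf (e1 i) 1)) (mf (e1 i) (- s i))
    (fun z => addr_ge0 (mulr_ge0 A0 (f0 _ _ z)) (f0 _ _ z)) (f0 _ _)
    (le_integralD mA (mf (e1 i) 1) (fun z => mulr_ge0 A0 (f0 _ _ z)) (f0 _ _)
      (le_integralZ (mf _ _) (f0 _ _) A0 (moment_e px)) (moment_u i px))
    (moment_uN i px))
  (le_integralZ (mf _ _) (f0 _ _) (B0 i) (moment_eN i px)).
have mg i : measurable_fun setT (g i).
  by repeat apply: measurable_funD => //.
have g0 i z : 0 <= g i z by rewrite !addr_ge0// mulr_ge0.
apply: (le_trans (le_integral_sum mg g0 bound)).
rewrite lee_fin /lyapunov pos1// mulr1.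
set su := \sum_l (tnth x.2 (e1 l) : R).
have su0 : 0 <= su by apply: sumr_ge0 => l _; exact: ltW.
apply: (@le_trans _ _ (\sum_i (gam * (A * (tnth x.2 e0 : R) + (tnth x.2 (e1 i) : R) `^ (- s i) +
    B i * (tnth x.2 e0 : R) `^ (- s i)) + alpha i * su + (A * C1 + C2 + C3 + B i * C4)))).
  apply: ler_sum => i _.
  have h1 : (A * rhoe + beta) * tnth x.2 e0 <= gam * A * tnth x.2 e0.
    by rewrite ler_wpM2r// ltW.
  have h2 : rho i * (tnth x.2 (e1 i) : R) `^ (- s i) <= gam * (tnth x.2 (e1 i) : R) `^ (- s i).
    by rewrite ler_wpM2r// powR_ge0.
  have h3 : D i * (tnth x.2 e0 : R) `^ (- s i) <= gam * B i * (tnth x.2 e0 : R) `^ (- s i).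
    by rewrite ler_wpM2r// powR_ge0.
  by move: h1 h2 h3; lra.
rewrite big_split/= lerD2r big_split/= -mulr_suml -mulr_sumr.
have -> : \sum_i lyapunov_term x.2 i = \sum_i (A * (tnth x.2 e0 : R) +
    (tnth x.2 (e1 i) : R) `^ (- s i) + B i * (tnth x.2 e0 : R) `^ (- s i)) + su.
  rewrite /su -big_split/=; apply: eq_bigr => i _; rewrite /lyapunov_term !powRr1; [ring|exact: ltW..].
by rewrite mulrDr lerD2l ler_wpM2r.
Qed.

End lyapunov.

(** * Densities of the mixed model *)

Section density.
Context (R : realType).

Lemma sqrt_exprn (v : R) k : 0 <= v -> Num.sqrt (v ^+ k) = v `^ (k%:R / 2).
Proof. by move=> v0; rewrite -powR12_sqrt ?exprn_ge0// -powR_mulrn// -powRrM. Qed.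

Lemma sqrt_prod (I : finType) (f : I -> R) : (forall i, 0 <= f i) ->
  Num.sqrt (\prod_i f i) = \prod_i Num.sqrt (f i).
Proof.
move=> f0; suff [] : 0 <= \prod_i f i /\ Num.sqrt (\prod_i f i) = \prod_i Num.sqrt (f i) by [].
elim/big_rec2 : _ => [|i x z _ [z0 zx]]; first by rewrite sqrtr1.
by rewrite mulr_ge0// sqrtrM// zx.
Qed.

Lemma sum_blocks r (q : 'I_r -> nat) (V : nmodType) (F : 'I_(\sum_i q i) -> V) :
  \sum_j F j = \sum_i \sum_k F (tagnat.Rank i k).
Proof.
rewrite [RHS]sig_big_dep/= (reindex _ tagnat.sig_bij_on)/=.
by apply: eq_bigr => j _; rewrite -[in LHS](tagnat.sig2K j).
Qed.

Lemma prod_blocks r (q : 'I_r -> nat) (F : 'I_(\sum_i q i) -> R) :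
  \prod_j F j = \prod_i \prod_k F (tagnat.Rank i k).
Proof.
rewrite [RHS]sig_big_dep/= (reindex _ tagnat.sig_bij_on)/=.
by apply: eq_bigr => j _; rewrite -[in LHS](tagnat.sig2K j).
Qed.

Lemma mvn_pdf_scalar n (x m : 'cV[R]_n) v : 0 < v ->
  mvn_pdf x m v%:M =
  (Num.sqrt ((2 * pi) ^+ n))^-1 * (expR (- (sqnorm (x - m) / v / 2)) / v `^ (n%:R / 2)).
Proof.
move=> v0; have v0' := ltW v0.
rewrite /mvn_pdf invmx_scalar det_scalar -scalemx1 -scalemxAr mulmx1 -scalemxAl mxE -sqnormE.
rewrite sqrtrM ?exprn_ge0 ?mulr_ge0 ?pi_ge0// (sqrt_exprn n v0') invfM.
by rewrite [v^-1 * _]mulrC mulrCA mulrA -mulrA.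
Qed.

Lemma invmx_diag n (d : 'rV[R]_n) : (forall j, d 0 j != 0) ->
  invmx (diag_mx d) = diag_mx (\row_j (d 0 j)^-1).
Proof.
move=> d0; have e : diag_mx d *m diag_mx (\row_j (d 0 j)^-1) = 1%:M.
  rewrite mulmx_diag -diag_const_mx; congr diag_mx; apply/rowP => j.
  by rewrite !mxE divff.
have [u _] := mulmx1_unit e.
by rewrite -[LHS]mulmx1 -e mulmxA mulVmx// mul1mx.
Qed.

Lemma mvn_pdf_diag n (x : 'cV[R]_n) (d : 'rV[R]_n) : (forall j, 0 < d 0 j) ->
  mvn_pdf x 0 (diag_mx d) = (Num.sqrt ((2 * pi) ^+ n))^-1 *
  \prod_j (expR (- (x j 0 ^+ 2 / d 0 j / 2)) / Num.sqrt (d 0 j)).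
Proof.
move=> d0; have dn j : d 0 j != 0 by rewrite gt_eqF.
rewrite /mvn_pdf invmx_diag// det_diag subr0.
rewrite sqrtrM ?exprn_ge0 ?mulr_ge0 ?pi_ge0// sqrt_prod; last by move=> j; exact: ltW.
rewrite big_split/= -expR_sum invfM prodfV mulrCA; congr (_ * (expR _ * _)).
rewrite sumrN -mulr_suml; congr (- (_ / 2)).
rewrite -mulmxA mul_diag_mx mxE; apply: eq_bigr => j _; rewrite !mxE.
by rewrite mulrCA mulrC expr2.
Qed.

(** Conjugacy: [k] normal observations with sum of squares [S] change the shape and
    scale of an inverse gamma law from [a] and [b] to [k/2 + a] and [b + S/2]. *)
Lemma inverse_gamma_factor (v S k a b : R) : 0 < v ->
  expR (- (S / v / 2)) / v `^ (k / 2) * (v `^ (- (a + 1)) * expR (- b / v)) =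
  v `^ (- (k / 2 + a) - 1) * expR (- ((b + S / 2) / v)).
Proof.
move=> v0.
have -> : - (k / 2 + a) - 1 = - (k / 2) + - (a + 1) by lra.
have -> : - ((b + S / 2) / v) = - (S / v / 2) + - b / v by field; rewrite gt_eqF.
rewrite powRD; last by rewrite (gt_eqF v0) ?implybT ?implyTb ?orbT.
by rewrite expRD (powRN v (k / 2)); ring.
Qed.

End density.

Section mixed.
Context (R : realType) (N p r : nat) (q : 'I_r -> nat).
Variables (X : 'M[R]_(N, p)) (Z : forall i, 'M[R]_(N, q i)) (y : 'cV[R]_N).
Variables (ae be : R) (a b : 'I_r -> R).

Local Notation sq := (\sum_i q i)%N.
Local Notation parT := (Rvec R (p + sq)).
Local Notation varT := (Rvec R r.+1).
Local Notation W := (Wmx X Z).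
Implicit Types (th : parT) (s : varT).

(** Index [ord0] is for the error variance, [lift ord0 i] for that of block [i]. *)
Definition ig_shape (j : 'I_r.+1) : R :=
  if unlift ord0 j is Some i then (q i)%:R / 2 + a i else N%:R / 2 + ae.

Definition ig_scale (j : 'I_r.+1) th : R :=
  if unlift ord0 j is Some i then b i + sqnorm (rand_eff_block th i) / 2
  else be + sqnorm (y - W *m col_of th) / 2.

Definition normalization : R :=
  (Num.sqrt ((2 * pi) ^+ N))^-1 * (Num.sqrt ((2 * pi) ^+ sq))^-1.

Lemma ig_shape0 : ig_shape ord0 = N%:R / 2 + ae. Proof. by rewrite /ig_shape unlift_none. Qed.
Lemma ig_shapeS i : ig_shape (lift ord0 i) = (q i)%:R / 2 + a i. Proof. by rewrite /ig_shape liftK. Qed.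
Lemma ig_scale0 th : ig_scale ord0 th = be + sqnorm (y - W *m col_of th) / 2.
Proof. by rewrite /ig_scale unlift_none. Qed.
Lemma ig_scaleS i th : ig_scale (lift ord0 i) th = b i + sqnorm (rand_eff_block th i) / 2.
Proof. by rewrite /ig_scale liftK. Qed.

Lemma rand_effE th j : rand_eff th j 0 = tnth th (rshift p j).
Proof. by rewrite !mxE. Qed.

Lemma rand_eff_blockE th i k : rand_eff_block th i k 0 = tnth th (rshift p (tagnat.Rank i k)).
Proof. by rewrite !mxE. Qed.

Lemma DmxE s : Dmx q s = diag_mx (\row_j var_u s (tagnat.sig1 j)).
Proof.
rewrite /Dmx; have -> : \row_j var_u s (tagnat.sig1 j) = \mxrow_i const_mx (var_u s i) :> 'rV_sq.
  by apply/rowP => j; rewrite !mxE.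
by rewrite diag_mxrow; apply: eq_mxdiag => i; rewrite diag_const_mx.
Qed.

Lemma sqnorm_rand_eff_block th i :
  sqnorm (rand_eff_block th i) = \sum_k rand_eff th (tagnat.Rank i k) 0 ^+ 2.
Proof. by apply: eq_bigr => k _; rewrite rand_effE rand_eff_blockE. Qed.

Lemma upostE th s : upost X Z y ae be a b th s = joint_density ig_shape ig_scale normalization th s.
Proof.
have [ps|ps] := pselect (posvec s); last first.
  by rewrite joint_density0// /upost /prior indicE memNset// !mulr0.
have v0 : 0 < var_e s by exact: ps.
have vi i : 0 < var_u s i by exact: ps.
rewrite /upost /prior indicE mem_set// mulr1 mvn_pdf_scalar// DmxE mvn_pdf_diag; last first.
  by move=> j; rewrite mxE.
rewrite prod_blocks/=.
have -> : \prod_i \prod_k (expR (- (rand_eff th (tagnat.Rank i k) 0 ^+ 2 /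
    (\row_j var_u s (tagnat.sig1 j)) 0 (tagnat.Rank i k) / 2)) /
    Num.sqrt ((\row_j var_u s (tagnat.sig1 j)) 0 (tagnat.Rank i k))) =
  \prod_i (expR (- (sqnorm (rand_eff_block th i) / var_u s i / 2)) / var_u s i `^ ((q i)%:R / 2)).
  apply: eq_bigr => i _.
  under eq_bigr do rewrite mxE tagnat.Rank1K.
  rewrite big_split/= -expR_sum prodr_const card_ord; congr (expR _ * _).
    by rewrite sumrN -!mulr_suml -sqnorm_rand_eff_block.
  rewrite exprVn -powR12_sqrt ?(ltW (vi i))// -powR_mulrn ?powR_ge0// -powRrM.
  by rewrite [2^-1 * _]mulrC.
rewrite /joint_density (pos1 ps) mulr1 big_ord_recl/= -/(var_e s) ig_shape0 ig_scale0 -(inverse_gamma_factor _ N%:R ae be v0).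
have -> : \prod_(i < r) ((tnth s (lift ord0 i) : R) `^ (- ig_shape (lift ord0 i) - 1) *
    expR (- (ig_scale (lift ord0 i) th / tnth s (lift ord0 i)))) =
  \prod_i (expR (- (sqnorm (rand_eff_block th i) / var_u s i / 2)) / var_u s i `^ ((q i)%:R / 2) *
    (var_u s i `^ (- (a i + 1)) * expR (- b i / var_u s i))).
  by apply: eq_bigr => i _; rewrite ig_shapeS ig_scaleS inverse_gamma_factor.
rewrite [in RHS]big_split/= /normalization; ring.
Qed.

Local Notation lam := (@lebesgue_vec R (p + sq)).

(** The conditional law of [theta] is that of [gauss (design s) (target s)]: the
    upper rows come from the likelihood, the lower ones from the law of [u]. *)
Definition design s : 'M[R]_(N + sq, p + sq) :=
  col_mx ((Num.sqrt (var_e s))^-1 *: W)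
    (row_mx 0 (diag_mx (\row_j (Num.sqrt (var_u s (tagnat.sig1 j)))^-1))).

Definition target s : 'cV[R]_(N + sq) := col_mx ((Num.sqrt (var_e s))^-1 *: y) 0.

Lemma sqnorm_design_sub s (x : 'cV[R]_(p + sq)) c : posvec s ->
  sqnorm (design s *m x - col_mx ((Num.sqrt (var_e s))^-1 *: c) 0) =
  sqnorm (W *m x - c) / var_e s + \sum_j dsubmx x j 0 ^+ 2 / var_u s (tagnat.sig1 j).
Proof.
move=> ps; have v0 : 0 <= var_e s by rewrite ltW//; exact: ps.
rewrite /design mul_col_mx opp_col_mx add_col_mx sqnorm_block; congr (_ + _).
  by rewrite -scalemxAl -scalerBr sqnormZ exprVn sqr_sqrtr// mulrC.
rewrite -{1}(vsubmxK x) mul_row_col mul0mx add0r subr0 mul_diag_mx.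
by apply: eq_bigr => j _; rewrite !mxE exprMn exprVn sqr_sqrtr 1?mulrC// ltW//; exact: ps.
Qed.

Lemma sqnorm_design s (x : 'cV[R]_(p + sq)) : posvec s ->
  sqnorm (design s *m x) =
  sqnorm (W *m x) / var_e s + \sum_j dsubmx x j 0 ^+ 2 / var_u s (tagnat.sig1 j).
Proof.
move=> ps; have := sqnorm_design_sub x 0 ps.
by rewrite scaler0 col_mx0 !subr0.
Qed.

Lemma sqnorm_residual s (x : 'cV[R]_(p + sq)) : posvec s ->
  sqnorm (design s *m x - target s) =
  sqnorm (W *m x - y) / var_e s + \sum_j dsubmx x j 0 ^+ 2 / var_u s (tagnat.sig1 j).
Proof. exact: sqnorm_design_sub. Qed.

Lemma energy_gauss th s : posvec s ->
  energy ig_scale th s = expR (- (be / var_e s + \sum_i b i / var_u s i)) *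
    gauss (design s) (target s) th.
Proof.
move=> ps; rewrite /energy /gauss -expRD sqnorm_residual//; congr expR.
rewrite big_ord_recl/= ig_scale0 -opprD; congr (- _).
have -> : \sum_(i < r) ig_scale (lift ord0 i) th / tnth s (lift ord0 i) =
    \sum_i b i / var_u s i + (\sum_j dsubmx (col_of th) j 0 ^+ 2 / var_u s (tagnat.sig1 j)) / 2.
  rewrite sum_blocks mulr_suml -big_split/=; apply: eq_bigr => i _.
  under [in RHS]eq_bigr do rewrite tagnat.Rank1K.
  rewrite ig_scaleS sqnorm_rand_eff_block -mulr_suml -/(var_u s i).
  by rewrite mulrDl [_ / 2 / _]mulrAC.
by rewrite -(sqnormN (_ - y)) opprB -/(var_e s); ring.
Qed.

Lemma measurable_ig_scale j : measurable_fun setT (ig_scale j).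
Proof.
case: (unliftP ord0 j) => [i|] ->.
  have -> : ig_scale (lift ord0 i) = fun th : parT => b i +
      (\sum_k (tnth th (rshift p (tagnat.Rank i k)) : R) ^+ 2) / 2.
    apply/funext => th; rewrite ig_scaleS; congr (_ + _ / 2).
    by apply: eq_bigr => k _; rewrite rand_eff_blockE.
  apply: measurable_funD => //; apply: measurable_funM => //.
  apply: measurable_sum => k; apply: measurable_funX; exact: measurable_tnth.
have -> : ig_scale ord0 = fun th : parT => be + sqnorm (W *m col_of th - y) / 2.
  by apply/funext => th; rewrite ig_scale0 -sqnormN opprB.
by apply: measurable_funD => //; apply: measurable_funM => //; exact: measurable_sqnorm_affine.
Qed.

Lemma SSE_le th : SSE X Z y <= sqnorm (y - W *m col_of th).
Proof.
rewrite /SSE enorm_sqr.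
have QW := coproj_mul0 W; have Qt := coproj_tr W; have Qi := coproj_idem W.
set Q := 1%:M - orthoproj W; rewrite -/Q in QW Qt Qi; clearbody Q.
have -> : Q *m y = Q *m (y - W *m col_of th) by rewrite mulmxBr mulmxA QW mul0mx subr0.
exact: sqnorm_proj_le.
Qed.

(** The lower rows of a vector in the kernel give [u = 0], and then the upper ones
    give [X beta = 0]. *)
Lemma rank_design s : posvec s -> \rank X = p -> \rank (design s) = (p + sq)%N.
Proof.
move=> ps rX.
rewrite -mxrank_tr; apply/eqP; rewrite -/(row_free _) -kermx_eq0 -submx0.
apply/rV_subP => v /sub_kermxP vA; rewrite submx0 -trmx_eq0; apply/eqP.
have Av : design s *m v^T = 0 by rewrite -[design s]trmxK -trmx_mul vA trmx0.
have := sqnorm_design v^T ps; rewrite Av sqnorm0 => /esym/eqP.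
have wj j : 0 <= dsubmx v^T j 0 ^+ 2 / var_u s (tagnat.sig1 j).
  by rewrite divr_ge0 ?sqr_ge0// ltW//; exact: ps.
rewrite paddr_eq0 ?sumr_ge0//; last by rewrite divr_ge0 ?sqnorm_ge0// ltW//; exact: ps.
have ve0 : var_e s != 0 by rewrite gt_eqF//; exact: ps.
rewrite mulf_eq0 invr_eq0 (negbTE ve0) orbF => /andP[/eqP /sqnorm_eq0 Wv /eqP u0].
have du : dsubmx v^T = 0.
  apply/colP => j; rewrite [RHS]mxE; apply/eqP; rewrite -sqrf_eq0.
  have /eqP := psumr_eq0P (fun j _ => wj j) u0 (i := j) isT.
  by rewrite mulf_eq0 invr_eq0 (gt_eqF (ps _)) orbF.
move: Wv; rewrite -(vsubmxK v^T) du /Wmx mul_row_col mulmx0 addr0 => Xv.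
have -> : usubmx v^T = 0; last by rewrite col_mx0.
apply/trmx_inj; rewrite trmx0; apply/eqP; rewrite -submx0.
have /eqP <- : kermx X^T == 0 by rewrite kermx_eq0 /row_free mxrank_tr rX.
by apply/sub_kermxP; rewrite -trmx_mul Xv trmx0.
Qed.

End mixed.

Section identification.
Context (R : realType) (N p r : nat) (q : 'I_r -> nat).
Variables (X : 'M[R]_(N, p)) (Z : forall i, 'M[R]_(N, q i)) (y : 'cV[R]_N).
Variables (ae be : R) (a b : 'I_r -> R).

Local Notation sq := (\sum_i q i)%N.
Local Notation parT := (Rvec R (p + sq)).
Local Notation varT := (Rvec R r.+1).
Local Notation W := (Wmx X Z).
Local Notation lam := (@lebesgue_vec R (p + sq)).
Local Notation shp := (ig_shape N q ae a).
Local Notation scl := (ig_scale X Z y be b).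
Local Notation A := (design X Z).
Local Notation c := (target q y).
Implicit Types (th : parT) (s : varT).

Hypothesis rankX : \rank X = p.
Hypothesis b_ge0 : forall i, 0 <= b i.
Hypothesis q_gt0 : forall i, b i = 0 -> (0 < q i)%N.
Hypothesis be_gt0 : 0 < 2 * be + SSE X Z y.

Let delta : R := be + SSE X Z y / 2.

Lemma delta_gt0 : 0 < delta.
Proof.
have -> : delta = (2 * be + SSE X Z y) / 2 by rewrite /delta; field.
by rewrite divr_gt0.
Qed.

(** No fitted value leaves a residual sum of squares smaller than [SSE]. *)
Lemma ig_scale0_ge th : delta <= scl ord0 th.
Proof. by rewrite ig_scale0 /delta lerD2l ler_wpM2r// SSE_le. Qed.

Lemma ig_scaleS_ge i th : b i <= scl (lift ord0 i) th.
Proof. by rewrite ig_scaleS lerDl divr_ge0// sqnorm_ge0. Qed.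

Lemma ig_scale_ge0 j th : 0 <= scl j th.
Proof.
case: (unliftP ord0 j) => [i|] ->; first exact: le_trans (ig_scaleS_ge i th).
exact: le_trans (ltW delta_gt0) (ig_scale0_ge th).
Qed.

(** A vanishing scale means [b i = 0] and [u_i = 0], hence a point on a coordinate
    hyperplane. *)
Lemma ig_scale_negligible j : lam.-negligible [set th | scl j th = 0].
Proof.
case: (unliftP ord0 j) => [i|] ->; last first.
  rewrite (_ : [set _ | _] = set0); first exact: negligible_set0.
  apply/seteqP; split => // th /= h; have := ig_scale0_ge th.
  by rewrite h leNgt delta_gt0.
have [bi|bi] := eqVneq (b i) 0; last first.
  rewrite (_ : [set _ | _] = set0); first exact: negligible_set0.
  apply/seteqP; split => // th /= h; have := ig_scaleS_ge i th; rewrite h => bi0.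
  by move: bi; rewrite eq_le b_ge0 bi0.
have k0 : 'I_(q i) by exact: Ordinal (q_gt0 bi).
exists [set th : parT | tnth th (rshift p (tagnat.Rank i k0)) = 0]; split.
- rewrite [X in measurable X](_ : _ = (fun th : parT => tnth th (rshift p (tagnat.Rank i k0))) @^-1`
    ([set 0] : set (measurableTypeR R))); last by apply/seteqP; split.
  by rewrite -[X in measurable X]setTI; exact: measurable_tnth.
- exact: lebesgue_vec_hyperplane.
- move=> th /=; rewrite ig_scaleS bi add0r => /eqP; rewrite mulf_eq0 invr_eq0 pnatr_eq0 orbF.
  by move=> /eqP /sqnorm_eq0 h; rewrite -rand_eff_blockE h mxE.
Qed.

Lemma energy_mass_gauss s : posvec s -> energy_mass lam scl s =
  ((expR (- (be / var_e s + \sum_i b i / var_u s i)))%:E *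
    \int[lam]_th (gauss (A s) (c s) th)%:E)%E.
Proof.
move=> ps; rewrite /energy_mass.
under eq_integral do rewrite energy_gauss// EFinM.
rewrite ge0_integralZl//.
- by apply/measurable_EFinP; exact: measurable_gauss.
- by move=> th _; rewrite lee_fin gauss_ge0.
Qed.

Let Ai s : posvec s -> \rank (A s) = (p + sq)%N.
Proof. by move=> ps; exact: rank_design. Qed.

Lemma energy_mass_gt0 s : posvec s -> (0 < energy_mass lam scl s)%E.
Proof.
move=> ps; rewrite energy_mass_gauss// mule_gt0 ?lte_fin ?expR_gt0//.
exact: integral_gauss_gt0.
Qed.

Lemma energy_mass_lty s : posvec s -> (energy_mass lam scl s < +oo)%E.
Proof.
move=> ps; rewrite energy_mass_gauss// lte_mul_pinfty ?lee_fin ?expR_ge0//.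
exact: (integral_gauss_fin _ (Ai ps)).
Qed.

Lemma cond_thetaE th s : posvec s ->
  cond_theta X Z y ae be a b th s = theta_cond lam scl th s.
Proof.
move=> ps; rewrite /cond_theta upostE jointE//.
set K := normalization R N q * _.
have K0 : 0 < K.
  rewrite mulr_gt0//; last by apply: prodr_gt0 => j _; rewrite powR_gt0//; exact: ps.
  by rewrite mulr_gt0// invr_gt0 sqrtr_gt0 exprn_gt0// mulr_gt0// pi_gt0.
have -> : \int[lam]_t upost X Z y ae be a b t s = K * fine (energy_mass lam scl s).
  rewrite /Rintegral; transitivity (fine (K%:E * energy_mass lam scl s)%E).
    congr fine; rewrite /energy_mass -ge0_integralZl//.
    - by apply: eq_integral => t _; rewrite upostE jointE// -/K EFinM.
    - apply/measurable_EFinP.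
      exact: (measurableT_comp (measurable_energy (@measurable_ig_scale _ _ _ _ _ _ _ _ _ _)) (pair2_measurable s)).
    - by move=> t _; rewrite lee_fin ltW// energy_gt0.
    - by rewrite lee_fin ltW.
  by rewrite fineM// massE//; [exact: energy_mass_gt0|exact: energy_mass_lty].
rewrite /theta_cond; field.
by rewrite !gt_eqF ?fine_mass_gt0//; [exact: energy_mass_gt0|exact: energy_mass_lty].
Qed.

Lemma nullset_regular th :
  (th \in @nullset R p r q b) = ~~ regular scl th.
Proof.
have normE i : (enorm (rand_eff_block th i) == 0) = (sqnorm (rand_eff_block th i) == 0).
  by rewrite -enorm_sqr sqrf_eq0.
apply/idP/idP => [/set_mem/= /eqP|].
  rewrite prodf_seq_eq0 => /hasP[i _ /andP[/eqP bi]]; rewrite normE => /eqP ui.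
  apply/forallPn; exists (lift ord0 i).
  by rewrite ig_scaleS bi ui mul0r addr0 ltxx.
move=> /forallPn[j]; rewrite -leNgt; case: (unliftP ord0 j) => [i|] -> sj; last first.
  by have := lt_le_trans delta_gt0 (le_trans (ig_scale0_ge th) sj); rewrite ltxx.
apply/mem_set/eqP; rewrite prodf_seq_eq0; apply/hasP; exists i; first exact: mem_index_enum.
have := b_ge0 i; have := sqnorm_ge0 (rand_eff_block th i); rewrite normE.
move: sj; rewrite ig_scaleS => h1 h2 h3.
by apply/andP; split; apply/eqP; lra.
Qed.

Lemma cond_varE s th : cond_var X Z y ae be a b s th = var_cond shp scl s th.
Proof.
rewrite /cond_var nullset_regular /var_cond; case: (regular scl th) => /=.
  rewrite big_ord_recl ig_shape0 ig_scale0 -enorm_sqr; congr (_ * _).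
  by apply: eq_bigr => i _; rewrite ig_shapeS ig_scaleS -enorm_sqr.
by rewrite big_ord_recl.
Qed.

End identification.

(** * Moments of the effects given the variances *)

Section moments.
Context (R : realType).

(** The Cauchy-Schwarz inequality in the plane. *)
Lemma sqrrD_le (x y al be X Y : R) : 0 <= al -> 0 <= be -> 0 <= X -> 0 <= Y ->
  x ^+ 2 <= al * X -> y ^+ 2 <= be * Y -> (x + y) ^+ 2 <= (al + be) * (X + Y).
Proof.
move=> al0 be0 X0 Y0 xX yY.
have cross : 2 * (x * y) <= al * Y + be * X.
  apply: le_trans (ler_norm _) _; rewrite -ler_sqr ?nnegrE ?addr_ge0 ?mulr_ge0// real_normK ?num_real//.
  have h : x ^+ 2 * y ^+ 2 <= (al * X) * (be * Y) by rewrite ler_pM ?sqr_ge0.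
  have h2 : 0 <= (al * Y - be * X) ^+ 2 by exact: sqr_ge0.
  have -> : (2 * (x * y)) ^+ 2 = 4 * (x ^+ 2 * y ^+ 2) by ring.
  have -> : (al * Y + be * X) ^+ 2 = (al * Y - be * X) ^+ 2 + 4 * ((al * X) * (be * Y)) by ring.
  by move: h h2; lra.
have -> : (x + y) ^+ 2 = x ^+ 2 + y ^+ 2 + 2 * (x * y) by ring.
by move: xX yY cross; lra.
Qed.

Variables (N p r : nat) (q : 'I_r -> nat).
Variables (X : 'M[R]_(N, p)) (Z : forall i, 'M[R]_(N, q i)) (y : 'cV[R]_N).
Variables (be : R) (b : 'I_r -> R).

Local Notation sq := (\sum_i q i)%N.
Local Notation parT := (Rvec R (p + sq)).
Local Notation varT := (Rvec R r.+1).
Local Notation W := (Wmx X Z).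
Local Notation lam := (@lebesgue_vec R (p + sq)).
Local Notation scl := (ig_scale X Z y be b).
Local Notation A := (design X Z).
Local Notation c := (target q y).
Local Notation mean s := (gauss_mean (A s) (c s)).
Local Notation ct := (theta_cond lam scl).
Implicit Types (th : parT) (s : varT).

Hypothesis rankX : \rank X = p.

Let Ai s : posvec s -> \rank (A s) = (p + sq)%N.
Proof. by move=> ps; exact: rank_design. Qed.

Let mass s : R := fine (\int[lam]_th (gauss (A s) (c s) th)%:E).

Let massE s : posvec s -> (\int[lam]_th (gauss (A s) (c s) th)%:E = (mass s)%:E)%E.
Proof.
move=> ps; rewrite fineK// ge0_fin_numE; first exact: (integral_gauss_fin _ (Ai ps)).
by rewrite ltW// integral_gauss_gt0.
Qed.

Let mass_gt0 s : posvec s -> 0 < mass s.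
Proof. by move=> ps; rewrite -lte_fin -massE// integral_gauss_gt0. Qed.

Lemma theta_cond_gauss th s : posvec s -> ct th s = gauss (A s) (c s) th / mass s.
Proof.
move=> ps; rewrite /theta_cond energy_mass_gauss// massE// -EFinM /= energy_gauss//.
by field; rewrite !gt_eqF ?mass_gt0 ?expR_gt0.
Qed.

Lemma theta_cond_ge0 th s : posvec s -> 0 <= ct th s.
Proof. by move=> ps; rewrite theta_cond_gauss// divr_ge0 ?gauss_ge0// ltW// mass_gt0. Qed.

Lemma measurable_theta_cond_slice s : posvec s -> measurable_fun setT (fun th => ct th s).
Proof.
move=> ps; have -> : (fun th => ct th s) = fun th => gauss (A s) (c s) th / mass s.
  by apply/funext => th; exact: theta_cond_gauss.
by apply: measurable_funM => //; exact: measurable_gauss.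
Qed.

Lemma theta_cond_expectation (h : parT -> R) s B : posvec s -> measurable_fun setT h ->
  (forall th, 0 <= h th) ->
  (\int[lam]_th (h th * gauss (A s) (c s) th)%:E <=
    B%:E * \int[lam]_th (gauss (A s) (c s) th)%:E)%E ->
  (\int[lam]_th (ct th s * h th)%:E <= B%:E)%E.
Proof.
move=> ps mh h0; rewrite massE// => hB; have m0 := mass_gt0 ps.
have -> : (\int[lam]_th (ct th s * h th)%:E =
    \int[lam]_th ((mass s)^-1 * (h th * gauss (A s) (c s) th))%:E)%E.
  by apply: eq_integral => th _; rewrite theta_cond_gauss//; congr EFin; ring.
apply: le_trans (le_integralZ (a := B * mass s) _ _ _ _) _.
- by apply: measurable_funM => //; exact: measurable_gauss.
- by move=> th; rewrite mulr_ge0 ?gauss_ge0.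
- by rewrite invr_ge0 ltW.
- by rewrite EFinM.
- by rewrite lee_fin mulrC mulfK// gt_eqF.
Qed.

Lemma le_theta_cond_cst (h : parT -> R) s B : posvec s -> measurable_fun setT h ->
  (forall th, 0 <= h th <= B) -> (\int[lam]_th (ct th s * h th)%:E <= B%:E)%E.
Proof.
move=> ps mh h0B; have h0 th : 0 <= h th by case/andP: (h0B th).
apply: theta_cond_expectation => //.
rewrite -ge0_integralZl//; last 3 first.
- by apply/measurable_EFinP; exact: measurable_gauss.
- by move=> th _; rewrite lee_fin gauss_ge0.
- by rewrite lee_fin; case/andP: (h0B point) => /le_trans; exact.
apply: ge0_le_integral => //.
- by move=> th _; rewrite lee_fin mulr_ge0 ?gauss_ge0.
- by apply/measurable_EFinP; apply: measurable_funM => //; exact: measurable_gauss.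
- by apply/measurable_EFinP; apply: measurable_funM => //; exact: measurable_gauss.
- by move=> th _; rewrite -EFinM lee_fin ler_wpM2r ?gauss_ge0//; case/andP: (h0B th).
Qed.

(** The mean minimises the penalised sum of squares, and 0 is a competitor. *)
Lemma sqnorm_mean_residual s : posvec s -> sqnorm (W *m mean s - y) <= sqnorm y.
Proof.
move=> ps; have v0 : 0 < var_e s by exact: ps.
have h : sqnorm (A s *m mean s - c s) <= sqnorm (A s *m 0 - c s).
  by rewrite (sqnorm_gauss_mean (c s) (Ai ps) 0) lerDr sqnorm_ge0.
have w0 (x : 'cV[R]_(p + sq)) : 0 <= \sum_j dsubmx x j 0 ^+ 2 / var_u s (tagnat.sig1 j).
  by apply: sumr_ge0 => j _; rewrite divr_ge0 ?sqr_ge0// ltW//; exact: ps.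
move: h; rewrite !sqnorm_residual// mulmx0 sub0r sqnormN.
have -> : \sum_j dsubmx (0 : 'cV[R]_(p + sq)) j 0 ^+ 2 / var_u s (tagnat.sig1 j) = 0.
  by rewrite big1// => j _; rewrite !mxE expr0n/= mul0r.
rewrite addr0 => h; rewrite -(ler_pM2r (_ : 0 < (var_e s)^-1)) ?invr_gt0//.
by apply: le_trans h; rewrite lerDl.
Qed.

(** Row by row: a fitted value is the scalar product of [W theta] with a column
    of [P_W], so its conditional variance is at most [v_e] times the squared norm
    of this column. These squared norms add up to the rank. *)
Lemma expected_residual s : posvec s ->
  (\int[lam]_th (ct th s * sqnorm (y - W *m col_of th))%:E <=
    ((\rank W)%:R * var_e s + sqnorm y)%:E)%E.
Proof.
move=> ps; have v0 : 0 < var_e s by exact: ps.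
set P := orthoproj W.
have Pt : P^T = P := orthoproj_tr W; have Pi : P *m P = P := orthoproj_idem W.
have PW : P *m W = W := orthoproj_id W.
have trP : \tr P = (\rank W)%:R := mxtrace_orthoproj W.
clearbody P.
have lE (x : 'cV[R]_(p + sq)) i : (((row i W)^T)^T *m x) 0 0 = (W *m x) i 0.
  by rewrite trmxK -row_mul mxE.
pose f i th := ct th s * ((((row i W)^T)^T *m col_of th) 0 0 - y i 0) ^+ 2.
have mf i : measurable_fun setT (f i).
  apply: measurable_funM; first exact: measurable_theta_cond_slice.
  by apply: measurable_funX; apply: measurable_funB => //; exact: measurable_mulmx_col.
have f0 i th : 0 <= f i th by rewrite mulr_ge0 ?theta_cond_ge0 ?sqr_ge0.
have fb i : (\int[lam]_th (f i th)%:E <=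
    (sqnorm (col i P) * var_e s + ((W *m mean s) i 0 - y i 0) ^+ 2)%:E)%E.
  apply: theta_cond_expectation => //.
  - by apply: measurable_funX; apply: measurable_funB => //; exact: measurable_mulmx_col.
  - by move=> th; exact: sqr_ge0.
  rewrite -lE; apply: gauss_moment2; first exact: Ai.
    by rewrite mulr_ge0 ?sqnorm_ge0// ltW.
  move=> x; rewrite lE.
  have -> : (W *m x) i 0 = ((col i P)^T *m (W *m x)) 0 0.
    by rewrite tr_col Pt -row_mul mulmxA PW [RHS]mxE.
  apply: (le_trans (cauchy_schwarz _ _)); rewrite -mulrA ler_wpM2l ?sqnorm_ge0//.
  rewrite sqnorm_design// mulrDr mulrCA divff ?gt_eqF// mulr1 lerDl mulr_ge0 ?(ltW v0)//.
  by apply: sumr_ge0 => j _; rewrite divr_ge0 ?sqr_ge0// ltW//; exact: ps.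
have -> : (\int[lam]_th (ct th s * sqnorm (y - W *m col_of th))%:E = \int[lam]_th (\sum_i f i th)%:E)%E.
  apply: eq_integral => th _; congr EFin; rewrite -sqnormN opprB /sqnorm mulr_sumr.
  by apply: eq_bigr => i _; rewrite /f lE !mxE.
apply: (le_trans (le_integral_sum mf f0 fb)); rewrite lee_fin.
rewrite big_split/= -mulr_suml (sum_sqnorm_col_proj Pt Pi) trP lerD2l.
apply: le_trans (sqnorm_mean_residual ps); rewrite le_eqVlt; apply/orP; left; apply/eqP.
by apply: eq_bigr => i _; rewrite !mxE.
Qed.

Let M : 'M[R]_(N, sq) := (1%:M - orthoproj X) *m Zmx Z.

Let P_r : 'M[R]_sq := orthoproj M^T.

Let P_k : 'M[R]_sq := 1%:M - P_r.

(** The kernel of [(I - P_X) Z] consists of the values of [u] that the data cannot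
    tell from 0; this is the share of coordinate [j] in its dimension. *)
Definition free_weight (j : 'I_sq) : R := sqnorm (col j P_k).

Lemma free_weight_ge0 j : 0 <= free_weight j. Proof. exact: sqnorm_ge0. Qed.

Lemma sum_free_weight :
  \sum_j free_weight j = sq%:R - (\rank ((Zmx Z)^T *m (1%:M - orthoproj X) *m Zmx Z))%:R.
Proof.
rewrite /free_weight (sum_sqnorm_col_proj (coproj_tr _) (coproj_idem _)).
rewrite /P_k raddfB/= mxtrace1 mxtrace_orthoproj mxrank_tr -(mxrank_gram M) /M.
have Qt := coproj_tr X; have Qi := coproj_idem X.
set Q := 1%:M - orthoproj X; rewrite -/Q in Qt Qi; clearbody Q.
by rewrite trmx_mul Qt !mulmxA -(mulmxA _ Q Q) Qi.
Qed.

Let proj_decomp : exists2 L : 'M[R]_(sq, N), P_r = L *m M & M *m P_r = M.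
Proof.
have [B PB] := orthoproj_factor M^T; have Pt := orthoproj_tr M^T.
exists B^T; first by rewrite -[LHS]Pt PB trmx_mul trmxK.
by rewrite -[LHS]trmxK trmx_mul Pt orthoproj_id trmxK.
Qed.

Let M_coproj (x : 'cV[R]_(p + sq)) : M *m dsubmx x = (1%:M - orthoproj X) *m (W *m x).
Proof.
have QX := coproj_mul0 X; rewrite /M; set Q := 1%:M - orthoproj X; rewrite -/Q in QX; clearbody Q.
by rewrite -{2}(vsubmxK x) /Wmx mul_row_col mulmxDr !mulmxA QX mul0mx add0r.
Qed.

Let sqnorm_M_le (x : 'cV[R]_(p + sq)) : sqnorm (M *m dsubmx x) <= sqnorm (W *m x).
Proof. by rewrite M_coproj; apply: sqnorm_proj_le; [exact: coproj_tr|exact: coproj_idem]. Qed.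

(** The component of the mean orthogonal to the kernel of [M] is bounded by the
    data. For the other one, the normal equations say that the mean is orthogonal
    to the kernel for the weights [1 / v_i]. *)
Lemma mean_rand_eff_bounded : exists2 C, 0 <= C &
  forall s, posvec s -> forall j, `|dsubmx (mean s) j 0| <= C.
Proof.
have [L PL MP] := proj_decomp.
have Kc a (k h : 'cV[R]_sq) : M *m k = 0 -> M *m h = 0 -> M *m (k + a *: h) = 0.
  by move=> k0 h0; rewrite mulmxDr -scalemxAr k0 h0 scaler0 addr0.
have [C C0 HC] := weighted_orthogonal_bound Kc.
pose B := Num.sqrt (sqnormM L * (4 * sqnorm y)).
have B0 : 0 <= B by exact: sqrtr_ge0.
exists (C * B + B); first by rewrite addr_ge0// mulr_ge0.
move=> s ps j; set m := mean s.
have ve0 : 0 < var_e s by exact: ps.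
pose e := P_r *m dsubmx m; pose k := dsubmx m - e.
have mke i : dsubmx m i 0 = k i 0 + e i 0 by rewrite !mxE subrK.
have Mk : M *m k = 0 by rewrite mulmxBr mulmxA MP subrr.
have eB i : `|e i 0| <= B.
  rewrite -ler_sqr ?nnegrE// real_normK ?num_real// /B sqr_sqrtr; last first.
    by rewrite mulr_ge0 ?sqnormM_ge0// mulr_ge0 ?sqnorm_ge0.
  apply: (le_trans (sqr_coord_le e i)); rewrite /e PL -mulmxA.
  apply: (le_trans (sqnorm_mul _ _)); rewrite ler_wpM2l ?sqnormM_ge0//.
  apply: (le_trans (sqnorm_M_le _)).
  have := sqnormD_le (W *m m - y) y; rewrite subrK => h; apply: (le_trans h).
  by have := sqnorm_mean_residual ps; rewrite -/m; lra.
rewrite mke; apply: (le_trans (ler_normD _ _)); apply: lerD => //.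
apply: (HC (fun i => (var_u s (tagnat.sig1 i))^-1) k e) => //.
  by move=> i; rewrite invr_gt0; exact: ps.
move=> h Mh.
have [x Wx xh] : exists2 x : 'cV[R]_(p + sq), W *m x = 0 & dsubmx x = h.
  have [B' PB] := orthoproj_factor X.
  exists (col_mx (- (B' *m (Zmx Z *m h))) h); last by rewrite col_mxKd.
  rewrite /Wmx mul_row_col mulmxN (mulmxA X) -PB.
  by move: Mh; rewrite /M mulmxBl mul1mx mulmxBl -mulmxA => /subr0_eq <-; rewrite addNr.
have := gauss_mean_normal (c s) (Ai ps); rewrite -/m => nrm.
have : (x^T *m ((A s)^T *m (A s *m m - c s))) 0 0 = 0 by rewrite nrm mulmx0 mxE.
rewrite mulmxA -trmx_mul.
have -> : A s *m x = col_mx 0 (\col_i ((Num.sqrt (var_u s (tagnat.sig1 i)))^-1 * h i 0)).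
  rewrite /design mul_col_mx -scalemxAl Wx scaler0; congr col_mx.
  by rewrite -(vsubmxK x) xh mul_row_col mul0mx add0r mul_diag_mx; apply/colP => i; rewrite !mxE.
have -> : A s *m m - c s = col_mx ((Num.sqrt (var_e s))^-1 *: (W *m m) - (Num.sqrt (var_e s))^-1 *: y)
    (\col_i ((Num.sqrt (var_u s (tagnat.sig1 i)))^-1 * dsubmx m i 0)).
  rewrite /design /target mul_col_mx -scalemxAl opp_col_mx add_col_mx subr0; congr col_mx.
  by rewrite -{1}(vsubmxK m) mul_row_col mul0mx add0r mul_diag_mx; apply/colP => i; rewrite !mxE.
move: (dsubmx m) mke => mu mke.
rewrite tr_col_mx mul_row_col trmx0 mul0mx add0r mxE => h0; rewrite -[RHS]h0.
apply: eq_bigr => i _; rewrite -mke !mxE.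
rewrite -[in LHS](@sqr_sqrtr _ (var_u s _)); last by rewrite ltW//; exact: ps.
by rewrite expr2 invfM; ring.
Qed.

(** The component along the kernel of [M] is controlled by the law of [u], the
    orthogonal one by the likelihood. *)
Let rand_eff_coord_le s (x : 'cV[R]_(p + sq)) L j : posvec s -> P_r = L *m M ->
  dsubmx x j 0 ^+ 2 <=
  (sqnormM L * var_e s + free_weight j * \sum_i var_u s i) * sqnorm (A s *m x).
Proof.
move=> ps PL; have v0 : 0 < var_e s by exact: ps.
have vu i : 0 < var_u s i by exact: ps.
set u := dsubmx x.
have uE : u j 0 = (P_r *m u) j 0 + (P_k *m u) j 0.
  have -> : (P_r *m u) j 0 + (P_k *m u) j 0 = (P_r *m u + P_k *m u) j 0 by rewrite [RHS]mxE.
  by rewrite -mulmxDl /P_k addrC subrK mul1mx.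
have w0 i : 0 <= u i 0 ^+ 2 / var_u s (tagnat.sig1 i) by rewrite divr_ge0 ?sqr_ge0// ltW.
have sv0 : 0 <= \sum_i var_u s i by apply: sumr_ge0 => i _; exact: ltW.
rewrite uE sqnorm_design// -/u; apply: sqrrD_le.
- by rewrite mulr_ge0 ?sqnormM_ge0// ltW.
- by rewrite mulr_ge0 ?free_weight_ge0.
- by rewrite divr_ge0 ?sqnorm_ge0// ltW.
- exact: sumr_ge0.
- apply: (le_trans (sqr_coord_le _ _)); rewrite PL -mulmxA.
  apply: (le_trans (sqnorm_mul _ _)); rewrite -mulrA ler_wpM2l ?sqnormM_ge0//.
  by rewrite mulrCA divff ?gt_eqF// mulr1 sqnorm_M_le.
have -> : (P_k *m u) j 0 = ((col j P_k)^T *m u) 0 0.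
  by rewrite tr_col /P_k coproj_tr -row_mul [RHS]mxE.
apply: (le_trans (cauchy_schwarz _ _)); rewrite -mulrA ler_wpM2l ?sqnorm_ge0//.
rewrite mulr_sumr; apply: ler_sum => i _.
rewrite mulrCA ler_peMr ?sqr_ge0// ler_pdivlMr// mul1r.
by rewrite (bigD1 (tagnat.sig1 i))//= lerDl sumr_ge0// => l _; exact: ltW.
Qed.

Lemma expected_rand_eff : exists C1 C2, [/\ 0 <= C1, 0 <= C2 &
  forall s i, posvec s -> (\int[lam]_th (ct th s * sqnorm (rand_eff_block th i))%:E <=
    ((\sum_k free_weight (tagnat.Rank i k)) * (\sum_l var_u s l) + C1 * var_e s + C2)%:E)%E].
Proof.
have [L PL _] := proj_decomp.
have [C C0 Cm] := mean_rand_eff_bounded.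
exists (sq%:R * sqnormM L), (sq%:R * C ^+ 2); split.
- by rewrite mulr_ge0 ?sqnormM_ge0.
- by rewrite mulr_ge0 ?sqr_ge0.
move=> s i ps; have v0 : 0 < var_e s by exact: ps.
have sv0 : 0 <= \sum_i var_u s i by apply: sumr_ge0 => l _; rewrite ltW//; exact: ps.
pose j (k : 'I_(q i)) : 'I_(p + sq) := rshift p (@tagnat.Rank r q i k).
pose l k : 'cV[R]_(p + sq) := delta_mx (j k) 0.
have lE k (x : 'cV[R]_(p + sq)) : ((l k)^T *m x) 0 0 = dsubmx x (tagnat.Rank i k) 0.
  by rewrite /l trmx_delta -rowE !mxE.
pose f k th := ct th s * ((((l k)^T *m col_of th) 0 0 - 0) ^+ 2).
have ml k : measurable_fun setT (fun th : parT => (((l k)^T *m col_of th) 0 0 - 0) ^+ 2).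
  by apply: measurable_funX; apply: measurable_funB => //; exact: measurable_mulmx_col.
have mf k : measurable_fun setT (f k).
  by apply: measurable_funM; [exact: measurable_theta_cond_slice|exact: ml].
have f0 k th : 0 <= f k th by rewrite mulr_ge0 ?theta_cond_ge0 ?sqr_ge0.
have fb k : (\int[lam]_th (f k th)%:E <= (free_weight (tagnat.Rank i k) * (\sum_l var_u s l) +
    (sqnormM L * var_e s + C ^+ 2))%:E)%E.
  apply: theta_cond_expectation => //; first by move=> th; exact: sqr_ge0.
  apply: (le_trans (gauss_moment2 (c s) (Ai ps) (C := sqnormM L * var_e s +
    free_weight (tagnat.Rank i k) * \sum_i var_u s i) _ _ _)).
  - by rewrite addr_ge0 ?mulr_ge0 ?sqnormM_ge0 ?free_weight_ge0// ltW.
  - by move=> x; rewrite lE; exact: rand_eff_coord_le.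
  rewrite lee_wpmul2r ?(ltW (integral_gauss_gt0 _ _))// lee_fin subr0 lE.
  have : dsubmx (mean s) (tagnat.Rank i k) 0 ^+ 2 <= C ^+ 2.
    by rewrite -real_normK ?num_real// ler_sqr ?nnegrE// Cm.
  by lra.
have -> : (\int[lam]_th (ct th s * sqnorm (rand_eff_block th i))%:E =
    \int[lam]_th (\sum_k f k th)%:E)%E.
  apply: eq_integral => th _; congr EFin; rewrite /sqnorm mulr_sumr.
  by apply: eq_bigr => k _; rewrite /f lE subr0 rand_eff_blockE !mxE.
apply: (le_trans (le_integral_sum mf f0 fb)); rewrite lee_fin.
rewrite big_split/= -mulr_suml -addrA lerD2l sumr_const card_ord -[leLHS]mulr_natl.
have qs : ((q i)%:R : R) <= sq%:R by rewrite ler_nat (bigD1 i)//= leq_addr.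
have h : 0 <= sqnormM L * var_e s + C ^+ 2 by rewrite addr_ge0 ?sqr_ge0// mulr_ge0 ?sqnormM_ge0// ltW.
by apply: (le_trans (ler_wpM2r h qs)); rewrite mulrDr mulrA.
Qed.

(** The columns of the design matrix for block [i] have squared norm at most
    [1 / v_i + |W|^2 / v_e]. *)
Lemma expected_neg_power s i e : posvec s -> b i = 0 -> 0 < e -> e < (q i)%:R / 2 ->
  (\int[lam]_th (ct th s * scl (lift ord0 i) th `^ (- e))%:E <=
   (((var_u s i)^-1 + sqnormM W / var_e s) `^ e *
     (Gamma ((q i)%:R / 2 - e) / Gamma ((q i)%:R / 2)))%:E)%E.
Proof.
move=> ps bi e0 eq; have v0 : 0 < var_e s by exact: ps.
have vi : 0 < var_u s i by exact: ps.
pose js := [seq rshift p (@tagnat.Rank r q i k) | k <- enum 'I_(q i)].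
have sjs : size js = q i by rewrite size_map size_enum_ord.
have ujs : uniq js.
  rewrite map_inj_uniq ?enum_uniq// => k k' /rshift_inj /tagnat.rank_inj /eqP.
  by rewrite -tag_eqE /= /tag_eq /= eqxx/= tagged_asE => /eqP.
apply: theta_cond_expectation => //.
- exact: (measurableT_comp (measurable_powR (- e)) (measurable_ig_scale _ _ _ _ _ _)).
- by move=> th; exact: powR_ge0.
have colb j : j \in js -> sqnorm (col j (A s)) <= (var_u s i)^-1 + sqnormM W / var_e s.
  move=> /mapP[k _ ->]; rewrite colE sqnorm_design// addrC lerD//.
    rewrite (bigD1 (tagnat.Rank i k))//= [X in _ + X]big1; last first.
      by move=> l lk; rewrite !mxE eq_rshift (negbTE lk) /= expr0n/= mul0r.
    by rewrite !mxE !eqxx/= expr1n addr0 mul1r tagnat.Rank1K.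
  rewrite ler_wpM2r ?invr_ge0 ?(ltW v0)//; apply: (le_trans (sqnorm_mul _ _)).
  rewrite ler_piMr ?sqnormM_ge0// /sqnorm (bigD1 (rshift p (tagnat.Rank i k)))//= [X in _ + X]big1.
    by rewrite mxE !eqxx/= expr1n addr0.
  by move=> l lk; rewrite mxE (negbTE lk) expr0n.
have kap0 : 0 < (var_u s i)^-1 + sqnormM W / var_e s.
  by rewrite ltr_wpDr ?invr_gt0// divr_ge0 ?sqnormM_ge0// ltW.
have := @gauss_neg_moment R _ _ (A s) (c s) _ e js (Ai ps) ujs colb e0.
rewrite sjs => /(_ eq kap0); rewrite mulrA; apply: le_trans.
rewrite le_eqVlt; apply/orP; left; apply/eqP; apply: eq_integral => th _.
congr (EFin (_ `^ _ * _)); rewrite ig_scaleS bi add0r; congr (_ / 2).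
by rewrite big_map big_enum /=; apply: eq_bigr => k _; rewrite rand_eff_blockE.
Qed.

End moments.

(** * The drift condition in the mixed model *)

Section split_power.
Context (R : realType).

(** [Q < 1] leaves room for [Q L^e < 1] with some [L > 1], which covers the case
    [x + y <= L x]; otherwise [x] is at most a multiple of [y]. *)
Lemma powR_split (Q e : R) : 0 < Q -> Q < 1 -> 0 < e -> exists rho D, [/\ 0 <= rho, rho < 1, 0 <= D &
  forall x y, 0 <= x -> 0 <= y -> Q * (x + y) `^ e <= rho * x `^ e + D * y `^ e].
Proof.
move=> Q0 Q1 e0; pose L := Q `^ (- (2 * e)^-1).
have e2 : 0 < (2 * e)^-1 by rewrite invr_gt0 mulr_gt0.
have L1 : 1 < L.
  rewrite /L powRN -[ltLHS]invr1 ltf_pV2 ?posrE ?powR_gt0//.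
  apply: (@lt_le_trans _ _ (1 `^ (2 * e)^-1)); last by rewrite powR1.
  by apply: gt0_ltr_powR => //; rewrite nnegrE ?ler01// ltW.
have L0 : 0 < L by exact: lt_trans L1.
have Le : L `^ e = Q `^ (- 2^-1).
  rewrite /L -powRrM; congr (_ `^ _); field.
  by rewrite gt_eqF.
exists (Q * L `^ e), (Q * (L / (L - 1)) `^ e); split.
- by rewrite mulr_ge0 ?powR_ge0// ltW.
- have -> : Q * L `^ e = Q `^ 2^-1.
    rewrite Le -[X in X * _]powRr1 ?(ltW Q0)// -powRD; last by rewrite (gt_eqF Q0) implybT.
    by congr (_ `^ _); field.
  have h0 : (0 : R) < 2^-1 by rewrite invr_gt0.
  apply: (@lt_le_trans _ _ (1 `^ 2^-1)); last by rewrite powR1.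
  by apply: gt0_ltr_powR => //; rewrite nnegrE ?ler01// ltW.
- by rewrite mulr_ge0 ?powR_ge0// ltW.
move=> x y x0 y0; rewrite -!mulrA -mulrDr ler_wpM2l ?(ltW Q0)//.
have L10 : 0 < L - 1 by rewrite subr_gt0.
have mon u v : 0 <= u -> u <= v -> u `^ e <= v `^ e.
  move=> u0 uv; apply: ge0_ler_powR => //; rewrite ?nnegrE//; first exact: ltW.
  exact: le_trans uv.
have [h|h] := leP y ((L - 1) * x).
  apply: (@le_trans _ _ ((L * x) `^ e)); first by apply: mon; [exact: addr_ge0|lra].
  by rewrite powRM// ?(ltW L0)// lerDl mulr_ge0 ?powR_ge0.
apply: (@le_trans _ _ ((L / (L - 1) * y) `^ e)).
  apply: mon; first exact: addr_ge0.
  have -> : L / (L - 1) * y = y + y / (L - 1) by field; rewrite gt_eqF.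
  by rewrite addrC lerD2l ler_pdivlMr// mulrC ltW.
have LL : 0 <= L / (L - 1) by rewrite divr_ge0// ltW.
by rewrite powRM// lerDr mulr_ge0 ?powR_ge0.
Qed.

End split_power.

Section drift.
Context (R : realType) (N p r : nat) (q : 'I_r -> nat).
Variables (X : 'M[R]_(N, p)) (Z : forall i, 'M[R]_(N, q i)) (y : 'cV[R]_N).
Variables (ae be : R) (a b : 'I_r -> R).

Local Notation sq := (\sum_i q i)%N.
Local Notation parT := (Rvec R (p + sq)).
Local Notation varT := (Rvec R r.+1).
Local Notation W := (Wmx X Z).
Local Notation lam := (@lebesgue_vec R (p + sq)).
Local Notation lamv := (@lebesgue_vec R r.+1).
Local Notation shp := (ig_shape N q ae a).
Local Notation scl := (ig_scale X Z y be b).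
Local Notation ct := (theta_cond lam scl).
Local Notation k := (gibbs_kernel lam shp scl).
Local Notation t := (\rank ((Zmx Z)^T *m (1%:M - orthoproj X) *m Zmx Z)).
Local Notation tau i := (\sum_k free_weight X Z (tagnat.Rank i k)).
Implicit Types (th : parT) (s : varT).

Hypothesis r_ge1 : (1 <= r)%N.
Hypothesis rankX : \rank X = p.
Hypothesis condA : forall i, (a i < b i /\ b i = 0) \/ 0 < b i.
Hypothesis condB : forall i, sq%:R - t%:R + 2 < (q i)%:R + 2 * a i.
Hypothesis condC : p%:R + t%:R + 2 < N%:R + 2 * ae.
Hypothesis condD : 0 < 2 * be + SSE X Z y.

Let b_ge0 i : 0 <= b i.
Proof. by case: (condA i) => [[_ ->]|/ltW]. Qed.

Let t_le : (t%:R : R) <= sq%:R.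
Proof. by rewrite ler_nat rank_leq_col. Qed.

Let kappa : R := sq%:R - t%:R.

Let kappa_ge0 : 0 <= kappa. Proof. by rewrite subr_ge0. Qed.

Let q2a i : kappa < (q i)%:R + 2 * a i - 2.
Proof. by have := condB i; rewrite /kappa; lra. Qed.

Let q_gt0 i : b i = 0 -> (0 < q i)%N.
Proof.
move=> bi; case: (condA i) => [[]|]; rewrite bi ?ltxx// => ai _.
have := q2a i; have := kappa_ge0; rewrite lt0n => h1 h2; apply/negP => /eqP qi.
by move: h2; rewrite qi; lra.
Qed.

Let df : R := N%:R + 2 * ae - 2.

Let rank_df : (\rank W)%:R < df.
Proof.
have := rank_row_mx_coproj X (Zmx Z); rewrite rankX -(ler_nat R) natrD => h.
by apply: (le_lt_trans h); rewrite /df; have := condC; lra.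
Qed.

Let df_gt0 : 0 < df. Proof. exact: le_lt_trans rank_df. Qed.

Let shape_gt1 j : 1 < shp j.
Proof.
case: (unliftP ord0 j) => [i|] ->.
  by rewrite ig_shapeS; have := q2a i; have := kappa_ge0; lra.
by rewrite ig_shape0; have := df_gt0; rewrite /df; lra.
Qed.

Let shape_gt0 j : 0 < shp j. Proof. exact: lt_trans (shape_gt1 j). Qed.

Let moment x j e : posvec x.2 -> e < shp j ->
  (\int[(lam \x lamv)%E]_z (k z x * (tnth z.2 j : R) `^ e)%:E =
   (Gamma (shp j - e) / Gamma (shp j))%:E * \int[lam]_th (ct th x.2 * scl j th `^ e)%:E)%E.
Proof.
apply: gibbs_kernel_moment => //.
- by move=> i th; exact: ig_scale_ge0.
- by move=> i; exact: measurable_ig_scale.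
- by move=> i; exact: ig_scale_negligible.
- by move=> s; exact: energy_mass_gt0.
- by move=> s; exact: energy_mass_lty.
Qed.

Let moment_le x j e B : posvec x.2 -> e < shp j ->
  (\int[lam]_th (ct th x.2 * scl j th `^ e)%:E <= B%:E)%E ->
  (\int[(lam \x lamv)%E]_z (k z x * (tnth z.2 j : R) `^ e)%:E <=
    (Gamma (shp j - e) / Gamma (shp j) * B)%:E)%E.
Proof.
move=> px ej hB; rewrite moment// [leRHS]EFinM lee_wpmul2l// lee_fin divr_ge0// ltW// Gamma_gt0//.
by rewrite subr_gt0.
Qed.

Let Gamma_pred j : Gamma (shp j - 1) / Gamma (shp j) = (shp j - 1)^-1.
Proof.
have h : 0 < shp j - 1 by rewrite subr_gt0.
rewrite -[in X in _ / X](subrK 1 (shp j)) GammaS//.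
by field; rewrite !gt_eqF// Gamma_gt0.
Qed.

Let mean_le x j B : posvec x.2 ->
  (\int[lam]_th (ct th x.2 * scl j th)%:E <= B%:E)%E ->
  (\int[(lam \x lamv)%E]_z (k z x * (tnth z.2 j : R) `^ 1)%:E <= (B / (shp j - 1))%:E)%E.
Proof.
move=> px hB; rewrite [B / _]mulrC -Gamma_pred; apply: moment_le => //.
rewrite (_ : (\int[lam]_th _ = \int[lam]_th (ct th x.2 * scl j th)%:E)%E)//.
by apply: eq_integral => th _; rewrite powRr1// ig_scale_ge0.
Qed.

(** The absolute value is for [u = be], which may be negative. *)
Let ct_affine s (h : parT -> R) u B j : posvec s -> measurable_fun setT h ->
  (forall th, 0 <= h th) -> scl j = (fun th => u + h th / 2) ->
  (\int[lam]_th (ct th s * h th)%:E <= B%:E)%E ->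
  (\int[lam]_th (ct th s * scl j th)%:E <= (`|u| + B / 2)%:E)%E.
Proof.
move=> ps mh h0 sj hB.
have mc := measurable_theta_cond_slice Z y be b rankX ps.
have c0 th := theta_cond_ge0 Z y be b rankX th ps.
apply: (@le_trans _ _ (\int[lam]_th (ct th s * `|u| + 2^-1 * (ct th s * h th))%:E)%E).
  apply: ge0_le_integral => //.
  - by move=> th _; rewrite lee_fin mulr_ge0// ig_scale_ge0.
  - by apply/measurable_EFinP; apply: measurable_funM => //; exact: measurable_ig_scale.
  - apply/measurable_EFinP; apply: measurable_funD; first exact: measurable_funM.
    by apply: measurable_funM => //; exact: measurable_funM.
  - move=> th _; rewrite lee_fin sj [leRHS](_ : _ = ct th s * (`|u| + h th / 2)); last by ring.
    by rewrite ler_wpM2l// lerD2r ler_norm.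
apply: le_integralD.
- exact: measurable_funM.
- by apply: measurable_funM => //; exact: measurable_funM.
- by move=> th; rewrite mulr_ge0.
- by move=> th; apply: mulr_ge0 => //; exact: mulr_ge0.
- by apply: le_theta_cond_cst => // th; rewrite normr_ge0 lexx.
- rewrite [B / 2]mulrC; apply: le_integralZ => //; first exact: measurable_funM.
  by move=> th; rewrite mulr_ge0.
Qed.

Let drift_e x : posvec x.2 ->
  (\int[(lam \x lamv)%E]_z (k z x * (tnth z.2 ord0 : R) `^ 1)%:E <=
    ((\rank W)%:R / df * (tnth x.2 ord0 : R) + (2 * `|be| + sqnorm y) / df)%:E)%E.
Proof.
move=> px.
have mres : measurable_fun setT (fun th : parT => sqnorm (y - W *m col_of th)).
  have -> : (fun th : parT => sqnorm (y - W *m col_of th)) = fun th => sqnorm (W *m col_of th - y).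
    by apply/funext => th; rewrite -sqnormN opprB.
  exact: measurable_sqnorm_affine.
have sE : scl ord0 = fun th => be + sqnorm (y - W *m col_of th) / 2.
  by apply/funext => th; rewrite ig_scale0.
have hr := expected_residual Z y be b rankX px.
apply: le_trans (mean_le px (ct_affine px mres (fun th => sqnorm_ge0 _) sE hr)) _.
rewrite lee_fin le_eqVlt; apply/orP; left; apply/eqP.
have -> : shp ord0 - 1 = df / 2 by rewrite ig_shape0 /df; field.
by rewrite /var_e; field; rewrite gt_eqF.
Qed.

Let drift_eN (e : 'I_r -> R) : (forall i, 0 < e i) -> exists2 C, 0 <= C &
  forall x i, posvec x.2 ->
    (\int[(lam \x lamv)%E]_z (k z x * (tnth z.2 ord0 : R) `^ (- e i))%:E <= C%:E)%E.
Proof.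
move=> e0; pose delta := be + SSE X Z y / 2.
have d0 : 0 < delta by exact: delta_gt0.
pose C i := Gamma (shp ord0 - - e i) / Gamma (shp ord0) * delta `^ (- e i).
have C0 i : 0 <= C i.
  rewrite mulr_ge0 ?powR_ge0// divr_ge0 ?ltW ?Gamma_gt0//.
  by rewrite opprK addr_gt0.
exists (\sum_i C i); first exact: sumr_ge0.
move=> x i px; apply: (@le_trans _ _ (C i)%:E); last first.
  by rewrite lee_fin (bigD1 i)//= lerDl sumr_ge0.
apply: moment_le => //.
  by rewrite (@lt_trans _ _ 0)// oppr_lt0.
apply: le_theta_cond_cst => //.
- apply: (measurableT_comp (measurable_powR (- e i))); exact: measurable_ig_scale.
- move=> th; rewrite powR_ge0/=; have sd := ig_scale0_ge X Z y be b th.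
  have s0 : 0 < scl ord0 th by exact: lt_le_trans sd.
  rewrite !powRN lef_pV2 ?posrE ?powR_gt0//.
  by apply: ge0_ler_powR => //; rewrite ?nnegrE; exact: ltW.
Qed.

(** All the [q_i + 2 a_i - 2] are at least some [m > q - t], and the free weights
    add up to [q - t]. *)
Let drift_u : exists (alpha : 'I_r -> R) beta C, [/\ 0 <= beta, 0 <= C, \sum_i alpha i < 1 &
  forall x i, posvec x.2 ->
    (\int[(lam \x lamv)%E]_z (k z x * (tnth z.2 (lift ord0 i) : R) `^ 1)%:E <=
      (alpha i * (\sum_l (tnth x.2 (lift ord0 l) : R)) + beta * (tnth x.2 ord0 : R) + C)%:E)%E].
Proof.
have [C1 [C2 [C10 C20 HC]]] := expected_rand_eff Z y be b rankX.
(* The default value of the minimum only has to exceed [kappa]. *)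
pose m := \big[Num.min/kappa + 1]_i ((q i)%:R + 2 * a i - 2).
have mk : kappa < m.
  by apply: lt_bigmin => //; rewrite ltrDl.
have m0 : 0 < m by exact: le_lt_trans mk.
have mi i : m <= (q i)%:R + 2 * a i - 2 by exact: bigmin_le.
have bs i : b i <= \sum_l b l by rewrite (bigD1 i)//= lerDl sumr_ge0.
have bs0 : 0 <= \sum_l b l by exact: sumr_ge0.
exists (fun i => tau i / m), (C1 / m), ((2 * (\sum_l b l) + C2) / m); split.
- by rewrite divr_ge0// ltW.
- by rewrite divr_ge0 ?(ltW m0)// addr_ge0// mulr_ge0.
- by rewrite -mulr_suml -sum_blocks sum_free_weight ltr_pdivrMr// mul1r.
move=> x i px.
have mblk : measurable_fun setT (fun th : parT => sqnorm (rand_eff_block th i)).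
  have -> : (fun th : parT => sqnorm (rand_eff_block th i)) =
      fun th => \sum_k (tnth th (rshift p (tagnat.Rank i k)) : R) ^+ 2.
    by apply/funext => th; apply: eq_bigr => l _; rewrite rand_eff_blockE.
  by apply: measurable_sum => l; apply: measurable_funX; exact: measurable_tnth.
have sE : scl (lift ord0 i) = fun th => b i + sqnorm (rand_eff_block th i) / 2.
  by apply/funext => th; rewrite ig_scaleS.
apply: le_trans (mean_le px (ct_affine px mblk (fun th => sqnorm_ge0 _) sE (HC _ i px))) _.
set T := tau i * _ + _ + _.
have T0 : 0 <= T.
  rewrite /T !addr_ge0 ?mulr_ge0//; last by rewrite ltW//; exact: px.
  - by apply: sumr_ge0 => l _; exact: free_weight_ge0.
  - by apply: sumr_ge0 => l _; rewrite ltW//; exact: px.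
rewrite lee_fin ger0_norm//.
have -> : shp (lift ord0 i) - 1 = ((q i)%:R + 2 * a i - 2) / 2 by rewrite ig_shapeS; field.
have n0 : 0 < (q i)%:R + 2 * a i - 2 by exact: lt_le_trans (mi i).
have -> : (b i + T / 2) / (((q i)%:R + 2 * a i - 2) / 2) = (2 * b i + T) / ((q i)%:R + 2 * a i - 2).
  by field; rewrite gt_eqF.
apply: (@le_trans _ _ ((2 * (\sum_l b l) + T) / m)); last first.
  by rewrite /T /var_e /var_u le_eqVlt; apply/orP; left; apply/eqP; field; rewrite gt_eqF.
apply: ler_pM; rewrite ?invr_ge0 ?(ltW n0)//.
- by rewrite addr_ge0// mulr_ge0.
- by rewrite lerD2r ler_wpM2l.
- by rewrite lef_pV2 ?posrE.
Qed.

(** If [b i > 0], the scale is bounded below and the exponent 1 will do. If [b i = 0],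
    the exponent [- a_i / 2] makes the arguments of the gamma functions produced by
    the two half-steps agree, at the midpoint of [q_i/2 + a_i] and [q_i/2]. *)
Let drift_uN : exists e rho D : 'I_r -> R, exists2 C, 0 <= C &
  [/\ forall i, 0 < e i, forall i, rho i < 1, forall i, 0 <= D i &
  forall x i, posvec x.2 ->
    (\int[(lam \x lamv)%E]_z (k z x * (tnth z.2 (lift ord0 i) : R) `^ (- e i))%:E <=
      (rho i * (tnth x.2 (lift ord0 i) : R) `^ (- e i) +
       D i * (tnth x.2 ord0 : R) `^ (- e i) + C)%:E)%E].
Proof.
have hex i : exists w : (R * R) * (R * R), [/\ 0 < w.1.1, w.1.2 < 1, 0 <= w.2.1, 0 <= w.2.2 &
    forall x, posvec x.2 ->
    (\int[(lam \x lamv)%E]_z (k z x * (tnth z.2 (lift ord0 i) : R) `^ (- w.1.1))%:E <=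
      (w.1.2 * (tnth x.2 (lift ord0 i) : R) `^ (- w.1.1) +
       w.2.1 * (tnth x.2 ord0 : R) `^ (- w.1.1) + w.2.2)%:E)%E].
  case: (condA i) => [[ab b0]|bi].
    have ai : a i < 0 by rewrite -b0.
    have qa : 0 < (q i)%:R + 2 * a i by have := q2a i; have := kappa_ge0; lra.
    pose e := - a i / 2; have e0 : 0 < e by rewrite /e; lra.
    have eg : e < (q i)%:R / 2 by rewrite /e; lra.
    pose g1 : R := (q i)%:R / 2 + a i; pose g2 : R := (q i)%:R / 2.
    have g10 : 0 < g1 by rewrite /g1; lra.
    have g12 : g1 < g2 by rewrite /g1 /g2; lra.
    have g20 : 0 < g2 by exact: lt_trans g12.
    have mid := Gamma_midpoint g10 g12.
    pose G := Gamma ((g1 + g2) / 2).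
    have G0 : 0 < G by apply: Gamma_gt0; rewrite divr_gt0// addr_gt0.
    have GG : 0 < Gamma g1 * Gamma g2 by apply: mulr_gt0; exact: Gamma_gt0.
    have Q0 : 0 < G ^+ 2 / (Gamma g1 * Gamma g2).
      exact: divr_gt0 (exprn_gt0 2 G0) GG.
    have Q1 : G ^+ 2 / (Gamma g1 * Gamma g2) < 1 by rewrite ltr_pdivrMr// mul1r.
    have [rho [D [rho0 rho1 D0 split]]] := powR_split Q0 Q1 e0.
    exists ((e, rho), (D * sqnormM W `^ e, 0)); split => //=.
      by rewrite mulr_ge0 ?powR_ge0.
    move=> x px; have ve0 : 0 < var_e x.2 by exact: px.
    have vi0 : 0 < var_u x.2 i by exact: px.
    have ng : - e < shp (lift ord0 i).
      by apply: (@lt_trans _ _ 0); [rewrite oppr_lt0|exact: shape_gt0].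
    apply: (le_trans (moment_le px ng (expected_neg_power Z y be rankX px b0 e0 eg))).
    have -> : shp (lift ord0 i) - - e = (g1 + g2) / 2.
      by rewrite ig_shapeS /e /g1 /g2; field.
    have -> : (q i)%:R / 2 - e = (g1 + g2) / 2 by rewrite /e /g1 /g2; field.
    rewrite ig_shapeS -/g1 -/g2 -/G lee_fin addr0.
    have vi1 : 0 <= (var_u x.2 i)^-1 by rewrite invr_ge0 ltW.
    have ve1 : 0 <= sqnormM W / var_e x.2 by rewrite divr_ge0 ?sqnormM_ge0// ltW.
    have := split _ _ vi1 ve1.
    have -> : (var_u x.2 i)^-1 `^ e = var_u x.2 i `^ (- e).
      by rewrite -powR_inv1 ?(ltW vi0)// -powRrM mulN1r.
    have -> : (sqnormM W / var_e x.2) `^ e = sqnormM W `^ e * var_e x.2 `^ (- e).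
      rewrite powRM ?sqnormM_ge0 ?invr_ge0 ?(ltW ve0)//; congr (_ * _).
      by rewrite -powR_inv1 ?(ltW ve0)// -powRrM mulN1r.
    move=> h; apply: le_trans (le_trans h _); last by rewrite mulrA.
    rewrite le_eqVlt; apply/orP; left; apply/eqP.
    have := Gamma_gt0 g10; have := Gamma_gt0 g20.
    move: (Gamma g1) (Gamma g2) (Gamma _) => u v w v0 u0.
    by field; rewrite (gt_eqF u0) (gt_eqF v0).
  pose C := Gamma (shp (lift ord0 i) - - 1) / Gamma (shp (lift ord0 i)) * b i `^ (- 1).
  exists ((1, 0), (0, C)); split => //=.
    by rewrite mulr_ge0 ?powR_ge0// divr_ge0 ?ltW ?Gamma_gt0// opprK addr_gt0.
  move=> x px; rewrite !mul0r !add0r; apply: moment_le => //.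
    by rewrite (@lt_trans _ _ 0)// oppr_lt0.
  apply: le_theta_cond_cst => //.
  - apply: (measurableT_comp (measurable_powR (- 1))); exact: measurable_ig_scale.
  - move=> th; rewrite powR_ge0/=; have sd := ig_scaleS_ge X Z y be b i th.
    have s0 : 0 < scl (lift ord0 i) th by exact: lt_le_trans sd.
    rewrite !powRN lef_pV2 ?posrE ?powR_gt0//.
    by apply: ge0_ler_powR => //; rewrite ?nnegrE; exact: ltW.
have [w hw] := choice hex.
exists (fun i => (w i).1.1), (fun i => (w i).1.2), (fun i => (w i).2.1), (\sum_i (w i).2.2).
  by apply: sumr_ge0 => i _; have [] := hw i.
split.
- by move=> i; have [] := hw i.
- by move=> i; have [] := hw i.
- by move=> i; have [] := hw i.
move=> x i px; have [_ _ _ _ h] := hw i; apply: (le_trans (h x px)).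
rewrite lee_fin lerD2l (bigD1 i)//= lerDl; apply: sumr_ge0 => l _.
by have [] := hw l.
Qed.

Lemma gibbs_ergodicity : gibbs_geometrically_ergodic X Z y ae be a b.
Proof.
pose rhoe : R := (\rank W)%:R / df.
have rhoe1 : rhoe < 1 by rewrite ltr_pdivrMr// mul1r.
have [alpha [beta [C2 [beta0 C20 alpha1 mu_]]]] := drift_u.
have [e [rho [D [C3 C30 [e0 rho1 D0 muN]]]]] := drift_uN.
have [C4 C40 meN] := drift_eN e0.
pose C1 := (2 * `|be| + sqnorm y) / df.
have C10 : 0 <= C1 by rewrite divr_ge0 ?(ltW df_gt0)// addr_ge0 ?mulr_ge0 ?sqnorm_ge0.
(* These weights make [gamA] and [gamB] hold as soon as [gam] is at least
   [(1 + rhoe) / 2] and 1/2. *)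
pose A := 2 * beta / (1 - rhoe) + 1; pose B i := 2 * D i + 1.
have r1 : 0 < 1 - rhoe by rewrite subr_gt0.
have A1 : 1 <= A by rewrite /A lerDr divr_ge0 ?mulr_ge0// ltW.
have B1 i : 1 <= B i by rewrite /B lerDr mulr_ge0.
pose gam := \big[Num.max/Num.max (Num.max 2^-1 ((1 + rhoe) / 2)) (\sum_i alpha i)]_i rho i.
have gam1 : gam < 1.
  apply: bigmax_lt => [|i _]; last exact: rho1.
  by rewrite !gt_max alpha1 andbT; apply/andP; split; lra.
have gamx : Num.max (Num.max 2^-1 ((1 + rhoe) / 2)) (\sum_i alpha i) <= gam by exact: bigmax_ge_id.
move: gamx; rewrite !ge_max => /andP[/andP[gam2 game] gam_alpha].
have gam_rho i : rho i <= gam by exact: le_bigmax.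
have gam0 : 0 <= gam by apply: le_trans gam2.
have gamA : A * rhoe + beta <= gam * A.
  have Ae : A * (1 - rhoe) = 2 * beta + (1 - rhoe) by rewrite /A; field; rewrite gt_eqF.
  apply: (@le_trans _ _ ((1 + rhoe) / 2 * A)); last first.
    by rewrite ler_wpM2r// (le_trans _ A1).
  by move: Ae r1; lra.
have gamB i : D i <= gam * B i.
  apply: (@le_trans _ _ (2^-1 * B i)); first by rewrite /B; lra.
  by rewrite ler_wpM2r// (le_trans _ (B1 i)).
have md j := measurable_ig_scale X Z y be b j.
have d0 j th := ig_scale_ge0 (X := X) (Z := Z) b_ge0 condD j th.
have mg s := energy_mass_gt0 X Z y be b (s := s).
have ml s := energy_mass_lty Z y be b rankX (s := s).
have nu0 := lebesgue_vec_setT_neq0 R (p + sq).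
have negl j := ig_scale_negligible (X := X) (Z := Z) b_ge0 q_gt0 condD j.
have k0 z x : 0 <= k z x.
  have [px|px] := pselect (posvec x.2); last by rewrite /gibbs_kernel (pos0 px) mulr0.
  have c1 := ltW (theta_cond_gt0 mg ml z.1 px).
  by apply: mulr_ge0 => //; apply: mulr_ge0 => //; apply: mulr_ge0 => //; exact: var_cond_ge0.
have kpos z x : ~ posvec z.2 -> k z x = 0 by move=> pz; rewrite /gibbs_kernel (pos0 pz) mulr0 mul0r.
have mk x : measurable_fun setT (fun z => k z x).
  exact: (measurableT_comp (measurable_gibbs_kernel lam shp md) (pair2_measurable x)).
have [K K0 drift] := lyapunov_drift A1 B1 mk k0 kpos (And4 C10 C20 C30 C40)
  (fun x px => drift_e px) mu_ muN meN gamA gam_alpha gam_rho gamB.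
have kap0 : 0 < normalization R N q.
  by rewrite mulr_gt0// invr_gt0 sqrtr_gt0 exprn_gt0// mulr_gt0// pi_gt0.
have [jfin jgeo] := gibbs_core_geometric shape_gt0 d0 md kap0 nu0 negl mg ml
  (measurable_lyapunov A B e) (lyapunov_ge0 e A1 B1) drift gam0 gam1 K0
  (lyapunov_boxes _ A1 B1 e0 r_ge1).
have margE : marginal X Z y ae be a b =
    (\int[(lam \x lamv)%E]_z (joint_density shp scl (normalization R N q) z.1 z.2)%:E)%E.
  have mj := measurable_joint_density shp (normalization R N q) md.
  have mjE : measurable_fun setT (fun z : parT * varT =>
      (joint_density shp scl (normalization R N q) z.1 z.2)%:E) by exact/measurable_EFinP.
  have j0 (z : parT * varT) : (0 <= (joint_density shp scl (normalization R N q) z.1 z.2)%:E)%E.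
    by rewrite lee_fin; exact: joint_density_ge0.
  rewrite (@fubini_tonelli2 _ _ _ _ _ lam lamv _ mjE j0) /marginal integral_mkcond.
  apply: eq_integral => s _; rewrite patchE /fubini_G/=.
  case: ifPn => [_|/negP ns]; first by apply: eq_integral => th _; rewrite upostE.
  have ps : ~ posvec s by move=> ps; apply: ns; exact/mem_set.
  by under eq_integral do rewrite joint_density0//; rewrite integral0.
split; first by rewrite /posterior_proper margE.
apply: eq_geometric_tv_bound jgeo.
- move=> z x [_ pz] [_ px]; rewrite /gibbs_kernel (pos1 pz) (pos1 px) !mulr1 /gibbs_density.
  by rewrite cond_varE// cond_thetaE.
- move=> E; rewrite /posterior margE; apply: eq_integral => z _.
  by rewrite upostE.
Qed.

End drift.

Theorem corollary1 (R : realType) (N p r : nat) (q : 'I_r -> nat)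
    (X : 'M[R]_(N, p)) (Z : forall i : 'I_r, 'M[R]_(N, q i)) (y : 'cV[R]_N)
    (ae be : R) (a b : 'I_r -> R)
    (r_ge1 : (1 <= r)%N) (rankX : \rank X = p) :
  let t := \rank ((Zmx Z)^T *m (1%:M - orthoproj X) *m Zmx Z) in
  (forall i, (a i < b i /\ b i = 0) \/ 0 < b i) ->
  (forall i, (\sum_j q j)%:R - t%:R + 2 < (q i)%:R + 2 * a i) ->
  p%:R + t%:R + 2 < N%:R + 2 * ae ->
  0 < 2 * be + SSE X Z y ->
  gibbs_geometrically_ergodic X Z y ae be a b.
Proof.
move=> t condA condB condC condD; exact: gibbs_ergodicity.
Qed.
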